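(* Let $E\to M$ be a vector bundle. There is a one-to-one correspondence between isomorphism classes of exact $E$-Courant algebroids and equivalence classes of admissible pairs of the omni-Lie algebroid $\mathcal E=\mathfrak DE\oplus\mathfrak JE$. More precisely: (i) For any exact $E$-Courant algebroid $(\mathcal K,(\cdot,\cdot)_E,[\cdot,\cdot]_{\mathcal K},\rho)$, one may identify $\mathcal K=\mathfrak DE\oplus\mathfrak JE$ and take $\rho$ as the projection to $\mathfrak DE$, and then there is a corresponding admissible pair $(\omega,\Theta)$ such that for all $\mathfrak d+\mu,\mathfrak r+\nu\in\Gamma(\mathfrak DE\oplus\mathfrak JE)$ $$(\mathfrak d+\mu,\mathfrak r+\nu)_E=\tfrac12(\langle\mathfrak d,\nu\rangle_E+\langle\mathfrak r,\mu\rangle_E)+\omega(\mathfrak d\otimes\mathfrak r),\qquad [\mathfrak d+\mu,\mathfrak r+\nu]_{\mathcal K}=\{\mathfrak d+\mu,\mathfrak r+\nu\}+\Theta(\mathfrak d\otimes\mathfrak r),$$ where $\{\cdot,\cdot\}$ is the standard bracket of the omni-Lie algebroid. (ii) Conversely, for any admissible pair $(\omega,\Theta)$, $(\mathfrak DE\oplus\mathfrak JE,(\cdot,\cdot)_E,[\cdot,\cdot]_{\mathcal K},\rho)$, with pairing and bracket given by the two formulas above and $\rho$ the projection to $\mathfrak DE$, is an exact $E$-Courant algebroid. (iii) Moreover, two exact $E$-Courant algebroids are isomorphic if and only if their corresponding admissible pairs are equivalent.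
   Context: **Bundles.** $\mathfrak DE$ is the gauge Lie algebroid (bundle of covariant differential operators) of $E$: its sections are the $\mathbb R$-linear $\mathfrak d:\Gamma(E)\to\Gamma(E)$ for which there is a vector field $j(\mathfrak d)$ with $\mathfrak d(fu)=f\mathfrak d(u)+j(\mathfrak d)(f)u$; bracket $[\cdot,\cdot]_{\mathfrak D}$ = commutator, anchor $j$. The first jet bundle $\mathfrak JE$ is regarded as $\{\nu\in\mathrm{Hom}(\mathfrak DE,E):\nu(\Psi)=\Psi(\nu(\mathrm{Id}_E))\ \forall\Psi\in\mathfrak{gl}(E)\}$, the jet $[u]_m$ corresponding to $\mathfrak d\mapsto\mathfrak d(u)(m)$. Write $\langle\mu,\mathfrak d\rangle_E=\langle\mathfrak d,\mu\rangle_E=\mu(\mathfrak d)$, and $\mathbf d:\Gamma(E)\to\Gamma(\mathfrak JE)$, $(\mathbf du)(\mathfrak d)=\mathfrak d(u)$. The Lie derivative on $\Gamma(\mathfrak JE)$ is $\langle\mathcal L_{\mathfrak d}\mu,\mathfrak d'\rangle_E=\mathfrak d\langle\mu,\mathfrak d'\rangle_E-\langle\mu,[\mathfrak d,\mathfrak d']_{\mathfrak D}\rangle_E$. The omni-Lie algebroid of $E$ is $\mathcal E=\mathfrak DE\oplus\mathfrak JE$ with anchor the projection to $\mathfrak DE$, standard pairing $\tfrac12(\langle\mathfrak d,\nu\rangle_E+\langle\mathfrak r,\mu\rangle_E)$ of $\mathfrak d+\mu$ and $\mathfrak r+\nu$, and standard bracket $\{\mathfrak d+\mu,\mathfrak r+\nu\}=[\mathfrak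 d,\mathfrak r]_{\mathfrak D}+\mathcal L_{\mathfrak d}\nu-\mathcal L_{\mathfrak r}\mu+\mathbf d\langle\mu,\mathfrak r\rangle_E$. **$E$-Courant algebroids.** A Leibniz algebra has a bilinear bracket with $[g_1,[g_2,g_3]]=[[g_1,g_2],g_3]+[g_2,[g_1,g_3]]$. An $E$-Courant algebroid is $(\mathcal K,(\cdot,\cdot)_E,[\cdot,\cdot]_{\mathcal K},\rho)$: $\mathcal K\to M$ a vector bundle with $(\Gamma(\mathcal K),[\cdot,\cdot]_{\mathcal K})$ a Leibniz algebra; $(\cdot,\cdot)_E:\mathcal K\otimes\mathcal K\to E$ a symmetric nondegenerate pairing, inducing an embedding $\mathcal K\hookrightarrow\mathrm{Hom}(\mathcal K,E)$; $\rho:\mathcal K\to\mathfrak DE$ a bundle map; with $\rho^\star(\nu)(k)=\nu(\rho(k))$, for all sections $X,Y,Z$ of $\mathcal K$: (EC-1) $\rho[X,Y]_{\mathcal K}=[\rho(X),\rho(Y)]_{\mathfrak D}$; (EC-2) $[X,X]_{\mathcal K}=\rho^\star\mathbf d(X,X)_E$; (EC-3) $\rho(X)(Y,Z)_E=([X,Y]_{\mathcal K},Z)_E+(Y,[X,Z]_{\mathcal K})_E$; (EC-4) $\rho^\star(\mathfrak JE)\subset\mathcal K$, i.e. $(\rho^\star(\mu),X)_E=\tfrac12\mu(\rho(X))$ for all $\mu\in\mathfrak JE$; (EC-5) $\rho\circ\rho^\star=0$. It is exact if $0\to\mathfrak JE\xrightarrow{\rho^\star}\mathcal K\xrightarrow{\rho}\mathfrak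 DE\to0$ is exact. **Isomorphisms.** An isomorphism of $E$-Courant algebroids $\mathcal K_1\to\mathcal K_2$ is a bundle isomorphism $F:\mathcal K_1\to\mathcal K_2$ covering a bundle automorphism $\Phi:E\to E$ such that $(F(X),F(Y))_E=\Phi(X,Y)_E$, $F[X,Y]_{\mathcal K_1}=[F(X),F(Y)]_{\mathcal K_2}$ and $\rho_2\circ F=\mathrm{Ad}_\Phi\circ\rho_1$, where $\mathrm{Ad}_\Phi(\mathfrak d)=\Phi\circ\mathfrak d\circ\Phi^{-1}$. **Leibniz cochains.** The Lie algebra $\Gamma(\mathfrak DE)$, viewed as a Leibniz algebra, acts on $\Gamma(\mathfrak JE)$ from the left by $\{\mathfrak d,\nu\}=\mathcal L_{\mathfrak d}\nu$ and from the right by $\{\mu,\mathfrak r\}=-\mathcal L_{\mathfrak r}\mu+\mathbf d\langle\mu,\mathfrak r\rangle_E$. With $\partial$ the coboundary operator of the corresponding Leibniz cohomology, for $b\in\Gamma(\mathrm{Hom}(\mathfrak DE,\mathfrak JE))$, $$\partial b(\mathfrak d,\mathfrak r)=\mathcal L_{\mathfrak d}b(\mathfrak r)-\mathcal L_{\mathfrak r}b(\mathfrak d)+\mathbf d\langle b(\mathfrak d),\mathfrak r\rangle_E-b([\mathfrak d,\mathfrak r]_{\mathfrak D}),$$ and $\Theta\in\Gamma(\mathrm{Hom}(\otimes^2\mathfrak DE,\mathfrak JE))$ is a 2-cocycle ($\partial\Theta=0$) if for all $\mathfrak d,\mathfrak r,\mathfrak t\in\Gamma(\mathfrak DE)$ $$\mathcal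 L_{\mathfrak d}\Theta(\mathfrak r,\mathfrak t)-\mathcal L_{\mathfrak r}\Theta(\mathfrak d,\mathfrak t)+\mathcal L_{\mathfrak t}\Theta(\mathfrak d,\mathfrak r)-\mathbf d\langle\mathfrak t,\Theta(\mathfrak d,\mathfrak r)\rangle_E+\Theta(\mathfrak d,[\mathfrak r,\mathfrak t]_{\mathfrak D})-\Theta(\mathfrak r,[\mathfrak d,\mathfrak t]_{\mathfrak D})-\Theta([\mathfrak d,\mathfrak r]_{\mathfrak D},\mathfrak t)=0.$$ **Admissible pairs.** Given a symmetric bundle map $\omega:\mathfrak DE\otimes\mathfrak DE\to E$ and $\Theta\in\Gamma(\mathrm{Hom}(\otimes^2\mathfrak DE,\mathfrak JE))$ (a bundle map $\mathfrak DE\otimes\mathfrak DE\to\mathfrak JE$), the pair $(\omega,\Theta)$ is an admissible pair of the omni-Lie algebroid if: 1) $\Theta$ is a 2-cocycle of the Leibniz cohomology of $\Gamma(\mathfrak DE)$ with coefficients in $\Gamma(\mathfrak JE)$; 2) $\Theta(\mathfrak d\otimes\mathfrak d)=\mathbf d(\omega(\mathfrak d\otimes\mathfrak d))$ for all $\mathfrak d\in\Gamma(\mathfrak DE)$; 3) $\tfrac12\mathfrak d\,\omega(\mathfrak r\otimes\mathfrak r)=(\Theta(\mathfrak d\otimes\mathfrak r),\mathfrak r)_E+\omega([\mathfrak d,\mathfrak r]_{\mathfrak D}\otimes\mathfrak r)$ for all $\mathfrak d,\mathfrak r\in\Gamma(\mathfrak DE)$, where $(\cdot,\cdot)_E$ is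 the standard pairing, so that $(\Theta(\mathfrak d\otimes\mathfrak r),\mathfrak r)_E=\tfrac12\langle\Theta(\mathfrak d\otimes\mathfrak r),\mathfrak r\rangle_E$. Two admissible pairs $(\omega,\Theta)$, $(\widetilde\omega,\widetilde\Theta)$ are equivalent if there is $b\in\Gamma(\mathrm{Hom}(\mathfrak DE,\mathfrak JE))$ with $\widetilde\omega(\mathfrak d\otimes\mathfrak r)=\omega(\mathfrak d\otimes\mathfrak r)+\tfrac12(\langle b(\mathfrak d),\mathfrak r\rangle_E+\langle b(\mathfrak r),\mathfrak d\rangle_E)$ for all $\mathfrak d,\mathfrak r\in\Gamma(\mathfrak DE)$ and $\widetilde\Theta=\Theta+\partial b$. *)

(* Defs.v *)
From HB Require Import structures.
From mathcomp Require Import all_boot all_order all_algebra.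
From mathcomp Require Import boolp classical_sets functions reals.
From mathcomp Require Import topology normedtype derive.

Set Implicit Arguments.
Unset Strict Implicit.
Unset Printing Implicit Defensive.
Import Order.TTheory GRing.Theory Num.Theory.
Import numFieldNormedType.Exports.
Local Open Scope classical_set_scope.
Local Open Scope ring_scope.

Record submod (R : realType) (V : lmodType R) := Submod {
  smem :> V -> Prop;
  smem0 : smem 0;
  smem_lin : forall (a : R) x y, smem x -> smem y -> smem (a *: x + y) }.

Section SubmodTheory.
Variables (R : realType) (V : lmodType R) (S : submod V).

Definition spred (x : V) : bool := `[< S x >].

Lemma spred_submod : submod_closed spred.
Proof.
split; first exact/asboolP/smem0.
by move=> a x y /asboolP Sx /asboolP Sy; exact/asboolP/smem_lin.
Qed.

HB.instance Definition _ :=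
  GRing.isSubmodClosed.Build R V spred spred_submod.

Record subm := Subm { sval_of : V; _ : spred sval_of }.

HB.instance Definition _ := [isSub for sval_of].
HB.instance Definition _ := [Choice of subm by <:].
HB.instance Definition _ := [SubChoice_isSubLmodule of subm by <:].

Definition mksub (x : V) (Sx : S x) : subm := Subm (introT (asboolP _) Sx).

Lemma submP (x : subm) : S (sval_of x).
Proof. by case: x => x /= /asboolP. Qed.

Lemma sval_lin (a : R) (x y : subm) :
  sval_of (a *: x + y) = a *: sval_of x + sval_of y.
Proof. by []. Qed.

End SubmodTheory.

Section DProd.
Variables (R : realType) (T : Type) (V : T -> lmodType R).

Definition dprod := forall t, V t.

HB.instance Definition _ := gen_eqMixin dprod.
HB.instance Definition _ := gen_choiceMixin dprod.

Definition dp_add (f g : dprod) : dprod := fun t => f t + g t.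
Definition dp_opp (f : dprod) : dprod := fun t => - f t.
Definition dp_scale (a : R) (f : dprod) : dprod := fun t => a *: f t.

Lemma dp_addA : associative dp_add.
Proof. by move=> f g h; apply: functional_extensionality_dep => t; exact: addrA. Qed.
Lemma dp_addC : commutative dp_add.
Proof. by move=> f g; apply: functional_extensionality_dep => t; exact: addrC. Qed.
Lemma dp_add0 : left_id (fun t => 0 : V t) dp_add.
Proof. by move=> f; apply: functional_extensionality_dep => t; exact: add0r. Qed.
Lemma dp_addN : left_inverse (fun t => 0 : V t) dp_opp dp_add.
Proof. by move=> f; apply: functional_extensionality_dep => t; exact: addNr. Qed.
HB.instance Definition _ :=
  GRing.isZmodule.Build dprod dp_addA dp_addC dp_add0 dp_addN.

Lemma dp_scaleA a b f : dp_scale a (dp_scale b f) = dp_scale (a * b) f.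
Proof. by apply: functional_extensionality_dep => t; exact: scalerA. Qed.
Lemma dp_scale1 : left_id 1 dp_scale.
Proof. by move=> f; apply: functional_extensionality_dep => t; exact: scale1r. Qed.
Lemma dp_scaleDr : right_distributive dp_scale +%R.
Proof. by move=> a f g; apply: functional_extensionality_dep => t; exact: scalerDr. Qed.
Lemma dp_scaleDl f : {morph dp_scale^~ f : a b / a + b}.
Proof. by move=> a b; apply: functional_extensionality_dep => t; exact: scalerDl. Qed.
HB.instance Definition _ := GRing.Zmodule_isLmodule.Build R dprod
  dp_scaleA dp_scale1 dp_scaleDr dp_scaleDl.

End DProd.

Section SmoothRn.
Variables (R : realType) (n : nat).
Implicit Types (U : set 'rV[R]_n) (f g : 'rV[R]_n -> R).

Fixpoint Ck k U f : Prop :=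
  (forall x, U x -> {for x, continuous f}) /\
  match k with
  | 0%N => True
  | k'.+1 => forall i : 'I_n,
      (forall x, U x -> derivable f x (delta_mx 0 i)) /\
      Ck k' U ('D_(delta_mx 0 i) f)
  end.

Definition smooth_on U f := forall k, Ck k U f.

Lemma Ck_eq k U f g : open U -> (forall x, U x -> f x = g x) ->
  Ck k U f -> Ck k U g.
Proof.
move=> oU.
have near_fg (h1 h2 : 'rV[R]_n -> R) x : (forall y, U y -> h1 y = h2 y) -> U x ->
    \forall y \near x, h1 y = h2 y.
  move=> h12 Ux; apply: (@filterS _ (nbhs x) _ U) => [y /h12 //|].
  exact: open_nbhs_nbhs (conj oU Ux).
have cont_fg (h1 h2 : 'rV[R]_n -> R) : (forall y, U y -> h1 y = h2 y) ->
    (forall x, U x -> {for x, continuous h1}) ->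
    (forall x, U x -> {for x, continuous h2}).
  move=> h12 c1 x Ux; rewrite /prop_for /continuous_at -(h12 _ Ux).
  apply: cvg_trans (c1 x Ux).
  by apply: (@near_eq_cvg _ _ (nbhs x)); exact: near_fg.
elim: k f g => [|k IH] f g fg [cf df].
  by split=> //; exact: cont_fg cf.
split; first exact: cont_fg cf.
move=> i; have [dfi Cfi] := df i; split=> [x Ux|].
  exact: near_eq_derivable (near_fg _ _ _ fg Ux) (dfi x Ux).
apply: IH Cfi => x Ux; apply: near_eq_derive; exact: near_fg.
Qed.

Lemma Ck_pred k U f : Ck k.+1 U f -> Ck k U f.
Proof.
elim: k f => [|k IH] f [cf df]; first by split.
by split=> // i; have [dfi Cfi] := df i; split=> //; exact: IH.
Qed.

Lemma Ck_lin k U (a : R) f g : open U ->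
  Ck k U f -> Ck k U g -> Ck k U (fun x => a * f x + g x).
Proof.
move=> oU; elim: k f g => [|k IH] f g [cf df] [cg dg].
  split=> // x Ux; apply: cvgD (cg x Ux).
  by apply: cvgM (cf x Ux); exact: cvg_cst.
split=> [x Ux|i].
  by apply: cvgD (cg x Ux); apply: cvgM (cf x Ux); exact: cvg_cst.
have [dfi Cfi] := df i; have [dgi Cgi] := dg i; split=> [x Ux|].
  by apply: derivableD (dgi x Ux); apply: derivableZ; exact: dfi.
apply: Ck_eq (IH _ _ Cfi Cgi) => // x Ux.
transitivity ('D_(delta_mx 0 i) ((a *: f) + g) x); last by [].
rewrite deriveD ?deriveZ//; [exact: dfi|exact: derivableZ (dfi x Ux)|exact: dgi].
Qed.

Lemma Ck_mul k U f g : open U ->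
  Ck k U f -> Ck k U g -> Ck k U (fun x => f x * g x).
Proof.
move=> oU; elim: k f g => [|k IH] f g Cf Cg.
  case: Cf Cg => cf _ [cg _].
  by split=> // x Ux; apply: cvgM (cf x Ux) (cg x Ux).
have Cf' := Ck_pred Cf; have Cg' := Ck_pred Cg.
case: Cf Cg => cf df [cg dg].
split=> [x Ux|i]; first exact: cvgM (cf x Ux) (cg x Ux).
have [dfi Cfi] := df i; have [dgi Cgi] := dg i; split=> [x Ux|].
  by apply: derivableM; [exact: dfi|exact: dgi].
have := Ck_lin 1 oU (IH _ _ Cf' Cgi) (IH _ _ Cg' Cfi).
apply: Ck_eq => // x Ux; rewrite mul1r.
by have /= <- := deriveM (dfi x Ux) (dgi x Ux).
Qed.

Lemma Ck_cst k U (c : R) : Ck k U (fun=> c).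
Proof.
elim: k c => [|k IH] c; first by split=> // x _; exact: cst_continuous.
split=> [x _|i]; first exact: cst_continuous.
split=> [x _|]; first exact: derivable_cst.
rewrite (_ : 'D_(delta_mx 0 i) (fun=> c) = fun=> 0) //.
by apply/funext => x; exact: derive_cst.
Qed.

End SmoothRn.

Record chart (R : realType) (n : nat) (T : topologicalType) := Chart {
  cdom : set T;
  cmap : T -> 'rV[R]_n;
  cinv : 'rV[R]_n -> T;
  cdom_open : open cdom;
  cimg_open : open (cmap @` cdom);
  cmap_cont : forall x, cdom x -> {for x, continuous cmap};
  cinv_cont : forall y, (cmap @` cdom) y -> {for y, continuous cinv};
  cmapK : forall x, cdom x -> cinv (cmap x) = x }.

Record manifold (R : realType) (n : nat) := Manifold {
  mpoint :> topologicalType;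
  mhausdorff : hausdorff_space mpoint;
  msecond_countable : @second_countable mpoint;
  matlas : set (chart R n mpoint);
  matlas_cover : forall x, exists2 c, matlas c & cdom c x;
  matlas_compat : forall c c', matlas c -> matlas c' -> forall j : 'I_n,
    smooth_on (cmap c @` (cdom c `&` cdom c'))
              (fun y => cmap c' (cinv c y) 0 j) }.

Arguments matlas {R n} m.

Section SmoothFunctions.
Variables (R : realType) (n : nat) (M : manifold R n).

(* meaningful for open W *)
Definition smooth_within (W : set M) (f : M -> R) : Prop :=
  forall c, matlas M c ->
    smooth_on (cmap c @` (cdom c `&` W)) (fun y => f (cinv c y)).

Definition is_smooth (f : M -> R^o) : Prop := smooth_within setT f.

Let img_open (c : chart R n M) : open (cmap c @` (cdom c `&` setT)).
Proof. by rewrite setIT; exact: cimg_open. Qed.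

Lemma is_smooth0 : is_smooth 0.
Proof. by move=> c _ k; exact: Ck_cst. Qed.

Lemma is_smooth_lin (a : R) f g :
  is_smooth f -> is_smooth g -> is_smooth (a *: f + g).
Proof. by move=> sf sg c Ac k; apply: Ck_lin => //; [exact: sf|exact: sg]. Qed.

Lemma is_smoothM (f g : M -> R^o) :
  is_smooth f -> is_smooth g -> is_smooth (fun m => f m * g m).
Proof. by move=> sf sg c Ac k; apply: Ck_mul => //; [exact: sf|exact: sg]. Qed.

Definition Cinf := subm (Submod is_smooth0 is_smooth_lin).

Definition cev (f : Cinf) (m : M) : R := sval_of f m.

Definition cmul (f g : Cinf) : Cinf :=
  mksub (S := Submod is_smooth0 is_smooth_lin) (is_smoothM (submP f) (submP g)).

End SmoothFunctions.
Coercion cev : Cinf >-> Funclass.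

Definition smooth_map (R : realType) (n : nat) (M : manifold R n) (h : M -> M) :=
  continuous h /\
  forall c c', matlas M c -> matlas M c' -> forall j : 'I_n,
    smooth_on (cmap c @` (cdom c `&` h @^-1` cdom c'))
              (fun y => cmap c' (h (cinv c y)) 0 j).

Record diffeo (R : realType) (n : nat) (M : manifold R n) := Diffeo {
  dfun :> M -> M;
  dinv : M -> M;
  dfunK : cancel dfun dinv;
  dinvK : cancel dinv dfun;
  dfun_smooth : smooth_map dfun;
  dinv_smooth : smooth_map dinv }.

Lemma smooth_map_id (R : realType) (n : nat) (M : manifold R n) :
  smooth_map (@id M).
Proof. by split=> [x|]; [exact: cvg_id|exact: matlas_compat]. Qed.

Definition diffeo_id (R : realType) (n : nat) (M : manifold R n) : diffeo M :=
  Diffeo (fun=> erefl) (fun=> erefl) (@smooth_map_id R n M) (@smooth_map_id R n M).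

(* A family of fibres with a C^infty(M)-submodule of sections declared smooth;
   it is a vector bundle when [vector_bundle] below holds. *)
Record bundle (R : realType) (n : nat) (M : manifold R n) := Bundle {
  fib :> M -> lmodType R;
  smooth_sec : submod (dprod fib);
  smooth_secZ : forall (f : Cinf M) (s : dprod fib),
    smooth_sec s -> smooth_sec (fun m => f m *: s m) }.

Arguments smooth_sec {R n M} b.

Section Bundles.
Variables (R : realType) (n : nat) (M : manifold R n).

Record local_frame (K : bundle M) := LocalFrame {
  fdom : set M;
  frank : nat;
  frame : 'I_frank -> dprod K;
  fdom_open : open fdom;
  frame_basis : forall m, fdom m -> forall v : K m,
    exists! c : {ffun 'I_frank -> R}, v = \sum_i c i *: frame i m }.

Arguments frame {K} l _ _.

(* on W, s is a combination of the frame with smooth coefficients *)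
Definition smooth_wrt (K : bundle M) (t : local_frame K) (W : set M)
    (s : dprod K) : Prop :=
  exists c : 'I_(frank t) -> M -> R,
    (forall i, smooth_within W (c i)) /\
    (forall m, W m -> s m = \sum_i c i m *: frame t i m).

(* The rank is locally constant, as on any locally trivial bundle. *)
Definition vector_bundle (K : bundle M) : Prop :=
  exists A : set (local_frame K),
    [/\ forall m, exists2 t, A t & fdom t m,
        forall t t', A t -> A t' -> forall i,
          smooth_wrt t' (fdom t `&` fdom t') (frame t i)
      & forall s : dprod K,
          smooth_sec K s <-> forall t, A t -> smooth_wrt t (fdom t) s].

Definition sec (K : bundle M) := subm (smooth_sec K).

Definition sev (K : bundle M) (s : sec K) (m : M) : K m := sval_of s m.

End Bundles.
Coercion sev : sec >-> Funclass.

Section Bundles2.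
Variables (R : realType) (n : nat) (M : manifold R n).
Implicit Types (K L N : bundle M).

Definition mksec K (s : dprod K) (Ss : smooth_sec K s) : sec K := mksub Ss.

Lemma sec_eq K (s t : sec K) : (forall m, s m = t m) -> s = t.
Proof.
by move=> st; apply: val_inj; apply: functional_extensionality_dep.
Qed.

Definition fmul K (f : Cinf M) (s : sec K) : sec K :=
  mksec (smooth_secZ f (submP s)).

Definition dsum_fib K L (m : M) : lmodType R := (K m * L m)%type.

Definition dsum_smooth K L (s : dprod (dsum_fib K L)) : Prop :=
  smooth_sec K (fun m => (s m).1) /\ smooth_sec L (fun m => (s m).2).

Program Definition dsum K L : bundle M :=
  @Bundle R n M (dsum_fib K L) (@Submod _ _ (@dsum_smooth K L) _ _) _.
Next Obligation. by move=> K L; split; exact: smem0. Qed.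
Next Obligation.
by move=> K L a x y [x1 x2] [y1 y2]; split;
  [exact: (smem_lin a x1 y1)|exact: (smem_lin a x2 y2)].
Qed.
Next Obligation.
by move=> K L f s [s1 s2]; split;
  [exact: (smooth_secZ f s1)|exact: (smooth_secZ f s2)].
Qed.

Definition pr1 K L (s : sec (dsum K L)) : sec K := mksec (proj1 (submP s)).
Definition pr2 K L (s : sec (dsum K L)) : sec L := mksec (proj2 (submP s)).

(* Bundle maps over the identity, i.e. sections of Hom(K, L) *)
Record bmap K L := BMap {
  bfun :> forall m, K m -> L m;
  bfun_lin : forall m, linear (@bfun m);
  bfun_smooth : forall s : sec K, smooth_sec L (fun m => bfun (s m)) }.

(* Bundle maps K \otimes L -> N *)
Record bmap2 K L N := BMap2 {
  bfun2 :> forall m, K m -> L m -> N m;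
  bfun2_linl : forall m y, linear (fun x => @bfun2 m x y);
  bfun2_linr : forall m x, linear (@bfun2 m x);
  bfun2_smooth : forall (s : sec K) (t : sec L),
    smooth_sec N (fun m => bfun2 (s m) (t m)) }.

Definition bapp K L (b : bmap K L) (s : sec K) : sec L := mksec (bfun_smooth b s).
Definition bapp2 K L N (b : bmap2 K L N) (s : sec K) (t : sec L) : sec N :=
  mksec (bfun2_smooth b s t).

(* Bundle isomorphisms covering a diffeomorphism; smoothness in both
   directions says that s |-> F^-1 o s o phi preserves and reflects smooth
   sections. *)
Record biso (phi : diffeo M) K L := BIso {
  ifun :> forall m, K m -> L (phi m);
  iinv : forall m, L (phi m) -> K m;
  ifun_lin : forall m, linear (@ifun m);
  ifunK : forall m, cancel (@ifun m) (@iinv m);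
  iinvK : forall m, cancel (@iinv m) (@ifun m);
  ifun_smooth : forall s : dprod L,
    smooth_sec L s <-> smooth_sec K (fun m => iinv (s (phi m))) }.

Definition pull phi K L (F : biso phi K L) (s : sec L) : sec K :=
  mksec (proj1 (ifun_smooth F s) (submP s)).

(* Y = F(X) as sections *)
Definition is_push phi K L (F : biso phi K L) (X : sec K) (Y : sec L) : Prop :=
  forall m, Y (phi m) = F m (X m).

Definition biso_id K : biso (diffeo_id M) K K :=
  @BIso (diffeo_id M) K K (fun m x => x) (fun m x => x)
    (fun _ _ _ _ => erefl) (fun _ _ => erefl) (fun _ _ => erefl)
    (fun s => conj id id).

End Bundles2.

Section Omni.
Variables (R : realType) (n : nat) (M : manifold R n) (E : bundle M).

Definition vector_field (X : Cinf M -> Cinf M) : Prop :=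
  linear X /\ forall f g, X (cmul f g) = cmul (X f) g + cmul f (X g).

Definition tangent_vector (m : M) (v : Cinf M -> R^o) : Prop :=
  linear v /\ forall f g, v (cmul f g) = v f * g m + f m * v g.

(* Fibre of DE at m: derivative endomorphisms at m, with symbol v in T_m M *)
Definition is_gauge (m : M) (d : sec E -> E m) : Prop :=
  linear d /\ exists2 v, tangent_vector m v &
    forall f u, d (fmul f u) = f m *: d u + v f *: u m.

Definition covariant_diff_op (d : sec E -> sec E) : Prop :=
  linear d /\ exists2 X, vector_field X &
    forall f u, d (fmul f u) = fmul f (d u) + fmul (X f) u.

Lemma is_gauge0 m : @is_gauge m 0.
Proof.
split=> [a x y|]; first by rewrite scaler0 addr0.
exists 0; first by split=> [a f g|f g];
  rewrite ?scaler0 ?addr0 // mul0r mulr0 addr0.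
by move=> f u; rewrite scaler0 scale0r addr0.
Qed.

Lemma is_gauge_lin m a (d r : sec E -> E m) :
  is_gauge d -> is_gauge r -> is_gauge (a *: d + r).
Proof.
move=> [dl [v [vl vM] dv]] [rl [w [wl wM] rw]]; split=> [b x y|].
  rewrite /= !fctE dl rl !scalerDr !scalerA [b * a]mulrC.
  by rewrite -!addrA; congr (_ + _); rewrite addrCA.
exists (a *: v + w).
  split=> [b f g|f g]; rewrite /= !fctE ?vl ?wl.
    rewrite !scalerDr !scalerA [b * a]mulrC.
    by rewrite -!addrA; congr (_ + _); rewrite addrCA.
  rewrite vM wM mulrDl mulrDr scalerDr -!addrA; congr (_ + _).
    by rewrite scalerAl.
  by rewrite addrCA; congr (_ + (_ + _)); rewrite scalerAr.
move=> f u; rewrite /= !fctE dv rw scalerDl !scalerDr !scalerA [a * f m]mulrC.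
by rewrite -!addrA; congr (_ + _); rewrite addrCA.
Qed.

Definition gauge_fib (m : M) : lmodType R :=
  subm (Submod (@is_gauge0 m) (@is_gauge_lin m)).

Definition gev m (d : gauge_fib m) (u : sec E) : E m := sval_of d u.

Lemma fmulDl (f g : Cinf M) a (u : sec E) :
  fmul (a *: f + g) u = a *: fmul f u + fmul g u.
Proof.
apply: sec_eq => m.
transitivity ((a * f m + g m) *: u m); first by [].
by rewrite scalerDl -scalerA.
Qed.

Lemma fmulDr (f : Cinf M) a (u v : sec E) :
  fmul f (a *: u + v) = a *: fmul f u + fmul f v.
Proof.
apply: sec_eq => m.
transitivity (f m *: (a *: u m + v m)); first by [].
by rewrite scalerDr scalerA mulrC -scalerA.
Qed.

Lemma fmulA (f g : Cinf M) (u : sec E) : fmul f (fmul g u) = fmul (cmul f g) u.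
Proof. by apply: sec_eq => m; exact: scalerA. Qed.

Lemma cmulC (f g : Cinf M) : cmul f g = cmul g f.
Proof. by apply: val_inj; apply/funext => m; exact: mulrC. Qed.

Lemma cmulA (f g h : Cinf M) : cmul f (cmul g h) = cmul (cmul f g) h.
Proof. by apply: val_inj; apply/funext => m; exact: mulrA. Qed.

Lemma cmulDr (f : Cinf M) a (g h : Cinf M) :
  cmul f (a *: g + h) = a *: cmul f g + cmul f h.
Proof.
apply: val_inj; apply/funext => m.
transitivity (f m * (a * g m + h m)); first by [].
by rewrite mulrDr mulrCA.
Qed.

Lemma cmulDl a (f g h : Cinf M) :
  cmul (a *: f + g) h = a *: cmul f h + cmul g h.
Proof. by rewrite cmulC cmulDr ![cmul h _]cmulC. Qed.

Lemma lin_comb (V : lmodType R) (a b : R) (x y z t : V) :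
  a *: (b *: x + y) + (b *: z + t) = b *: (a *: x + z) + (a *: y + t).
Proof.
rewrite !scalerDr !scalerA [b * a]mulrC -!addrA; congr (_ + _).
by rewrite addrCA.
Qed.

(* The sections of DE are exactly the covariant differential operators. *)
Definition gauge_smooth (s : dprod gauge_fib) : Prop :=
  exists2 d, covariant_diff_op d & forall m u, gev (s m) u = d u m.

Lemma gauge_smooth0 : gauge_smooth 0.
Proof.
exists 0 => //; split=> [a x y|]; first by rewrite scaler0 addr0.
exists 0; first by split=> [a f g|f g]; rewrite ?scaler0 ?addr0//;
  apply: val_inj; apply/funext => m; rewrite -[RHS]/(0 * g m + f m * 0) mul0r mulr0 addr0.
move=> f u; apply: sec_eq => m.
by rewrite -[RHS]/(f m *: (0 : E m) + (0 : R) *: u m) scaler0 scale0r addr0.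
Qed.

Lemma gauge_smooth_lin a s t :
  gauge_smooth s -> gauge_smooth t -> gauge_smooth (a *: s + t).
Proof.
move=> [d [dl [X [Xl XM] dX]] sd] [r [rl [Y [Yl YM] rY]] tr].
exists (a *: d + r); last first.
  move=> m u; rewrite -[RHS]/(a *: d u m + r u m) -sd -tr //.
split=> [b x y|]; first by rewrite !fctE dl rl lin_comb.
exists (a *: X + Y).
  split=> [b f g|f g]; rewrite !fctE; first by rewrite Xl Yl lin_comb.
  by rewrite XM YM cmulDr cmulDl scalerDr addrACA.
by move=> f u; rewrite !fctE dX rY fmulDr fmulDl scalerDr addrACA.
Qed.

Lemma gauge_smoothZ (f : Cinf M) (s : dprod gauge_fib) :
  gauge_smooth s -> gauge_smooth (fun m => f m *: s m).
Proof.
move=> [d [dl [X [Xl XM] dX]] sd].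
exists (fun u => fmul f (d u)); last first.
  by move=> m u; rewrite -[RHS]/(f m *: d u m) -sd.
split=> [b x y|]; first by rewrite dl fmulDr.
exists (fun g => cmul f (X g)).
  split=> [b g h|g h]; first by rewrite Xl cmulDr.
  rewrite XM -[cmul (X g) h]scale1r cmulDr scale1r cmulA; congr (_ + _).
  by rewrite !cmulA [cmul f g]cmulC.
move=> g u; rewrite dX -[fmul g (d u)]scale1r fmulDr scale1r !fmulA.
by rewrite [cmul f g]cmulC.
Qed.

Definition DE : bundle M :=
  @Bundle R n M gauge_fib (Submod gauge_smooth0 gauge_smooth_lin) gauge_smoothZ.

Lemma gact_smooth (d : sec DE) (u : sec E) :
  smooth_sec E (fun m => gev (d m) u).
Proof.
have [d' _ dd'] := submP d.
rewrite (_ : (fun m => _) = sval_of (d' u)); first exact: submP.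
by apply: functional_extensionality_dep => m; exact: dd'.
Qed.

Definition gact (d : sec DE) (u : sec E) : sec E := mksec (gact_smooth d u).

Lemma gact_cdo (d : sec DE) : covariant_diff_op (gact d).
Proof.
have [d' cd' dd'] := submP d; rewrite (_ : gact d = d') //.
by apply/funext => u; apply: sec_eq => m; exact: dd'.
Qed.

Lemma cdo_gauge (d : sec E -> sec E) m : covariant_diff_op d ->
  is_gauge (fun u => d u m).
Proof.
move=> [dl [X [Xl XM] dX]]; split=> [a u v|]; first by rewrite dl.
exists (fun f => X f m); last by move=> f u; rewrite dX.
by split=> [a f g|f g]; [rewrite Xl|rewrite XM].
Qed.

Lemma linear_add (U V : lmodType R) (h : U -> V) : linear h ->
  forall x y, h (x + y) = h x + h y.
Proof. by move=> hl x y; rewrite -[x]scale1r hl !scale1r. Qed.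

Lemma linear_sub (U V : lmodType R) (h : U -> V) : linear h ->
  forall x y, h (x - y) = h x - h y.
Proof. by move=> hl x y; rewrite addrC -scaleN1r hl scaleN1r addrC. Qed.

Lemma linear_comb (V : lmodType R) (d r : V -> V) : linear d -> linear r ->
  linear (fun u => d (r u) - r (d u)).
Proof.
by move=> dl rl a u v; rewrite !(rl, dl) scalerBr opprD addrACA.
Qed.

Lemma subr_cross (V : zmodType) (a b x1 x2 y1 y2 : V) :
  (x1 + a + (b + x2)) - (y1 + b + (a + y2)) = (x1 - y1) + (x2 - y2).
Proof.
have -> : x1 + a + (b + x2) = (x1 + x2) + (a + b).
  by rewrite [b + x2]addrC addrACA.
have -> : y1 + b + (a + y2) = (a + b) + (y1 + y2).
  by rewrite [a + y2]addrC addrACA [b + a]addrC addrC.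
by rewrite addrKA opprD addrACA.
Qed.

Lemma comm_cdo (d r : sec E -> sec E) :
  covariant_diff_op d -> covariant_diff_op r ->
  covariant_diff_op (fun u => d (r u) - r (d u)).
Proof.
move=> [dl [X [Xl XM] dX]] [rl [Y [Yl YM] rY]]; split; first exact: linear_comb.
exists (fun f => X (Y f) - Y (X f)).
  split; first exact: linear_comb.
  move=> f g; rewrite !(XM, YM, linear_add Xl, linear_add Yl) subr_cross.
  congr (_ + _); last by rewrite (linear_sub (fun a => cmulDr f a)).
  by rewrite (linear_sub (fun a x y => cmulDl a x y g)).
move=> f u; rewrite !(dX, rY, linear_add dl, linear_add rl) subr_cross.
congr (_ + _); first by rewrite (linear_sub (fun a => fmulDr f a)).
by rewrite (linear_sub (fun a x y => fmulDl x y a u)).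
Qed.

Definition gbr_fun (d r : sec DE) : dprod gauge_fib := fun m =>
  mksub (S := Submod (@is_gauge0 m) (@is_gauge_lin m))
    (cdo_gauge m (comm_cdo (gact_cdo d) (gact_cdo r))).

Lemma gbr_smooth (d r : sec DE) : smooth_sec DE (gbr_fun d r).
Proof.
by exists (fun u => gact d (gact r u) - gact r (gact d u));
  first exact: comm_cdo (gact_cdo d) (gact_cdo r).
Qed.

Definition gbr (d r : sec DE) : sec DE := mksec (gbr_smooth d r).

Lemma gbrE (d r : sec DE) u :
  gact (gbr d r) u = gact d (gact r u) - gact r (gact d u).
Proof. exact: sec_eq. Qed.

(* gl(E_m) inside the fibre of DE at m: Psi acts by u |-> Psi(u(m)) *)
Lemma gl_is_gauge m (Psi : {linear E m -> E m}) :
  is_gauge (fun u : sec E => Psi (u m)).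
Proof.
split=> [a u v|]; first by rewrite -linearP.
exists 0; first by split=> [a f g|f g];
  rewrite ?scaler0 ?addr0 // mul0r mulr0 addr0.
by move=> f u; rewrite scale0r addr0 -linearZ.
Qed.

Definition gl_gauge m (Psi : {linear E m -> E m}) : DE m :=
  mksub (S := Submod (@is_gauge0 m) (@is_gauge_lin m)) (gl_is_gauge Psi).

Definition gauge_id m : DE m := gl_gauge (@idfun (E m)).

(* Fibre of JE at m, inside Hom(DE_m, E_m) *)
Definition is_jet m (nu : DE m -> E m) : Prop :=
  linear nu /\
  forall Psi : {linear E m -> E m}, nu (gl_gauge Psi) = Psi (nu (gauge_id m)).

Lemma is_jet0 m : @is_jet m 0.
Proof.
by split=> [a x y|Psi]; rewrite ?scaler0 ?addr0 // -[RHS]/(Psi 0) linear0.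
Qed.

Lemma is_jet_lin m a (mu nu : DE m -> E m) :
  is_jet mu -> is_jet nu -> is_jet (a *: mu + nu).
Proof.
move=> [ml mP] [nl nP]; split=> [b x y|Psi]; rewrite !fctE.
  by rewrite ml nl lin_comb.
by rewrite mP nP linearP.
Qed.

Definition jet_fib (m : M) : lmodType R :=
  subm (Submod (@is_jet0 m) (@is_jet_lin m)).

Definition jev m (mu : jet_fib m) (d : DE m) : E m := sval_of mu d.

(* smooth sections of JE as a subbundle of Hom(DE, E) *)
Definition jet_smooth (mu : dprod jet_fib) : Prop :=
  forall d : sec DE, smooth_sec E (fun m => jev (mu m) (d m)).

Lemma jet_smooth0 : jet_smooth 0.
Proof. by move=> d; exact: (smem0 (smooth_sec E)). Qed.

Lemma jet_smooth_lin a mu nu :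
  jet_smooth mu -> jet_smooth nu -> jet_smooth (a *: mu + nu).
Proof. by move=> sm sn d; exact: (smem_lin a (sm d) (sn d)). Qed.

Lemma jet_smoothZ (f : Cinf M) (mu : dprod jet_fib) :
  jet_smooth mu -> jet_smooth (fun m => f m *: mu m).
Proof. by move=> sm d; exact: (smooth_secZ f (sm d)). Qed.

Definition JE : bundle M :=
  @Bundle R n M jet_fib (Submod jet_smooth0 jet_smooth_lin) jet_smoothZ.

(* <mu, d>_E; partially applied, it embeds Gamma(JE) into the maps from
   Gamma(DE) to Gamma(E), where the operations below take their values. *)
Definition jpair (mu : sec JE) (d : sec DE) : sec E := mksec (submP mu d).

Lemma jet_is_jet (u : sec E) m : is_jet (fun d : DE m => gev d u).
Proof. by []. Qed.

Lemma jet_is_smooth (u : sec E) :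
  jet_smooth (fun m => mksub (S := Submod (@is_jet0 m) (@is_jet_lin m))
                             (jet_is_jet u m)).
Proof. by move=> d; exact: gact_smooth. Qed.

(* the map bold-d : Gamma(E) -> Gamma(JE) *)
Definition jet (u : sec E) : sec JE := mksec (K := JE) (jet_is_smooth u).

Lemma jetE u d : jpair (jet u) d = gact d u.
Proof. exact: sec_eq. Qed.

(* Lie derivative, as a map Gamma(DE) -> Gamma(E) *)
Definition LieD (d : sec DE) (mu : sec JE) : sec DE -> sec E :=
  fun s => gact d (jpair mu s) - jpair mu (gbr d s).

(* JE-component of the standard bracket {d + mu, r + nu} *)
Definition omni_jet (d : sec DE) (mu : sec JE) (r : sec DE) (nu : sec JE) :
    sec DE -> sec E :=
  LieD d nu - LieD r mu + jpair (jet (jpair mu r)).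

Definition leibniz_cocycle (Th : bmap2 DE DE JE) : Prop :=
  forall d r t : sec DE,
    LieD d (bapp2 Th r t) - LieD r (bapp2 Th d t) + LieD t (bapp2 Th d r)
    - jpair (jet (jpair (bapp2 Th d r) t))
    + jpair (bapp2 Th d (gbr r t)) - jpair (bapp2 Th r (gbr d t))
    - jpair (bapp2 Th (gbr d r) t) = 0.

Definition cobound (b : bmap DE JE) (d r : sec DE) : sec DE -> sec E :=
  LieD d (bapp b r) - LieD r (bapp b d) + jpair (jet (jpair (bapp b d) r))
  - jpair (bapp b (gbr d r)).

Record admissible_pair := AdmissiblePair {
  apom : bmap2 DE DE E;
  apTh : bmap2 DE DE JE;
  apom_sym : forall m (x y : DE m), apom m x y = apom m y x;
  apTh_cocycle : leibniz_cocycle apTh;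
  apTh_diag : forall d : sec DE, bapp2 apTh d d = jet (bapp2 apom d d);
  apom_inv : forall d r : sec DE,
    2^-1 *: gact d (bapp2 apom r r) =
    2^-1 *: jpair (bapp2 apTh d r) r + bapp2 apom (gbr d r) r }.

Definition pair_equiv (p q : admissible_pair) : Prop :=
  exists b : bmap DE JE,
    (forall d r : sec DE,
       bapp2 (apom q) d r = bapp2 (apom p) d r +
         2^-1 *: (jpair (bapp b d) r + jpair (bapp b r) d)) /\
    (forall d r : sec DE,
       jpair (bapp2 (apTh q) d r) = jpair (bapp2 (apTh p) d r) + cobound b d r).

Record courant_data (K : bundle M) := CourantData {
  cpair : bmap2 K K E;
  cbr : sec K -> sec K -> sec K;
  canchor : bmap K DE }.

Section CourantAxioms.
Variables (K : bundle M) (S : courant_data K).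

(* k = rho^*(mu): K is embedded in Hom(K, E) by k |-> 2 (k, -)_E, so that
   (rho^*(mu), x)_E = 1/2 mu(rho x). *)
Definition is_costar m (mu : JE m) (k : K m) : Prop :=
  forall x : K m, cpair S m k x = 2^-1 *: jev mu (canchor S m x).

Record is_courant : Prop := IsCourant {
  ec_bundle : vector_bundle K;
  ec_linl : forall Y, linear (fun X => cbr S X Y);
  ec_linr : forall X, linear (cbr S X);
  ec_leibniz : forall X Y Z,
    cbr S X (cbr S Y Z) = cbr S (cbr S X Y) Z + cbr S Y (cbr S X Z);
  ec_sym : forall m (x y : K m), cpair S m x y = cpair S m y x;
  ec_nondeg : forall m (x : K m), (forall y, cpair S m x y = 0) -> x = 0;
  ec1 : forall X Y,
    bapp (canchor S) (cbr S X Y) =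
    gbr (bapp (canchor S) X) (bapp (canchor S) Y);
  ec2 : forall X m, is_costar (jet (bapp2 (cpair S) X X) m) (cbr S X X m);
  ec3 : forall X Y Z,
    gact (bapp (canchor S) X) (bapp2 (cpair S) Y Z) =
    bapp2 (cpair S) (cbr S X Y) Z + bapp2 (cpair S) Y (cbr S X Z);
  ec4 : forall m (mu : JE m), exists k, is_costar mu k;
  ec5 : forall m (mu : JE m) k, is_costar mu k -> canchor S m k = 0 }.

(* Exactness of 0 -> JE -> K -> DE -> 0; the inclusion of the image of rho^* in
   the kernel of rho is ec5. *)
Record is_exact : Prop := IsExact {
  ex_inj : forall m (mu : JE m), is_costar mu 0 -> mu = 0;
  ex_mid : forall m (k : K m), canchor S m k = 0 -> exists mu, is_costar mu k;
  ex_surj : forall m (d : DE m), exists k, canchor S m k = d }.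

Definition exact_courant : Prop := is_courant /\ is_exact.

End CourantAxioms.

Definition courant_iso (K1 K2 : bundle M) (S1 : courant_data K1)
    (S2 : courant_data K2) (phi : diffeo M) (Phi : biso phi E E)
    (F : biso phi K1 K2) : Prop :=
  [/\ forall m (x y : K1 m), cpair S2 (phi m) (F m x) (F m y) = Phi m (cpair S1 m x y),
      forall X Y X' Y', is_push F X X' -> is_push F Y Y' ->
        is_push F (cbr S1 X Y) (cbr S2 X' Y')
    & forall m (x : K1 m) (u : sec E),
        gev (canchor S2 (phi m) (F m x)) u = Phi m (gev (canchor S1 m x) (pull Phi u))].

Record exact_EC := ExactEC {
  ecK : bundle M;
  ecS : courant_data ecK;
  ecP : exact_courant ecS }.

Definition isomorphic (A B : exact_EC) : Prop :=
  exists (phi : diffeo M) (Phi : biso phi E E) (F : biso phi (ecK A) (ecK B)),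
    courant_iso (ecS A) (ecS B) Phi F.

(* The data on DE (+) JE attached to p: rho is the projection, and the pairing
   and the bracket are the standard ones twisted by p. *)
Definition twisted (p : admissible_pair) (S : courant_data (dsum DE JE)) : Prop :=
  [/\ forall m (x : dsum DE JE m), canchor S m x = x.1,
      forall m (x y : dsum DE JE m),
        cpair S m x y = 2^-1 *: (jev y.2 x.1 + jev x.2 y.1) + apom p m x.1 y.1
    & forall X Y : sec (dsum DE JE),
        pr1 (cbr S X Y) = gbr (pr1 X) (pr1 Y) /\
        jpair (pr2 (cbr S X Y)) =
          omni_jet (pr1 X) (pr2 X) (pr1 Y) (pr2 Y) +
          jpair (bapp2 (apTh p) (pr1 X) (pr1 Y))].

(* p is a pair corresponding to A: an identification of K with DE (+) JE, i.e.
   an isomorphism over the identity of E, carries the structure of A to the one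
   attached to p. *)
Definition corresponds (A : exact_EC) (p : admissible_pair) : Prop :=
  exists S : courant_data (dsum DE JE), twisted p S /\
    exists F : biso (diffeo_id M) (ecK A) (dsum DE JE),
      courant_iso (ecS A) S (biso_id E) F.

Definition iso_classes := {C : exact_EC -> Prop | exists A, C = isomorphic A}.
Definition pair_classes :=
  {C : admissible_pair -> Prop | exists p, C = pair_equiv p}.

Definition iso_class (A : exact_EC) : iso_classes :=
  exist _ (isomorphic A) (ex_intro _ A erefl).
Definition pair_class (p : admissible_pair) : pair_classes :=
  exist _ (pair_equiv p) (ex_intro _ p erefl).

End Omni.

(* Main.v *)
Require Import Defs.
From HB Require Import structures.
From mathcomp Require Import all_boot all_order all_algebra ring lra.
From mathcomp Require Import boolp classical_sets functions cardinality reals.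
From mathcomp Require Import ereal topology normedtype derive realfun.
From mathcomp Require Import sequences exp measure lebesgue_measure.
From mathcomp Require Import lebesgue_integral ftc.

Set Implicit Arguments.
Unset Strict Implicit.
Unset Printing Implicit Defensive.
Import Order.TTheory GRing.Theory Num.Theory.
Import numFieldNormedType.Exports.
Local Open Scope classical_set_scope.
Local Open Scope ring_scope.

(** The section Id of DE acts as the identity on Gamma(E) and commutes with
    Gamma(DE), so that the Lie derivative along it is the identity of
    Gamma(JE). This rigidity reduces each of the two sets of classes to one
    point, represented by the untwisted omni-Lie algebroid.

    Admissible pairs. Put b(r) = Theta(Id, r). The invariance condition with
    first argument Id says that omega(r, r) = <b(r), r>; polarized, it gives
    omega as the symmetric part of b ([contraction_omega]). In the cocycle
    identity with first argument Id the Lie derivative along Id contributes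
    Theta(d, r) itself, the brackets with Id vanish, and what remains is that
    Theta is the coboundary of b ([contraction_theta]). Hence every admissible
    pair is equivalent to (0, 0) and any two are equivalent ([pairs_equiv]).

    Exact E-Courant algebroids. Choose a section e of K with rho(e) = Id and
    let P X = [e, X]. Invariance of the pairing gives
    (P X, Y) + (X, P Y) = (X, Y); with nondegeneracy, this makes P linear over
    the functions. As Id is central, rho P = 0; as ker rho is the image of the
    dual anchor, it is orthogonal to itself, hence to the values of P, and P is
    the identity on it. Thus P is a bundle projection onto the image of JE. The
    kernel of P is isotropic by the displayed identity and closed under the
    bracket because P is a derivation of it, by the Leibniz identity. So K is
    DE + JE with the standard pairing and bracket, by k |-> (rho k, mu) where mu
    is the jet with image [e, k] ([standard_form]). Any two exact E-Courant
    algebroids are therefore isomorphic, and all of them correspond to (0, 0).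

    Conversely the axioms for the structure twisted by an admissible pair are
    identities between linear combinations ([twisted_courant],
    [twisted_is_exact]); the bracket is well defined because the Lie derivative
    of a jet is a jet ([LieD_is_jet]).

    What is left is analysis. The section e is glued from local lifts of Id
    ([lift_near], [lift_global]). The bundles DE and JE are defined by algebraic
    conditions on their fibres, and local frames of them come from the fact
    that the derivations at a point are spanned by the partial derivatives
    ([coords_exist]), a consequence of Hadamard's lemma ([hadamard]). For a
    local frame s_a of E and coordinates X_i, DE has as a frame the derivatives
    of the coefficients along X_i and the elementary endomorphisms of the frame
    ([gauge_frame]), and JE has the jets ds_a and the differences
    d(X_i s_a) - X_i ds_a ([jet_frame]). Bump functions turn all these local
    objects into global sections ([coframe_exists]). *)

(** * Functions of class C^k on R^n *)

Section CkBasics.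
Variables (R : realType) (n : nat).
Implicit Types (U V : set 'rV[R]_n) (f g : 'rV[R]_n -> R).

Lemma Ck_sub k U V f : V `<=` U -> Ck k U f -> Ck k V f.
Proof.
move=> VU; elim: k f => [|k IH] f [cf df]; (split=> [x /VU|]; first exact: cf) => //.
move=> i; have [dfi Cfi] := df i.
by split=> [x /VU|]; [exact: dfi|exact: IH].
Qed.

Lemma Ck_bigcup k U f : (forall x, U x -> exists2 V, V x & Ck k V f) -> Ck k U f.
Proof.
elim: k f => [|k IH] f H; (split=> [x /H [V Vx [cf _]]|]; first exact: cf) => //.
move=> i; split=> [x /H [V Vx [_ /(_ i) [df _]]]|]; first exact: df.
by apply: IH => x /H [V Vx [_ /(_ i) [_ Cf]]]; exists V.
Qed.

Lemma Ck_sum k U (I : Type) (r : seq I) (F : I -> 'rV[R]_n -> R) : open U ->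
  (forall i, Ck k U (F i)) -> Ck k U (fun x => \sum_(i <- r) F i x).
Proof.
move=> oU CF; elim: r => [|i r IH].
  by apply: Ck_eq (Ck_cst k U 0) => // x _; rewrite big_nil.
apply: Ck_eq (Ck_lin 1 oU (CF i) IH) => // x _.
by rewrite big_cons mul1r.
Qed.

Lemma Ck_prod k U (I : Type) (r : seq I) (F : I -> 'rV[R]_n -> R) : open U ->
  (forall i, Ck k U (F i)) -> Ck k U (fun x => \prod_(i <- r) F i x).
Proof.
move=> oU CF; elim: r => [|i r IH].
  by apply: Ck_eq (Ck_cst k U 1) => // x _; rewrite big_nil.
by apply: Ck_eq (Ck_mul oU (CF i) IH) => // x _; rewrite big_cons.
Qed.

Lemma is_derive_coord (x v : 'rV[R]_n) j :
  is_derive x v (fun y : 'rV[R]_n => y 0 j) (v 0 j).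
Proof.
have cv : h^-1 *: ((h *: v + x) 0 j - x 0 j) @[h --> 0^'] --> v 0 j.
  apply: cvg_near_cst; near=> h.
  rewrite !mxE addrK -[_ *: _]/(_ * _) mulrA mulVf ?mul1r //.
  by near: h; exact: nbhs_dnbhs_neq.
by apply: DeriveDef; [apply/cvg_ex; exists (v 0 j)|exact: cvg_lim cv].
Unshelve. all: by end_near. Qed.

Lemma Ck_coord k U j : Ck k U (fun y : 'rV[R]_n => y 0 j).
Proof.
case: k => [|k]; (split=> [x _|]; first exact: coord_continuous) => //.
move=> i; split=> [x _|]; first exact: (@ex_derive _ _ _ _ _ _ _ (is_derive_coord _ _ _)).
rewrite (_ : 'D_(delta_mx 0 i) _ = fun=> (delta_mx 0 i : 'rV[R]_n) 0 j).
  exact: Ck_cst.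
by apply/funext => x; exact: (@derive_val _ _ _ _ _ _ _ (is_derive_coord _ _ _)).
Qed.

(** Reduces directional derivatives to functions of one variable. *)
Lemma is_derive_line (f : 'rV[R]_n -> R) (x v : 'rV[R]_n) (t : R) :
  derivable f (t *: v + x) v ->
  is_derive t 1 (fun s : R => f (s *: v + x)) ('D_v f (t *: v + x)).
Proof.
move=> df.
have E : (fun h : R => h^-1 *: (f ((h *: (1 : R) + t) *: v + x) - f (t *: v + x))) =
    (fun h : R => h^-1 *: (f (h *: v + (t *: v + x)) - f (t *: v + x))).
  by apply/funext => h; rewrite -[h *: 1]/(h * 1) mulr1 scalerDl addrA.
by apply: DeriveDef; rewrite ?/derivable ?/derive/= E.
Qed.

End CkBasics.

Section Outer.
Variables (R : realType) (n : nat).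

Lemma is_derive_outer (f : 'rV[R]_n -> R) (h : R -> R) x v (dh : R) :
  derivable f x v -> is_derive (f x) 1 h dh ->
  is_derive x v (h \o f) (dh * 'D_v f x).
Proof.
move=> df dhf.
have d1 := @is_derive_line _ _ f x v 0; rewrite scale0r add0r in d1.
have {}d1 := d1 df.
have dhf' : is_derive ((fun s : R => f (s *: v + x)) 0) 1 h dh.
  by rewrite scale0r add0r.
have d2 := @is_derive1_comp R h (fun s : R => f (s *: v + x)) 0 dh ('D_v f x) dhf' d1.
have E : (fun s : R => s^-1 *: ((h \o (fun s : R => f (s *: v + x))) (s *: (1:R) + 0) -
  (h \o (fun s : R => f (s *: v + x))) 0)) =
   (fun s : R => s^-1 *: ((h \o f) (s *: v + x) - (h \o f) x)).
  by apply/funext => s /=; rewrite scale0r add0r addr0 -[s *: 1]/(s * 1) mulr1.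
case: d2; rewrite /derivable /derive /= in E * => d2 e2.
apply: DeriveDef; rewrite /derivable /derive /=; first by rewrite -E.
by rewrite -E.
Qed.

(** A class of one-variable functions closed under differentiation acts on
    functions of class C^k: each derivative of [h \o f] is again a product of
    such a composite with a derivative of [f]. *)
Lemma Ck_outer (D : set R) (P : set (R -> R)) k (U : set 'rV[R]_n) f h :
  (forall h, P h -> exists2 dh, P dh & forall x, D x -> is_derive x 1 h (dh x)) ->
  open U -> (forall x, U x -> D (f x)) -> P h -> Ck k U f -> Ck k U (h \o f).
Proof.
move=> HP oU fD; elim: k h => [|k IH] h Ph Cf.
  split=> // x Ux; have [dh Pdh /(_ _ (fD x Ux)) dhf] := HP h Ph.
  apply: continuous_comp; first exact: Cf.1.
  by apply: differentiable_continuous; exact/derivable1_diffP/ex_derive.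
have [dh Pdh dhf] := HP h Ph.
split=> [x Ux|i].
  apply: continuous_comp; first exact: Cf.1.
  by apply: differentiable_continuous; exact/derivable1_diffP/(@ex_derive _ _ _ _ _ _ _
    (dhf _ (fD x Ux))).
have [dfi Cfi] := Cf.2 i.
have dd x : U x -> is_derive x (delta_mx 0 i) (h \o f) (dh (f x) * 'D_(delta_mx 0 i) f x).
  by move=> Ux; apply: is_derive_outer (dfi x Ux) (dhf _ (fD x Ux)).
split=> [x Ux|]; first exact: (@ex_derive _ _ _ _ _ _ _ (dd x Ux)).
apply: (@Ck_eq _ _ _ _ (fun x => (dh \o f) x * 'D_(delta_mx 0 i) f x)) => //.
  by move=> x Ux; rewrite (@derive_val _ _ _ _ _ _ _ (dd x Ux)).
by apply: Ck_mul => //; apply: IH => //; exact: Ck_pred.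
Qed.

Lemma Ck_inv k (U : set 'rV[R]_n) f : open U -> (forall x, U x -> f x != 0) ->
  Ck k U f -> Ck k U (fun x => (f x)^-1).
Proof.
move=> oU f0 Cf.
(* The functions c x^-m form a class closed under differentiation on x != 0. *)
pose P : set (R -> R) := [set h | exists c m, h = fun x => c * x^-1 ^+ m].
apply: (@Ck_outer [set x | x != 0] P k U f GRing.inv) => //; last first.
  by exists 1, 1%N; apply/funext => x; rewrite mul1r expr1.
move=> _ [c [m ->]]; exists (fun x => (c * - m%:R) * x^-1 ^+ m.+1);
  first by eexists; eexists.
move=> x /= x0.
have dV : is_derive x 1 (fun x : R => x^-1) (- x ^- 2 *: 1).
  apply: DeriveDef; first by apply: derivableV => //; exact: derivable_id.
  by rewrite (@deriveV _ _ (@idfun R)) ?derive_id //; exact: derivable_id.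
have dX := @is_deriveX _ _ (fun x : R => x^-1) m x 1 _ dV.
have dZ := @is_deriveZ _ _ _ _ c x 1 _ dX.
rewrite (_ : (fun y => c * y^-1 ^+ m) = c *: ((fun y : R => y^-1) ^+ m : R -> R));
  last first.
  by apply/funext => y; rewrite !fctE.
apply: is_derive_eq dZ _.
rewrite -[LHS]/(c * (m%:R * x^-1 ^+ m.-1 * (- x ^- 2 * 1))).
case: m {dX} => [|m] /=; first by ring.
rewrite -exprVn !exprS expr0; ring.
Qed.

End Outer.

(** * Bump functions on R^n *)

Section FlatFunction.
Variable R : realType.

(** The functions x^-k exp(-1/x), extended by 0 to x <= 0: flat at 0, and
    stable, up to linear combinations, under differentiation. *)
Definition flat k (x : R) : R := if 0 < x then x^-1 ^+ k * expR (- x^-1) else 0.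

(** From exp y >= y^(k+2) / (k+2)! at y = 1/x. The square of x is what makes
    the difference quotients of [flat k] at 0 tend to 0. *)
Lemma flat_le k (x : R) : `|flat k x| <= k.+2`!%:R * x ^+ 2.
Proof.
rewrite /flat; case: ifPn => [x0|_]; last first.
  by rewrite normr0 mulr_ge0 // sqr_ge0.
have y0 : 0 < x^-1 by rewrite invr_gt0.
have f0 : 0 < (k.+2`!%:R : R) by rewrite ltr0n fact_gt0.
rewrite ger0_norm; last by rewrite mulr_ge0 ?exprn_ge0 ?expR_ge0 // (ltW y0).
have := expR_ge1Dxn k.+1 (ltW y0).
move/(le_trans (ler_wpDl ler01 (lexx _))) => H.
rewrite expRN ler_pdivrMr ?expR_gt0 //.
apply: le_trans (_ : k.+2`!%:R * x ^+ 2 * (x^-1 ^+ k.+2 / k.+2`!%:R) <= _).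
  rewrite le_eqVlt; apply/orP; left; apply/eqP; rewrite !exprS expr0; field.
  by rewrite (gt_eqF x0) (gt_eqF f0).
by rewrite ler_wpM2l // mulr_ge0 ?sqr_ge0 // ltW.
Qed.

Lemma is_derive_flat k (x : R) :
  is_derive x 1 (flat k) (- k%:R * flat k.+1 x + flat k.+2 x).
Proof.
have [x0|x0|<-] := ltgtP 0 x.
- have dV : is_derive x 1 (fun x : R => x^-1) (- x ^- 2 *: 1).
    apply: DeriveDef; first by apply: derivableV; [rewrite gt_eqF|exact: derivable_id].
    by rewrite (@deriveV _ _ (@idfun R)) ?derive_id ?gt_eqF //; exact: derivable_id.
  have dX := @is_deriveX _ _ (fun x : R => x^-1) k x 1 _ dV.
  have dN := @is_deriveN _ _ _ (fun x : R => x^-1) x 1 _ dV.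
  have dE := @is_derive1_comp R expR (- (fun x : R => x^-1)) x _ _ (is_derive_expR _) dN.
  have dM := @is_deriveM _ _ _ _ x 1 _ _ dX dE.
  apply: (@near_eq_is_derive _ _ _ (fun y : R => y^-1 ^+ k * expR (- y^-1))).
    near=> y; rewrite /flat ifT //; near: y; exact: lt_nbhsr.
  rewrite (_ : (fun y => _) = (fun y : R => y^-1) ^+ k * (expR \o - (fun y : R => y^-1))).
    apply: is_derive_eq dM _.
  2: by apply/funext => y; rewrite !fctE.
  rewrite /flat x0 fctE.
  rewrite -[LHS]/(x^-1 ^+ k * ((expR (- x^-1)) * (- (- x ^- 2 * 1))) +
     expR (- x^-1) * (k%:R * x^-1 ^+ k.-1 * (- x ^- 2 * 1))).
  rewrite -exprVn; case: k {dX} => [|k] /=; rewrite !exprS expr0; ring.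
- rewrite {2 3}/flat ltNge (ltW x0) /= mulr0 addr0.
  apply: (@near_eq_is_derive _ _ _ (cst (0 : R))).
  by near=> y; rewrite /flat ifF //; apply/negbTE; rewrite -leNgt ltW //;
      near: y; exact: lt_nbhsl.
- rewrite {2 3}/flat ltxx mulr0 addr0.
  have cv : h^-1 *: (flat k (h *: 1 + 0) - flat k 0) @[h --> 0^'] --> 0.
    apply: norm_cvg0.
    apply: (@squeeze_cvgr _ _ _ _ (cst 0) (fun h => k.+2`!%:R * `|h|)).
    + near=> h; rewrite normr_ge0 /= /(flat k 0) ltxx subr0 addr0 normrZ.
      rewrite -[h *: 1]/(h * 1) mulr1 normfV ler_pdivrMl ?normr_gt0; last first.
        by near: h; exact: nbhs_dnbhs_neq.
      by rewrite mulrCA -expr2 real_normK ?num_real //; exact: flat_le.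
    + exact: cvg_cst.
    + apply: (@cvg_within_filter _ _ _ (nbhs 0)).
      have : k.+2`!%:R * `|h| @[h --> (0 : R)] --> k.+2`!%:R * `|0 : R|.
        by apply: cvgM; [exact: cvg_cst|apply: cvg_norm; exact: cvg_id].
      by rewrite normr0 mulr0.
  by apply: DeriveDef; [apply/cvg_ex; exists 0|exact: cvg_lim cv].
Unshelve. all: by end_near. Qed.

Lemma flat_gt0 k (x : R) : 0 < x -> 0 < flat k x.
Proof. by move=> x0; rewrite /flat x0 mulr_gt0 ?expR_gt0 // exprn_gt0 ?invr_gt0. Qed.

Lemma flat_eq0 k (x : R) : x <= 0 -> flat k x = 0.
Proof. by move=> x0; rewrite /flat ifF //; apply/negbTE; rewrite -leNgt. Qed.

Lemma flat_ge0 k (x : R) : 0 <= flat k x.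
Proof. by have [/flat_eq0->|/flat_gt0/ltW] := leP x 0. Qed.

(** The derivative of [flat k] is a combination of two flat functions, so it is
    their span that is closed under differentiation, as [Ck_outer] asks. *)
Inductive flat_comb : (R -> R) -> Prop :=
| FlatBase k : flat_comb (flat k)
| FlatComb a h g : flat_comb h -> flat_comb g ->
    flat_comb (fun x => a * h x + g x).

Lemma flat_comb_derive h : flat_comb h ->
  exists2 dh, flat_comb dh & forall x : R, is_derive x 1 h (dh x).
Proof.
elim=> [k|a {}h g _ [dh Ph hP] _ [dg Pg gP]].
  exists (fun x => - k%:R * flat k.+1 x + flat k.+2 x) => [|x].
    by apply: FlatComb; exact: FlatBase.
  exact: is_derive_flat.
exists (fun x => a * dh x + dg x) => [|x]; first exact: FlatComb.
exact: (@is_deriveD _ _ _ _ _ _ _ _ _ (@is_deriveZ _ _ _ _ a _ _ _ (hP x)) (gP x)).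
Qed.

Variable n : nat.
Implicit Type U : set 'rV[R]_n.

Lemma Ck_flat k U K f : open U -> Ck k U f -> Ck k U (flat K \o f).
Proof.
move=> oU; apply: (@Ck_outer _ _ setT flat_comb) => //; last exact: FlatBase.
by move=> h /flat_comb_derive [dh Ph hP]; exists dh.
Qed.

Definition cutoff (x : R) := flat 0 (2 - x) / (flat 0 (2 - x) + flat 0 (x - 1)).

Lemma cutoff_den x : flat 0 (2 - x) + flat 0 (x - 1) != 0.
Proof.
rewrite gt_eqF //; have [x2|x2] := ltP x 2.
  by apply: ltr_wpDr; [exact: flat_ge0|apply: flat_gt0; rewrite subr_gt0].
by apply: ltr_wpDl; [exact: flat_ge0|apply: flat_gt0; lra].
Qed.

Lemma cutoff1 x : x <= 1 -> cutoff x = 1.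
Proof.
move=> x1; have := cutoff_den x; rewrite /cutoff (@flat_eq0 _ (x - 1)) ?subr_le0 //.
by rewrite addr0 => /divff.
Qed.

Lemma cutoff0 x : 2 <= x -> cutoff x = 0.
Proof. by move=> x2; rewrite /cutoff flat_eq0 ?mul0r // subr_le0. Qed.

Lemma Ck_cutoff k U f : open U -> Ck k U f -> Ck k U (cutoff \o f).
Proof.
move=> oU Cf.
have Cn : Ck k U (flat 0 \o (fun x => 2 - f x)).
  apply: Ck_flat => //; apply: Ck_eq (Ck_lin (-1) oU Cf (Ck_cst k U 2)) => // x _.
  by rewrite mulN1r addrC.
have Cp : Ck k U (flat 0 \o (fun x => f x - 1)).
  apply: Ck_flat => //; apply: Ck_eq (Ck_lin 1 oU Cf (Ck_cst k U (-1))) => // x _.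
  by rewrite mul1r.
apply: Ck_mul => //; apply: Ck_inv => // [x _|]; first exact: cutoff_den.
by apply: Ck_eq (Ck_lin 1 oU Cn Cp) => // x _; rewrite mul1r.
Qed.

Lemma rV_bump (a : 'rV[R]_n) e : 0 < e -> exists phi : 'rV[R]_n -> R,
  [/\ smooth_on setT phi, \forall y \near a, phi y = 1 &
      forall y, e <= `|y - a| -> phi y = 0].
Proof.
(* The sup norm is not smooth, hence the sum of squares. The factor 2 / e makes
   it at least 4, beyond the end 2 of the cutoff, outside the ball of radius e. *)
move=> e0; pose rho (y : 'rV[R]_n) := \sum_j (2 / e * (y 0 j - a 0 j)) ^+ 2.
have Crho k : Ck k setT rho.
  apply: Ck_sum; first exact: openT.
  move=> j; have C1 : Ck k setT (fun y : 'rV[R]_n => 2 / e * (y 0 j - a 0 j)).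
    apply: Ck_mul; [exact: openT|exact: Ck_cst|].
    apply: Ck_eq (Ck_lin 1 openT (Ck_coord k setT j) (Ck_cst k setT (- a 0 j))).
      exact: openT.
    by move=> x _; rewrite mul1r.
  by apply: Ck_eq (Ck_mul openT C1 C1); [exact: openT|move=> x _; rewrite expr2].
exists (cutoff \o rho); split.
- by move=> k; apply: Ck_cutoff => //; exact: openT.
- have /(cvgr_lt (rho a)) : rho y @[y --> a] --> rho a by exact: (Crho 0%N).1.
  move=> /(_ 1); have -> : rho a = 0.
    by rewrite /rho big1 // => j _; rewrite subrr mulr0 expr0n.
  move=> /(_ ltr01); apply: filterS => y /= y1.
  by rewrite cutoff1 // ltW.
- move=> y ye; rewrite /= cutoff0 //.
  have [j yj] : exists j, e <= `|y 0 j - a 0 j|.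
    apply: contrapT => /forallNP H; move: ye; apply/negP; rewrite -ltNge.
    rewrite [`|y - a|]mx_normrE; apply/bigmax_ltP; split => // -[i j] _ /=.
    by rewrite ord1 !mxE ltNge; apply/negP; exact: H.
  rewrite /rho (bigD1 j) //=; apply: ler_wpDr; first by apply: sumr_ge0 => i _;
    exact: sqr_ge0.
  rewrite -real_normK ?num_real // normrM gtr0_norm ?divr_gt0 //.
  have : 2 <= 2 / e * `|y 0 j - a 0 j| by rewrite mulrAC ler_pdivlMr // ler_wpM2l.
  by move=> H; nra.
Qed.

End FlatFunction.

(** * Integrals depending on a parameter *)

Section ParametricIntegral.
Variable R : realType.

Definition mean01 (g : R -> R) : R := \int[lebesgue_measure]_(s in `[0, 1]) g s.

Let m01 : measurable (`[0, 1]%classic : set R). Proof. exact: measurable_itv. Qed.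

Lemma integrable01 (g : R -> R) : continuous g ->
  lebesgue_measure.-integrable `[0, 1] (EFin \o g).
Proof.
move=> cg; apply: continuous_compact_integrable; first exact: segment_compact.
by apply: continuous_subspaceT => x; exact: cg.
Qed.

Lemma mean01_cst (c : R) : mean01 (cst c) = c.
Proof.
rewrite /mean01 Rintegral_cst //= lebesgue_measure_itv /= lte_fin ltr01.
by rewrite -EFinD /= subr0 mulr1.
Qed.

Lemma mean01B (f g : R -> R) : continuous f -> continuous g ->
  mean01 f - mean01 g = mean01 (fun s => f s - g s).
Proof. by move=> cf cg; rewrite /mean01 RintegralB //; exact: integrable01. Qed.

Lemma mean01Z (c : R) (f : R -> R) : continuous f ->
  mean01 (fun s => c * f s) = c * mean01 f.
Proof. by move=> cf; rewrite /mean01 RintegralZl //; exact: integrable01. Qed.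

Lemma mean01_le (f : R -> R) (e : R) : continuous f ->
  (forall s, 0 <= s <= 1 -> `|f s| <= e) -> `|mean01 f| <= e.
Proof.
move=> cf fe; apply: le_trans (le_normr_Rintegral _ _) _ => //.
  exact: integrable01.
rewrite -[leRHS]mean01_cst; apply: le_Rintegral => //.
- by apply: (@integrable01 (fun s => `|f s|)) => x; apply: cvg_norm; exact: cf.
- by apply: integrable01; exact: cst_continuous.
Qed.

(** By compactness of [0, 1], a continuous function of (s, x) is continuous in x
    uniformly in s. *)
Lemma mean01_continuous (T : topologicalType) (g : R -> T -> R) :
  continuous (fun p : R * T => g p.1 p.2) -> continuous (fun x => mean01 (g ^~ x)).
Proof.
move=> cg x.
have cgs y : continuous (g ^~ y).
  move=> s; apply: (@continuous_comp _ _ _ (fun s => (s, y))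
    (fun p : R * T => g p.1 p.2)).
    exact: (@cvg_pair _ _ _ (nbhs s) (nbhs s) (nbhs y) _ _ _ id (cst y) cvg_id
      (cvg_cst _)).
  exact: cg.
apply/cvgrPdist_le => e e0.
have cpt : near_covering (`[0, 1]%classic : set R).
  by apply/compact_near_coveringP; exact: segment_compact.
have : \forall y \near x, `[0, 1]%classic `<=` (fun s => `|g s x - g s y| <= e).
  apply: (cpt T (nbhs x) (fun y s => `|g s x - g s y| <= e)) => s _.
  have e20 : 0 < e / 2 by rewrite divr_gt0.
  have /cvgrPdist_le/(_ _ e20) := cg (s, x).
  have /cvgrPdist_le/(_ _ e20) := cgs x s.
  case=> d /= d0 Hd [[A B] /= [As Bx] AB].
  exists (A `&` ball s d, B) => /=.
    by split => //; apply: filterI => //; exact: nbhsx_ballx.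
  move=> [s' y] /= [[As' ds'] By].
  have := AB (s', y) (conj As' By); have := Hd s' ds'; rewrite /=.
  move=> H1 H2; rewrite [e]splitr.
  rewrite (_ : g s' x - g s' y = (g s' x - g s x) + (g s x - g s' y)); last by ring.
  by apply: le_trans (ler_normD _ _) _; apply: lerD => //; rewrite distrC.
apply: filterS => y Hy; rewrite mean01B //.
by apply: mean01_le => [s|s s01]; [apply: cvgB; exact: cgs|apply: Hy; rewrite /= in_itv].
Qed.

(** The derivative is dominated by the maximum of its absolute value on the
    compact rectangle [t - 1, t + 1] x [0, 1]. *)
Lemma mean01_derive (h dh : R -> R -> R) (t : R) :
  (forall t, continuous (h t)) ->
  continuous (fun p : R * R => dh p.1 p.2) ->
  (forall t s, is_derive (t : R) (1 : R) (h ^~ s : R -> R) (dh t s)) ->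
  is_derive t (1 : R) (fun t : R => mean01 (h t)) (mean01 (dh t)).
Proof.
move=> ch cdh dd.
have [M M0 HM] : exists2 M, 0 <= M & forall t' s, t - 1 <= t' <= t + 1 -> 0 <= s <= 1 ->
  `|dh t' s| <= M.
  have cK : compact ((`[t - 1, t + 1]%classic : set R) `*` (`[0, 1]%classic : set R)).
    by apply: compact_setX; exact: segment_compact.
  have K0 : ((`[t - 1, t + 1]%classic : set R) `*` (`[0, 1]%classic : set R)) !=set0.
    by exists (t, 0); split; rewrite /= in_itv /= ?lexx ?ler01 // lerBlDr lerDl ler01.
  have cf : {within (`[t - 1, t + 1]%classic : set R) `*` (`[0, 1]%classic : set R),
      continuous (fun p : R * R => `|dh p.1 p.2|)}.
    by apply: continuous_subspaceT => q; apply: cvg_norm; exact: cdh.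
  have [p pK pmax] := compact_EVT_max K0 cK cf.
  exists `|dh p.1 p.2| => // t' s tt' ss.
  by apply: (pmax (t', s)); rewrite inE; split; rewrite /= in_itv.
pose u := t - 1; pose v := t + 1.
have Iuv : (`]u, v[%classic : set R) t by rewrite /= in_itv /= /u /v; lra.
have sub t' : (`]u, v[%classic : set R) t' -> t - 1 <= t' <= t + 1.
  by rewrite /= in_itv /= => /andP[/ltW -> /ltW ->].
have intf : forall x, (`]u, v[%classic : set R) x ->
  lebesgue_measure.-integrable `[0, 1] (EFin \o h x).
  by move=> x _; exact: integrable01.
have derf : forall x y, (`]u, v[%classic : set R) x -> (`[0, 1]%classic : set R) y ->
  derivable (h ^~ y) x 1.
  by move=> x y _ _; exact: ex_derive.
have intG : lebesgue_measure.-integrable `[0, 1] (EFin \o (fun _ : R => M)).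
  by apply: integrable01; exact: cst_continuous.
have pE : partial1of2 h = dh.
  apply/funext => x; apply/funext => y; rewrite partial1of2E.
  exact: derive_val.
have Gub : forall x y, (`]u, v[%classic : set R) x -> (`[0, 1]%classic : set R) y ->
  `|partial1of2 h x y| <= M.
  by move=> x y /sub xt; rewrite /= in_itv /= => y01; rewrite pE; exact: HM.
apply: DeriveDef.
  exact: (@derivable_under_integral R _ _ lebesgue_measure h _ m01 t u v Iuv intf derf
    (fun=> M) (fun=> M0) intG Gub).
rewrite -derive1E (@differentiation_under_integral R _ _ lebesgue_measure h _ m01 t u v
  Iuv intf derf (fun=> M) (fun=> M0) intG Gub).
by rewrite pE.
Qed.

End ParametricIntegral.

(** * Hadamard's lemma *)

Section Hadamard.
Variables (R : realType) (n : nat).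
Implicit Types (f : 'rV[R]_n -> R).

Lemma cvg_rV (T : Type) (F : set_system T) (FF : Filter F)
  (f : T -> 'rV[R]_n) (l : 'rV[R]_n) :
  (forall j, f x 0 j @[x --> F] --> l 0 j) -> f @ F --> l.
Proof.
move=> H; rewrite (row_sum_delta l).
rewrite (_ : f = fun x => \sum_j f x 0 j *: delta_mx 0 j); last first.
  by apply/funext => x; exact: row_sum_delta.
apply: (@cvg_big _ _ +%R 0 xpredT (@add_continuous ('rV[R]_n : normedModType R)) _ F) =>
  j _.
apply: cvgZr_tmp; exact: H.
Qed.

(** For fixed x, a path parametrized by s. Because the dependence on x is
    diagonal, the derivative in direction i of a function composed with it is
    [l i s] times the derivative in the same direction. *)
Definition diag_affine (c l : 'I_n -> R -> R) (s : R) (x : 'rV[R]_n) : 'rV[R]_n :=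
  \row_j (c j s + l j s * x 0 j).

Section DiagAffine.
Variables (c l : 'I_n -> R -> R).
Hypotheses (cc : forall j, continuous (c j)) (cl : forall j, continuous (l j)).

Lemma diag_affine_continuous :
  continuous (fun p : R * 'rV[R]_n => diag_affine c l p.1 p.2).
Proof.
move=> [s x]; apply: cvg_rV => j.
rewrite mxE (_ : (fun p => _) = fun p : R * 'rV[R]_n => c j p.1 + l j p.1 * p.2 0 j);
  last first.
  by apply/funext => p; rewrite mxE.
have c1 : p.1 @[p --> (s, x)] --> s by exact: cvg_fst.
have c2 : p.2 @[p --> (s, x)] --> x by exact: cvg_snd.
apply: cvgD; first exact: (cvg_comp _ _ c1 (@cc j s)).
apply: cvgM; first exact: (cvg_comp _ _ c1 (@cl j s)).
exact: (cvg_comp _ _ c2 (@coord_continuous _ _ _ 0 j x)).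
Qed.

Lemma diag_affine_line s t i (x : 'rV[R]_n) :
  diag_affine c l s (t *: delta_mx 0 i + x) =
  (t * l i s) *: delta_mx 0 i + diag_affine c l s x.
Proof.
apply/rowP => j; rewrite !mxE eqxx /=.
by case: eqVneq => [->|_]; rewrite ?mulr1n ?mulr0n; ring.
Qed.

(** A weighted mean of [f] over such a family is as smooth as [f]: its
    derivatives are means of the same kind of the derivatives of [f]. *)
Lemma Ck_mean k (w : R -> R) f : continuous w -> Ck k setT f ->
  Ck k setT (fun x => mean01 (fun s => w s * f (diag_affine c l s x))).
Proof.
have joint (v : R -> R) (g : 'rV[R]_n -> R) : continuous v -> Ck 0 setT g ->
    continuous (fun p : R * 'rV[R]_n => v p.1 * g (diag_affine c l p.1 p.2)).
  move=> cv [cg _] [s x].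
  have c1 : p.1 @[p --> (s, x)] --> s by exact: cvg_fst.
  apply: cvgM; first exact: (cvg_comp _ _ c1 (@cv s)).
  apply: (cvg_comp _ _ (diag_affine_continuous (x := (s, x)))); exact: cg.
have Ck0 m (g : 'rV[R]_n -> R) : Ck m setT g -> Ck 0 setT g by case: m => [|m] [].
elim: k w f => [|k IH] w f cw Cf.
  split=> // x _; apply: (mean01_continuous (g :=
    fun s x => w s * f (diag_affine c l s x))).
  exact: joint.
split=> [x _|i].
  apply: (mean01_continuous (g := fun s x => w s * f (diag_affine c l s x))).
  by apply: joint => //; exact: Ck0 Cf.
have [dfi CDf] := Cf.2 i; have Cfi : Ck k setT ('D_(delta_mx 0 i) f) := CDf.
have cwl : continuous (fun s => w s * l i s).
  by move=> s; apply: cvgM; [exact: cw|exact: cl].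
have dd x : is_derive x (delta_mx 0 i)
    (fun x => mean01 (fun s => w s * f (diag_affine c l s x)))
    (mean01 (fun s => w s * l i s * 'D_(delta_mx 0 i) f (diag_affine c l s x))).
  pose h (t s : R) := w s * f (diag_affine c l s (t *: delta_mx 0 i + x)).
  pose dh (t s : R) := w s * l i s * 'D_(delta_mx 0 i) f
    (diag_affine c l s (t *: delta_mx 0 i + x)).
  have cline : continuous (fun p : R * R => (p.2, p.1 *: delta_mx 0 i + x)).
    move=> [t s]; have c1 : p.1 @[p --> (t, s)] --> t by exact: cvg_fst.
    have c2 : p.2 @[p --> (t, s)] --> s by exact: cvg_snd.
    apply: (@cvg_pair _ _ _ (nbhs (t, s)) (nbhs s)
      (nbhs (t *: delta_mx 0 i + x : 'rV[R]_n)) _ _ _ _ _ c2).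
    by apply: cvgD; [apply: cvgZr_tmp|exact: cvg_cst].
  have ch : forall t, continuous (h t).
    move=> t s; apply: (@continuous_comp R (R * 'rV[R]_n)%type R
      (fun s => (s, t *: delta_mx 0 i + x : 'rV[R]_n))
      (fun p : R * 'rV[R]_n => w p.1 * f (diag_affine c l p.1 p.2))).
      exact: (@cvg_pair _ _ _ (nbhs s) (nbhs s)
        (nbhs (t *: delta_mx 0 i + x : 'rV[R]_n)) _ _ _ _ _ cvg_id (cvg_cst _)).
    by apply: joint => //; exact: Ck0 Cf.
  have cdh : continuous (fun p : R * R => dh p.1 p.2).
    move=> p; apply: (@continuous_comp (R * R)%type (R * 'rV[R]_n)%type R
      (fun p : R * R => (p.2, p.1 *: delta_mx 0 i + x : 'rV[R]_n))
      (fun p : R * 'rV[R]_n => w p.1 * l i p.1 * 'D_(delta_mx 0 i) f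
        (diag_affine c l p.1 p.2))).
      exact: cline.
    exact: (joint (fun s => w s * l i s) _ cwl (Ck0 _ _ Cfi)).
  have ddh t s : is_derive (t : R) (1 : R) (h ^~ s : R -> R) (dh t s).
    have d1 := @is_derive_line R n f (diag_affine c l s x) (delta_mx 0 i) (t * l i s)
      (dfi _ I).
    have d2 : is_derive t (1 : R) (fun t : R => t * l i s) (l i s).
      have dM := @is_deriveM _ _ (@idfun R) (cst (l i s)) t 1 _ _ (is_derive_id _ _)
        (is_derive_cst _ _ _).
      rewrite (_ : (fun t : R => t * l i s) = (@idfun R) * cst (l i s)) //.
      by apply: is_derive_eq dM _; rewrite /= scaler0 add0r -[_ *: _]/(_ * _) mulr1.
    have d3 := @is_derive1_comp R _ (fun t : R => t * l i s) t _ _ d1 d2.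
    have d4 := @is_deriveZ _ _ _ _ (w s) t 1 _ d3.
    have -> : h ^~ s = w s *: ((fun r => f (r *: delta_mx 0 i + diag_affine c l s x)) \o
      (fun t : R => t * l i s)).
      by apply/funext => t'; rewrite /h diag_affine_line.
    apply: is_derive_eq d4 _; rewrite /dh diag_affine_line -[_ *: _]/(_ * _); ring.
  have := mean01_derive 0 ch cdh ddh.
  set H := fun t : R => mean01 (h t); move=> dH.
  have E : (fun t : R => t^-1 *: (H (t *: 1 + 0) - H 0)) =
     (fun t : R => t^-1 *: ((fun x => mean01 (fun s => w s * f (diag_affine c l s x)))
       (t *: delta_mx 0 i + x) -
                        (fun x => mean01 (fun s => w s * f (diag_affine c l s x))) x)).
    have H0 : H 0 = mean01 (fun s => w s * f (diag_affine c l s x)).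
      by congr mean01; apply/funext => s; rewrite /h scale0r add0r.
    by apply/funext => t; rewrite H0 addr0 -[t *: 1]/(t * 1) mulr1.
  have E2 : dh 0 = (fun s => w s * l i s * 'D_(delta_mx 0 i) f (diag_affine c l s x)).
    by apply/funext => s; rewrite /dh scale0r add0r.
  case: dH; rewrite /derivable /derive E => H1 H2.
  apply: DeriveDef; first exact: H1.
  exact: (etrans H2 (congr1 (@mean01 R) E2)).
split=> [x _|]; first exact: (@ex_derive _ _ _ _ _ _ _ (dd x)).
apply: Ck_eq (IH _ _ cwl Cfi); first exact: openT.
by move=> x _; rewrite (@derive_val _ _ _ _ _ _ _ (dd x)).
Qed.

End DiagAffine.

(** Replace the coordinates of [a] by those of [y] one at a time: the
    increment of [f] along the i-th move is the i-th coordinate of [y - a]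
    times a mean of the i-th partial derivative of [f]. *)
Lemma hadamard f (a : 'rV[R]_n) : Ck 1 setT f ->
  exists q : 'I_n -> 'rV[R]_n -> R,
    [/\ forall k, Ck k.+1 setT f -> forall i, Ck k setT (q i),
        forall i, q i a = 'D_(delta_mx 0 i) f a &
        forall y, f y = f a + \sum_i (y 0 i - a 0 i) * q i y].
Proof.
move=> Cf.
(* The i-th move: the coordinates before i are those of [y], the i-th one runs
   from [a] to [y], those after i are still those of [a]. *)
pose c (i j : 'I_n) (s : R) : R :=
  if (j < i)%N then 0 else if j == i then (1 - s) * a 0 i else a 0 j.
pose l (i j : 'I_n) (s : R) : R := if (j < i)%N then 1 else if j == i then s else 0.
have c1B : continuous (fun s : R => 1 - s).
  by move=> s; apply: cvgB; [exact: cvg_cst|exact: cvg_id].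
have cc i j : continuous (c i j).
  rewrite /c; case: (j < i)%N; first exact: cst_continuous.
  case: (j == i); last exact: cst_continuous.
  by move=> s; apply: cvgM; [exact: c1B|exact: cvg_cst].
have cl i j : continuous (l i j).
  rewrite /l; case: (j < i)%N; first exact: cst_continuous.
  by case: (j == i); [move=> s; exact: cvg_id|exact: cst_continuous].
pose q i (y : 'rV[R]_n) := mean01 (fun s => 1 * 'D_(delta_mx 0 i) f
  (diag_affine (c i) (l i) s y)).
exists q; split.
- move=> k Ckf i.
  have c1 : continuous (fun _ : R => 1 : R) by exact: cst_continuous.
  exact: (Ck_mean (cc i) (cl i) c1 (Ckf.2 i).2).
- move=> i; rewrite /q -[RHS]mean01_cst; congr mean01; apply/funext => s.
  rewrite mul1r (_ : diag_affine _ _ _ _ = a) //; apply/rowP => j; rewrite !mxE /c /l.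
  case: ifP => _; first by ring.
  by case: eqVneq => [->|_]; ring.
move=> y.
pose T (i : nat) : 'rV[R]_n := \row_j (if (j < i)%N then y 0 j else a 0 j).
have step (i : 'I_n) : f (T i.+1) - f (T i) = (y 0 i - a 0 i) * q i y.
  pose d := y 0 i - a 0 i.
  have line s : T i + (s * d) *: delta_mx 0 i = diag_affine (c i) (l i) s y.
    apply/rowP => j; rewrite !mxE /c /l eqxx /=.
    have [ji|ij|/val_inj ->] := ltngtP j i.
    + have -> : (j == i) = false by apply/negbTE; rewrite neq_ltn ji.
      by rewrite mulr0; ring.
    + have -> : (j == i) = false by apply/negbTE; rewrite neq_ltn ij orbT.
      by rewrite mulr0; ring.
    + by rewrite eqxx /d mulr1; ring.
  pose g (s : R) := f ((s * d) *: delta_mx 0 i + T i).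
  have dg s : is_derive s (1 : R) g (d * 'D_(delta_mx 0 i) f
    (diag_affine (c i) (l i) s y)).
    have d1 := @is_derive_line R n f (T i) (delta_mx 0 i) (s * d) ((Cf.2 i).1 _ Logic.I).
    have dM := @is_deriveM _ _ (@idfun R) (cst d) s 1 _ _ (is_derive_id _ _)
      (is_derive_cst _ _ _).
    have d3 := @is_derive1_comp R _ (@idfun R * cst d) s _ _ d1 dM.
    by apply: is_derive_eq d3 _; rewrite /= scaler0 add0r -[d *: 1]/(d * 1) mulr1 mulrC
      addrC line.
  have cD : continuous (fun s => 'D_(delta_mx 0 i) f (diag_affine (c i) (l i) s y)).
    have cA : continuous (fun s => diag_affine (c i) (l i) s y).
      move=> s; apply: (@continuous_comp R (R * 'rV[R]_n)%type 'rV[R]_n (fun s => (s, y))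
        (fun p : R * 'rV[R]_n => diag_affine (c i) (l i) p.1 p.2)).
        exact: (@cvg_pair _ _ _ (nbhs s) (nbhs s) (nbhs y) _ _ _ _ _ cvg_id (cvg_cst _)).
      exact: (diag_affine_continuous (cc i) (cl i)).
    have cDf : continuous ('D_(delta_mx 0 i) f : 'rV[R]_n -> R).
      by move=> x; exact: (Cf.2 i).2.1.
    by move=> s; exact: (continuous_comp (cA s) (cDf _)).
  have cdD : continuous (fun s => d * 'D_(delta_mx 0 i) f (diag_affine (c i) (l i) s y)).
    by move=> s; apply: cvgM; [exact: cvg_cst|exact: cD].
  have -> : f (T i.+1) = g 1.
    rewrite /g mul1r addrC; congr f; apply/rowP => j; rewrite !mxE eqxx /= ltnS /d.
    have [ji|ij|/val_inj ->] := ltngtP j i.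
    + have -> : (j == i) = false by apply/negbTE; rewrite neq_ltn ji.
      by rewrite mulr0 addr0.
    + have -> : (j == i) = false by apply/negbTE; rewrite neq_ltn ij orbT.
      by rewrite mulr0 addr0.
    + by rewrite eqxx mulr1; ring.
  have -> : f (T i) = g 0 by rewrite /g mul0r scale0r add0r.
  rewrite /q; under [X in mean01 X]eq_fun do rewrite mul1r.
  rewrite -/d -mean01Z //.
  have gc s : {for s, continuous g}.
    by apply: differentiable_continuous; exact/derivable1_diffP/ex_derive.
  have := @continuous_FTC2 R (fun s => d * 'D_(delta_mx 0 i) f
    (diag_affine (c i) (l i) s y)) g 0 1 ltr01.
  move=> H; rewrite /mean01 /Rintegral H.
  + by rewrite -EFinB.
  + exact: continuous_subspaceT.
  + split; first by move=> s _; exact: ex_derive.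
      by apply: cvg_at_right_filter; exact: gc.
    by apply: cvg_at_left_filter; exact: gc.
  + by move=> s _; rewrite derive1E; exact: derive_val.
have <- : \sum_(i < n) (f (T i.+1) - f (T i)) = \sum_i (y 0 i - a 0 i) * q i y.
  by apply: eq_bigr => i _; exact: step.
rewrite -(big_mkord xpredT (fun i => f (T i.+1) - f (T i))) telescope_sumr //.
have -> : T n = y by apply/rowP => j; rewrite mxE ltn_ord.
have -> : T 0%N = a by apply/rowP => j; rewrite mxE.
by rewrite addrC subrK.
Qed.

End Hadamard.

(** * The chain rule *)

Section ChainRule.
Variables (R : realType).

(** Multiplication by a bump turns a function that is smooth near a point into
    one that is smooth everywhere, without changing it near that point. *)
Lemma Ck_localize n (U : set 'rV[R]_n) (f : 'rV[R]_n -> R) a : open U -> U a ->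
  exists g : 'rV[R]_n -> R,
    (forall k, Ck k U f -> Ck k setT g) /\ \forall y \near a, g y = f y.
Proof.
move=> oU Ua.
have /nbhs_ballP [e /= e0 eU] : nbhs a U by exact: open_nbhs_nbhs.
have [phi [sphi phi1 phi0]] := rV_bump a (divr_gt0 e0 (ltr0n R 2)).
exists (fun y => phi y * f y); split; last first.
  by apply: filterS phi1 => y ->; rewrite mul1r.
move=> k Cf; apply: Ck_bigcup => x _.
have [Ux|nUx] := pselect (U x).
  exists U => //; apply: Ck_mul => //; apply: Ck_sub (sphi k) => //.
pose W := [set y : 'rV[R]_n | e / 2 < `|y - a|].
have oW : open W.
  apply: (@open_comp _ _ (fun y : 'rV[R]_n => `|y - a|) [set r | e / 2 < r]);
    last exact: open_gt.
  move=> y _.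
  have c : y' - a @[y' --> y] --> y - a by apply: (@cvgB _ _ _ (nbhs y));
    [exact: cvg_id|exact: cvg_cst].
  exact: cvg_norm c.
exists W.
  rewrite /W /= ltNge; apply/negP => xa; apply: nUx; apply: eU.
  rewrite -ball_normE /ball_ /= distrC; apply: le_lt_trans xa _.
  by rewrite ltr_pdivrMr // mulrDr mulr1 ltrDl.
apply: Ck_eq (Ck_cst k W 0) => // y Wy.
by rewrite phi0 ?mul0r // ltW.
Qed.

(** Hadamard's lemma writes the increment of [F \o G] as the sum of the
    increments of the coordinates of [G] times functions continuous at [G x]. *)
Lemma is_derive_chain m n (U : set 'rV[R]_n) (F : 'rV[R]_n -> R)
    (G : 'rV[R]_m -> 'rV[R]_n) (x v : 'rV[R]_m) :
  open U -> U (G x) -> Ck 1 U F -> {for x, continuous G} ->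
  (forall j, derivable (fun y => G y 0 j) x v) ->
  is_derive x v (F \o G)
    (\sum_j 'D_v (fun y => G y 0 j) x * 'D_(delta_mx 0 j) F (G x)).
Proof.
move=> oU UGx CF cG dG.
have [F' [CF' nF']] := Ck_localize F oU UGx.
have [q [Cq qa Fq]] := hadamard (G x) (CF' _ CF).
apply: (@near_eq_is_derive _ _ _ (F' \o G)).
  exact: (cG _ nF').
have -> : \sum_j 'D_v (fun y => G y 0 j) x * 'D_(delta_mx 0 j) F (G x) =
          \sum_j 'D_v (fun y => G y 0 j) x * q j (G x).
  by apply: eq_bigr => j _; rewrite qa (near_eq_derive _ nF').
have cv : h^-1 *: ((F' \o G) (h *: v + x) - (F' \o G) x) @[h --> 0^'] -->
     \sum_j 'D_v (fun y => G y 0 j) x * q j (G x).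
  have -> : (fun h : R => h^-1 *: ((F' \o G) (h *: v + x) - (F' \o G) x)) =
     fun h => \sum_j (h^-1 *: (G (h *: v + x) 0 j - G x 0 j)) * q j (G (h *: v + x)).
    apply/funext => h; rewrite /= (Fq (G (h *: v + x))) addrC addKr scaler_sumr.
    by apply: eq_bigr => j _; rewrite scalerAl.
  apply: (@cvg_big _ _ +%R 0 xpredT (@add_continuous (R : normedModType R)) _ 0^') => j _.
  apply: cvgM; first exact: dG.
  apply: cvg_comp (_ : G (h *: v + x) @[h --> 0^'] --> G x) _.
    apply: (@cvg_within_filter _ _ _ (nbhs 0)).
    have cl : h *: v + x @[h --> (0 : R)] --> x.
      rewrite -[X in _ --> X]add0r -(scale0r v).
      by apply: cvgD; [apply: cvgZr_tmp; exact: cvg_id|exact: cvg_cst].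
    exact: cvg_comp cl cG.
  exact: (Cq 0%N (CF' _ CF) j).1.
by apply: DeriveDef; [apply/cvg_ex; eexists; exact: cv|exact: cvg_lim cv].
Qed.

Lemma Ck_comp m n k (U : set 'rV[R]_n) (V : set 'rV[R]_m) F (G : 'rV[R]_m -> 'rV[R]_n) :
  open U -> open V -> (forall x, V x -> U (G x)) ->
  Ck k U F -> (forall j, Ck k V (fun y => G y 0 j)) -> Ck k V (F \o G).
Proof.
move=> oU oV VU.
have cG k' x : (forall j, Ck k' V (fun y => G y 0 j)) -> V x -> {for x, continuous G}.
  by move=> CG Vx; apply: (@cvg_rV R n _ (nbhs x)) => j; case: k' CG => [|k'] CG;
    exact: (CG j).1.
elim: k F => [|k IH] F CF CG.
  by split=> // x Vx; apply: continuous_comp (cG _ _ CG Vx) (CF.1 _ (VU _ Vx)).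
have CG' j := Ck_pred (CG j).
split=> [x Vx|i].
  exact: continuous_comp (cG _ _ CG Vx) (CF.1 _ (VU _ Vx)).
have CF1 : Ck 1 U F.
  by split=> [x Ux|j]; [exact: CF.1|split=> [|];
    [exact: (CF.2 j).1|case: k CF {IH CG CG'} => [|k] CF; split=> //;
    exact: (CF.2 j).2.1]].
have dd x : V x -> is_derive x (delta_mx 0 i) (F \o G)
    (\sum_j 'D_(delta_mx 0 i) (fun y => G y 0 j) x * 'D_(delta_mx 0 j) F (G x)).
  move=> Vx; apply: is_derive_chain CF1 _ _ => //; [exact: VU|exact: cG CG Vx|].
  by move=> j; exact: ((CG j).2 i).1.
split=> [x Vx|]; first exact: (@ex_derive _ _ _ _ _ _ _ (dd x Vx)).
apply: (@Ck_eq _ _ _ _ (fun x => \sum_j 'D_(delta_mx 0 i)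
  (fun y => G y 0 j) x * ('D_(delta_mx 0 j) F \o G) x)) => //.
  by move=> x Vx; rewrite (@derive_val _ _ _ _ _ _ _ (dd x Vx)).
apply: Ck_sum => // j; apply: Ck_mul => //; first exact: ((CG j).2 i).2.
by apply: IH => //; exact: (CF.2 j).2.
Qed.

End ChainRule.

(** * Smooth functions on a manifold *)

Section ManifoldFunctions.
Variables (R : realType) (n : nat) (M : manifold R n).
Implicit Types (W V : set M) (f g : M -> R).

Lemma chart_img_open (c : chart R n M) W : open W ->
  open (cmap c @` (cdom c `&` W)).
Proof.
move=> oW; rewrite openE => _ [x [cx Wx] <-].
have ci : (cmap c @` cdom c) (cmap c x) by exists x.
have nW : \forall y \near cmap c x, W (cinv c y).
  apply: (cinv_cont ci); rewrite /= cmapK //; exact: open_nbhs_nbhs.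
have nI : \forall y \near cmap c x, (cmap c @` cdom c) y.
  by apply: open_nbhs_nbhs; split => //; exact: cimg_open.
apply: filterS2 nW nI => y Wy [z cz zy]; move: Wy; rewrite -zy => Wy.
by exists z => //; split => //; move: Wy; rewrite cmapK.
Qed.

Lemma smooth_within_sub V W f : V `<=` W -> smooth_within W f -> smooth_within V f.
Proof.
move=> VW sf c Ac k; apply: Ck_sub (sf c Ac k) => _ [x [cx Vx] <-].
by exists x => //; split => //; exact: VW.
Qed.

Lemma smooth_within_bigcup W f :
  (forall m, W m -> exists2 V, V m & smooth_within V f) -> smooth_within W f.
Proof.
move=> H c Ac k; apply: Ck_bigcup => _ [x [cx Wx] <-].
have [V Vx sV] := H x Wx.
by exists (cmap c @` (cdom c `&` V)); [exists x|exact: sV].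
Qed.

Lemma smooth_within_eq W f g : open W -> (forall x, W x -> f x = g x) ->
  smooth_within W f -> smooth_within W g.
Proof.
move=> oW fg sf c Ac k; apply: Ck_eq (sf c Ac k); first exact: chart_img_open.
by move=> _ [x [cx Wx] <-]; rewrite cmapK // fg.
Qed.

Lemma smooth_within_cst W (a : R) : smooth_within W (fun=> a).
Proof. by move=> c _ k; exact: Ck_cst. Qed.

Lemma smooth_withinM W f g : open W ->
  smooth_within W f -> smooth_within W g -> smooth_within W (fun x => f x * g x).
Proof. by move=> oW sf sg c Ac k; apply: Ck_mul;
  [exact: chart_img_open|exact: sf|exact: sg]. Qed.

Lemma smooth_within_sum W (I : Type) (r : seq I) (F : I -> M -> R) : open W ->
  (forall i, smooth_within W (F i)) -> smooth_within W (fun x => \sum_(i <- r) F i x).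
Proof. by move=> oW sF c Ac k; apply: Ck_sum => [|i];
  [exact: chart_img_open|exact: sF]. Qed.

Lemma smooth_within_prod W (I : Type) (r : seq I) (F : I -> M -> R) : open W ->
  (forall i, smooth_within W (F i)) -> smooth_within W (fun x => \prod_(i <- r) F i x).
Proof. by move=> oW sF c Ac k; apply: Ck_prod => [|i];
  [exact: chart_img_open|exact: sF]. Qed.

Lemma smooth_within_inv W f : open W -> (forall x, W x -> f x != 0) ->
  smooth_within W f -> smooth_within W (fun x => (f x)^-1).
Proof.
move=> oW f0 sf c Ac k; apply: (@Ck_inv _ _ k _ (fun y => f (cinv c y))).
- exact: chart_img_open.
- by move=> _ [x [cx Wx] <-]; rewrite cmapK //; exact: f0.
- exact: sf.
Qed.

(** By compatibility of the charts and the chain rule, smoothness may be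
    tested in a single chart. *)
Lemma smooth_within_chart c W f : matlas M c -> open W -> W `<=` cdom c ->
  smooth_on (cmap c @` W) (fun y => f (cinv c y)) -> smooth_within W f.
Proof.
move=> Ac oW Wc sf c' Ac' k.
have oc : open (cmap c @` W).
  by rewrite (_ : W = cdom c `&` W); [exact: chart_img_open|rewrite setIidr].
have oc' : open (cmap c' @` (cdom c' `&` W)) by exact: chart_img_open.
apply: (@Ck_eq _ _ _ _ ((fun y => f (cinv c y)) \o (fun y => cmap c (cinv c' y)))) => //.
  by move=> _ [x [cx Wx] <-] /=; rewrite !cmapK //; exact: Wc.
apply: Ck_comp oc oc' _ (sf k) _.
  by move=> _ [x [cx Wx] <-]; exists x => //; rewrite cmapK.
move=> j; apply: Ck_sub (matlas_compat Ac' Ac j k) => _ [x [cx Wx] <-].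
by exists x => //; split => //; exact: Wc.
Qed.

Lemma smooth_within_coord c j : matlas M c ->
  smooth_within (cdom c) (fun m => cmap c m 0 j).
Proof. by move=> Ac c' Ac' k; exact: matlas_compat Ac' Ac j k. Qed.

Lemma smooth_within_pullback c (F : 'rV[R]_n -> R) : matlas M c ->
  smooth_on setT F -> smooth_within (cdom c) (F \o cmap c).
Proof.
move=> Ac sF; apply: smooth_within_chart Ac (cdom_open c) _ _ => // k.
apply: Ck_eq (Ck_sub _ (sF k)) => //; first exact: cimg_open.
by move=> _ [x cx <-] /=; rewrite cmapK.
Qed.

Lemma smooth_within_setT (f : Cinf M) W : smooth_within W f.
Proof. by apply: (@smooth_within_sub _ setT) => //; exact: submP f. Qed.

Definition mkCinf (f : M -> R) (sf : is_smooth f) : Cinf M :=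
  mksub (S := Submod (@is_smooth0 R n M) (@is_smooth_lin R n M)) sf.

Lemma Cinf_eq (f g : Cinf M) : (forall m, f m = g m) -> f = g.
Proof. by move=> fg; apply: val_inj; apply/funext. Qed.

(** In a chart, transport a bump of R^n and extend it by 0: its support is the
    image of a closed ball, compact, hence closed in M, which is Hausdorff. *)
Lemma manifold_bump W m : open W -> W m ->
  exists (phi : Cinf M) (V C : set M),
    [/\ [/\ open V, V m & V `<=` W], forall x, V x -> phi x = 1,
        closed C /\ C `<=` W & forall x, ~ C x -> phi x = 0].
Proof.
move=> oW Wm; have [c Ac cm] := matlas_cover m.
pose U := cmap c @` (cdom c `&` W); have oU : open U by exact: chart_img_open.
have Um : U (cmap c m) by exists m.
have /nbhs_ballP [e /= e0 eU] : nbhs (cmap c m) U by exact: open_nbhs_nbhs.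
have e20 : 0 < e / 2 by rewrite divr_gt0.
have [phi [sphi phi1 phi0]] := rV_bump (cmap c m) e20.
pose K : set 'rV[R]_n := [set y | `|y - cmap c m| <= e / 2].
have KU : K `<=` U.
  move=> y Ky; apply: eU; rewrite -ball_normE /ball_ /= distrC.
  by apply: le_lt_trans Ky _; rewrite ltr_pdivrMr // mulrDr mulr1 ltrDl.
have cK : compact K.
  apply: bounded_closed_compact.
    exists (e / 2 + `|cmap c m|); split; first exact: num_real.
    move=> r rlt y Ky; apply: ltW; apply: le_lt_trans rlt.
    by rewrite -(subrK (cmap c m) y); apply: le_trans (ler_normD _ _) _; rewrite lerD2r.
  apply: (@closed_comp _ _ (fun y : 'rV[R]_n => `|y - cmap c m|) [set r | r <= e / 2]);
    last exact: closed_le.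
  move=> y _.
  have cy : y' - cmap c m @[y' --> y] --> y - cmap c m.
    by apply: (@cvgB _ _ _ (nbhs y)); [exact: cvg_id|exact: cvg_cst].
  exact: cvg_norm cy.
pose C : set M := cinv c @` K.
have UC y : U y -> (cmap c @` cdom c) y by move=> [x [cx _] <-]; exists x.
have clC : closed C.
  apply: compact_closed; first exact: mhausdorff.
  apply: continuous_compact => //; apply: continuous_in_subspaceT => y /set_mem /KU /UC.
  exact: cinv_cont.
have CW : C `<=` W `&` cdom c.
  by move=> _ [y /KU [x [cx Wx] <-] <-]; rewrite cmapK.
pose f (x : M) : R := if pselect (cdom c x) then phi (cmap c x) else 0.
have fc x : cdom c x -> f x = phi (cmap c x) by rewrite /f; case: pselect.
have f0 x : ~ C x -> f x = 0.
  move=> nC; rewrite /f; case: pselect => // cx; apply: phi0.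
  rewrite leNgt; apply/negP => H; apply: nC; exists (cmap c x); last by rewrite cmapK.
  exact: ltW.
have sf : is_smooth f.
  apply: smooth_within_bigcup => x _; have [Cx|nC] := pselect (C x).
    exists (cdom c); first by case: (CW _ Cx).
    apply: (smooth_within_eq (cdom_open c) _ (smooth_within_pullback Ac sphi)).
    by move=> y cy; rewrite fc.
  exists (~` C) => //; apply: (smooth_within_eq _ _ (smooth_within_cst _ 0)).
    exact: closed_openC.
  by move=> y nCy; rewrite f0.
have : nbhs m (W `&` [set x | f x = 1]).
  apply: filterI; first exact: open_nbhs_nbhs.
  have n1 : \forall x \near m, phi (cmap c x) = 1 by exact: (cmap_cont cm phi1).
  have n2 : \forall x \near m, cdom c x by apply: open_nbhs_nbhs; split => //;
    exact: cdom_open.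
  by apply: filterS2 n1 n2 => x p1 cx; rewrite /= fc.
rewrite nbhsE => -[V [oV Vm] V1].
exists (mkCinf sf), V, C; split => //.
- by split => // x /V1 [].
- by move=> x /V1 [].
- by split => // x /CW [].
Qed.

(** A cut-off function supported in W lets a function that is smooth on W be
    multiplied into a globally smooth one. *)
Lemma smooth_cut (phi : Cinf M) W C f : open W -> closed C -> C `<=` W ->
  (forall x, ~ C x -> phi x = 0) -> smooth_within W f -> is_smooth (fun x => phi x * f x).
Proof.
move=> oW clC CW phi0 sf; apply: smooth_within_bigcup => x _.
have [Cx|nC] := pselect (C x).
  exists W; first exact: CW.
  by apply: smooth_withinM => //; exact: smooth_within_setT.
exists (~` C) => //; apply: (smooth_within_eq _ _ (smooth_within_cst _ 0)).
  exact: closed_openC.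
by move=> y nCy; rewrite phi0 ?mul0r.
Qed.

Lemma smooth_extend W m f : open W -> W m -> smooth_within W f ->
  exists (g : Cinf M) V, [/\ open V, V m, V `<=` W & forall x, V x -> g x = f x].
Proof.
move=> oW Wm sf.
have [phi [V [C [[oV Vm VW] phi1 [clC CW] phi0]]]] := manifold_bump oW Wm.
exists (mkCinf (smooth_cut oW clC CW phi0 sf)), V; split => // x Vx.
by rewrite -[LHS]/(phi x * f x) phi1 ?mul1r.
Qed.

Lemma Cinf_continuous (f : Cinf M) : continuous f.
Proof.
move=> x; have [c Ac cx] := matlas_cover x.
have Ix : (cmap c @` (cdom c `&` setT)) (cmap c x) by exists x.
have cf : {for cmap c x, continuous (fun y => f (cinv c y))}.
  exact: (submP f c Ac 0%N).1.
have n1 : \forall y \near x, f (cinv c (cmap c y)) = f y.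
  have : nbhs x (cdom c) by apply: open_nbhs_nbhs; split => //; exact: cdom_open.
  by apply: filterS => y cy; rewrite cmapK.
have E : f (cinv c (cmap c y)) @[y --> x] --> f (cinv c (cmap c x)).
  exact: (continuous_comp (cmap_cont cx) cf).
rewrite cmapK // in E; apply: cvg_trans E.
by apply: (@near_eq_cvg _ _ (nbhs x)); apply: filterS n1 => y ->.
Qed.

Lemma smooth_neq0_near W m f : open W -> W m -> smooth_within W f -> f m != 0 ->
  exists V, [/\ open V, V m, V `<=` W & forall x, V x -> f x != 0].
Proof.
move=> oW Wm sf f0; have [g [V [oV Vm VW gf]]] := smooth_extend oW Wm sf.
have oo : open (g @^-1` [set r : R | r != 0]).
  by apply: open_comp => [y _|]; [exact: Cinf_continuous|exact: open_neq].
exists (V `&` g @^-1` [set r : R | r != 0]); split.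
- exact: openI.
- by split => //=; rewrite gf.
- by move=> x [/VW].
- by move=> x [Vx /=]; rewrite gf.
Qed.

(** Lindelof property. As [Q] passes to subsets, the basic open sets that
    satisfy it cover M; [set0] fills the unused indices of their enumeration. *)
Lemma countable_cover (Q : set M -> Prop) : Q set0 ->
  (forall V W, V `<=` W -> Q W -> Q V) ->
  (forall m, exists V, [/\ open V, V m & Q V]) ->
  exists W : nat -> set M, (forall k, open (W k) /\ Q (W k)) /\ forall m, exists k, W k m.
Proof.
move=> Q0 QS cover; have [B cB [oB bB]] := @msecond_countable R n M.
have /countable_injP [h hinj] := cB.
pose W k : set M := [set x | exists b, [/\ B b, h b = k, Q b & b x]].
exists W; split=> [k|m].
  have [[b [Bb hb Qb]]|nb] := pselect (exists b, [/\ B b, h b = k & Q b]).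
    rewrite (_ : W k = b); first by split => //; exact: oB.
    rewrite eqEsubset; split=> [x [b' [Bb' hb' _ b'x]]|x bx]; last by exists b.
    by rewrite (hinj b b') ?inE // hb hb'.
  rewrite (_ : W k = set0); first by split => //; exact: open0.
  by rewrite -subset0 => x [b [Bb hb Qb _]]; apply: nb; exists b.
have [V [oV Vm QV]] := cover m.
have [b [Bb bm] bV] := bB m V (open_nbhs_nbhs (conj oV Vm)).
by exists (h b), b; split => //; exact: QS QV.
Qed.

End ManifoldFunctions.

(** * Local frames of a bundle *)

Section Frames.
Variables (R : realType) (n : nat) (M : manifold R n).
Implicit Types (K L : bundle M) (W V : set M).

Lemma sevD K (s t : sec K) m : sev (s + t) m = s m + t m. Proof. by []. Qed.
Lemma sevN K (s : sec K) m : sev (- s) m = - s m. Proof. by []. Qed.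
Lemma sevZ K a (s : sec K) m : sev (a *: s) m = a *: s m. Proof. by []. Qed.
Lemma fmulE K f (s : sec K) m : fmul f s m = f m *: s m. Proof. by []. Qed.

Lemma sev_sum K (I : Type) (r : seq I) (s : I -> sec K) m :
  sev (\sum_(i <- r) s i) m = \sum_(i <- r) s i m.
Proof. by elim: r => [|i r IH]; rewrite ?big_nil // !big_cons sevD IH. Qed.

(** The sheaf property of smooth sections. Together with [has_frames] it
    characterizes vector bundles, and both are checked more easily for DE and
    JE than the definition. *)
Definition local_sections K := forall s : dprod K,
  (forall m : M, exists s' : sec K, \forall x \near m, s x = s' x) -> smooth_sec K s.

(** The members of the frame are global sections, to which operators on
    Gamma(K) can be applied. *)
Definition frame_on K W (I : finType) (s : I -> sec K) :=
  [/\ open W,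
      forall x, W x -> forall v : K x, exists c : I -> R, v = \sum_i c i *: s i x,
      forall x, W x -> forall c : I -> R, \sum_i c i *: s i x = 0 -> forall i, c i = 0
    & forall u : sec K, exists c : I -> M -> R,
        (forall i, smooth_within W (c i)) /\ forall x, W x ->
          u x = \sum_i c i x *: s i x].

Definition has_frames K := forall m, exists W (I : finType) (s : I -> sec K),
  W m /\ frame_on W s.

Lemma frame_on_sub K W V (I : finType) (s : I -> sec K) : open V -> V `<=` W ->
  frame_on W s -> frame_on V s.
Proof.
move=> oV VW [oW sp fr co]; split => // [x /VW|x /VW|u]; [exact: sp|exact: fr|].
have [c [sc uc]] := co u; exists c; split => [i|x /VW]; last exact: uc.
exact: smooth_within_sub (sc i).
Qed.

(** Coordinates in a frame are local functions; cut off by a bump they become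
    global, and [cof_decomp] is an identity between sections to which linear
    and differential operators can be applied. *)
Record coframe K (m : M) := Coframe {
  cof_dom : set M;
  cof_I : finType;
  cof_sec : cof_I -> sec K;
  cof_bump : Cinf M;
  cof_coef : cof_I -> sec K -> Cinf M;
  cof_open : open cof_dom;
  cof_m : cof_dom m;
  cof_bump1 : forall x, cof_dom x -> cof_bump x = 1;
  cof_decomp : forall u, fmul cof_bump u = \sum_i fmul (cof_coef i u) (cof_sec i);
  cof_lin : forall i, linear (cof_coef i);
  cof_mul : forall i f u, cof_coef i (fmul f u) = cmul f (cof_coef i u);
  cof_dual : forall i j x, cof_dom x -> cof_coef i (cof_sec j) x = (i == j)%:R;
  cof_local : forall i (u : sec K) x, u x = 0 -> cof_coef i u x = 0;
  cof_frame : frame_on cof_dom cof_sec }.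

Lemma smooth_near W (m : M) (f : M -> R) : open W -> W m -> smooth_within W f ->
  exists g : Cinf M, \forall x \near m, g x = f x.
Proof.
move=> oW Wm /(smooth_extend oW Wm) [g [V [oV Vm VW gf]]]; exists g.
by apply: filterS gf _; exact: open_nbhs_nbhs.
Qed.

Lemma near_open_nbhs (m : M) (P : M -> Prop) : (\forall x \near m, P x) ->
  exists V, [/\ open V, V m & forall x, V x -> P x].
Proof.
move=> H; have : nbhs m [set x | P x] by exact: H.
by rewrite nbhsE => -[V [oV Vm] VP]; exists V.
Qed.

(** Coefficients in a basis are unique: chosen point by point, they agree with
    the smooth ones given by the frame, and the bump extends them by 0. *)
Lemma coframe_exists K W m : has_frames K -> open W -> W m ->
  exists F : coframe K m, cof_dom F `<=` W.
Proof.
move=> /(_ m) [W1 [I [s [W1m fr1]]]] oW Wm.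
have [oW2 sp fr co] : frame_on (W1 `&` W) s.
  have oW1 : open W1 by case: fr1.
  by apply: frame_on_sub (openI oW1 oW) _ fr1 => x [].
have [phi [V [C [[oV Vm VW] phi1 [clC CW] phi0]]]] := manifold_bump oW2 (conj W1m Wm).
pose coef x (v : K x) : I -> R :=
  if pselect (exists c : I -> R, v = \sum_i c i *: s i x) is left H
  then sval (cid H) else fun=> 0.
have coefE x (v : K x) : (W1 `&` W) x -> v = \sum_i coef x v i *: s i x.
  by move=> Wx; rewrite /coef; case: pselect => [H|[]]; [case: cid|exact: sp].
have coef_uniq x (v : K x) (c : I -> R) : (W1 `&` W) x -> v = \sum_i c i *: s i x ->
  forall i, coef x v i = c i.
  move=> Wx vc i; apply/eqP; rewrite -subr_eq0; apply/eqP.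
  apply: (fr x Wx (fun i => coef x v i - c i)).
  under eq_bigr do rewrite scalerBl.
  by rewrite sumrB -vc -coefE // subrr.
have Usm i (u : sec K) : is_smooth (fun x => phi x * coef x (u x) i).
  apply: smooth_cut clC CW phi0 _ => //.
  have [c [sc uc]] := co u.
  apply: (smooth_within_eq oW2 _ (sc i)) => x Wx.
  by rewrite (coef_uniq _ _ (c ^~ x)) //; exact: uc.
pose U i (u : sec K) : Cinf M := mkCinf (Usm i u).
have UE i (u : sec K) x : U i u x = phi x * coef x (u x) i by [].
have out x : ~ (W1 `&` W) x -> phi x = 0 by move=> nW; apply: phi0 => /CW.
have fr' : frame_on V s by apply: frame_on_sub oV VW _; split.
have Udec u : fmul phi u = \sum_i fmul (U i u) (s i).
  apply: sec_eq => x; rewrite fmulE sev_sum.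
  under eq_bigr do rewrite fmulE UE -scalerA.
  rewrite -scaler_sumr; have [Wx|/out ->] := pselect ((W1 `&` W) x);
    last by rewrite !scale0r.
  by rewrite -coefE.
have Ulin i : linear (U i).
  move=> a u v; apply: Cinf_eq => x.
  rewrite -[RHS]/(a * U i u x + U i v x) !UE mulrCA -mulrDr.
  have [Wx|/out ->] := pselect ((W1 `&` W) x); last by rewrite !mul0r.
  congr (_ * _); rewrite (coef_uniq _ _ (fun i => a * coef x (sev u x) i +
    coef x (sev v x) i)) => //.
  under eq_bigr do rewrite scalerDl -scalerA.
  by rewrite big_split /= -scaler_sumr -!coefE.
have Umul i f u : U i (fmul f u) = cmul f (U i u).
  apply: Cinf_eq => x; rewrite -[RHS]/(f x * U i u x) !UE mulrCA.
  have [Wx|/out ->] := pselect ((W1 `&` W) x); last by rewrite !mul0r.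
  congr (_ * _); rewrite (coef_uniq _ _ (fun i => f x * coef x (u x) i)) => //.
  under eq_bigr do rewrite -scalerA.
  by rewrite -scaler_sumr -!coefE.
have Udual i j x : V x -> U i (s j) x = (i == j)%:R.
  move=> Vx; rewrite UE phi1 // mul1r.
  apply: (coef_uniq _ _ (fun i => (i == j)%:R)); first exact: VW.
  by rewrite (bigD1 j) //= eqxx scale1r big1 ?addr0 // => k /negbTE ->; rewrite scale0r.
have Uloc i (u : sec K) x : u x = 0 -> U i u x = 0.
  move=> u0; rewrite UE; have [Wx|/out ->] := pselect ((W1 `&` W) x);
    last by rewrite mul0r.
  rewrite (coef_uniq _ _ (fun=> 0)) ?mulr0 // u0 big1 // => k _; exact: scale0r.
by exists (Coframe oV Vm phi1 Udec Ulin Umul Udual Uloc fr') => x /VW [].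
Qed.

Lemma coframe_span K m (F : coframe K m) x (u : sec K) : cof_dom F x ->
  u x = \sum_(i : cof_I F) cof_coef i u x *: cof_sec i x.
Proof.
move=> Fx; have := congr1 (fun s : sec K => s x) (cof_decomp F u).
by rewrite fmulE cof_bump1 // scale1r sev_sum.
Qed.

Lemma sec_through K m (v : K m) : has_frames K -> exists s : sec K, s m = v.
Proof.
move=> /(_ m) [W [I [s [Wm [oW sp _ _]]]]].
have [c ->] := sp m Wm v.
exists (\sum_i c i *: s i); rewrite sev_sum; exact: eq_bigr.
Qed.

(** Coefficients in a frame are unique, hence smooth as soon as they are so near
    every point. *)
Lemma vector_bundle_local K : vector_bundle K -> local_sections K.
Proof.
move=> [A [_ _ AS]] s loc; apply/AS => t At.
have ex x : exists c : 'I_(frank t) -> R, fdom t x -> s x = \sum_i c i *: frame i x.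
  have [tx|nt] := pselect (fdom t x); last by exists (fun=> 0).
  by have [c [sc _]] := @frame_basis _ _ _ _ t x tx (s x); exists c.
have [c cE] := choice ex.
exists (fun i x => c x i); split=> [i|x tx]; last exact: cE.
apply: smooth_within_bigcup => x tx.
have [s' /near_open_nbhs [V [oV Vx VE]]] := loc x.
have /AS/(_ t At) [c' [sc' c'E]] := submP s'.
exists (V `&` fdom t) => //.
apply: (smooth_within_eq _ _ (smooth_within_sub _ (sc' i))).
- by apply: openI => //; exact: fdom_open.
- move=> y [Vy ty]; have [c0 [_ c0u]] := @frame_basis _ _ _ _ t y ty (s y).
  have E1 : c0 = [ffun i => c y i].
    by apply: c0u; rewrite {1}(cE y ty); apply: eq_bigr => j _; rewrite ffunE.
  have E2 : c0 = [ffun i => c' i y].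
    apply: c0u; rewrite VE //; transitivity (\sum_j c' j y *: frame j y);
      first exact: c'E.
    by apply: eq_bigr => j _; rewrite ffunE.
  by move: E1; rewrite E2 => /ffunP/(_ i); rewrite !ffunE.
- by move=> y [].
Qed.

(** Multiplied by a bump, a local frame extends to global sections. *)
Lemma vector_bundle_frames K : vector_bundle K -> has_frames K.
Proof.
move=> [A [Acov Atr AS]] m; have [t At tm] := Acov m.
have [phi [V [C [[oV Vm VW] phi1 [clC CW] phi0]]]] :=
  manifold_bump (@fdom_open _ _ _ _ t) tm.
have ssm (i : 'I_(frank t)) : smooth_sec K (fun x => phi x *: frame i x).
  apply/AS => t' At'; have [c [sc cE]] := Atr t t' At At' i.
  exists (fun j x => if pselect (fdom t x) then phi x * c j x else 0); split=> [j|x t'x].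
    apply: smooth_within_bigcup => x t'x; have [Cx|nC] := pselect (C x).
      exists (fdom t `&` fdom t'); first by split => //; exact: CW.
      have oo : open (fdom t `&` fdom t') by apply: openI; exact: fdom_open.
      have sm : smooth_within (fdom t `&` fdom t') (fun x => phi x * c j x).
        by apply: smooth_withinM => //; exact: smooth_within_setT.
      apply: smooth_within_eq oo _ sm.
      by move=> y [ty t'y]; case: pselect.
    exists (~` C `&` fdom t') => //.
    apply: (smooth_within_eq _ _ (smooth_within_cst _ 0)).
      by apply: openI; [exact: closed_openC|exact: fdom_open].
    by move=> y [nCy _]; case: pselect => [ty|nty] //=; rewrite phi0 ?mul0r.
  have [tx|ntx] := pselect (fdom t x); last first.
    rewrite phi0 ?scale0r; last by move=> Cx; apply: ntx; exact: CW.
    by rewrite big1 // => j _; case: pselect => [tx|_] /=; rewrite ?scale0r.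
  rewrite cE // scaler_sumr; apply: eq_bigr => j _; rewrite scalerA.
  by case: pselect.
pose s i : sec K := mksec (ssm i).
have sE (i : 'I_(frank t)) x : V x -> s i x = frame i x.
  by move=> Vx; rewrite -[LHS]/(phi x *: frame i x) phi1 // scale1r.
exists V, 'I_(frank t), s; split => //; split => //.
- move=> x Vx v; have [c [vE _]] := @frame_basis _ _ _ _ t x (VW _ Vx) v.
  by exists c; rewrite {1}vE; apply: eq_bigr => i _; rewrite sE.
- move=> x Vx c c0 i; have [c1 [_ c1u]] := @frame_basis _ _ _ _ t x (VW _ Vx) (0 : K x).
  have E1 : c1 = [ffun i => c i].
    by apply: c1u; apply: etrans (esym c0) _; apply: eq_bigr => j _; rewrite ffunE sE.
  have E2 : c1 = [ffun=> 0].
    by apply: c1u; rewrite big1 // => j _; rewrite ffunE scale0r.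
  by move: E1; rewrite E2 => /ffunP/(_ i); rewrite !ffunE.
- move=> u; have /AS/(_ t At) [c [sc cE]] := submP u.
  exists c; split=> [i|x Vx]; first exact: smooth_within_sub (sc i).
  apply: etrans (cE x (VW _ Vx)) _; by apply: eq_bigr => i _; rewrite sE.
Qed.

Lemma frames_vector_bundle K : local_sections K -> has_frames K -> vector_bundle K.
Proof.
move=> loc fr.
exists [set t | exists s : 'I_(frank t) -> sec K,
  (forall i x, frame i x = s i x) /\ frame_on (fdom t) s].
have cover m : exists2 t : local_frame K, exists s : 'I_(frank t) -> sec K,
    (forall i x, frame i x = s i x) /\ frame_on (fdom t) s & fdom t m.
  have [W [I [s [Wm [oW sp fr' co]]]]] := fr m.
  pose s' (i : 'I_#|I|) : sec K := s (enum_val i).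
  have re x (c : I -> R) : \sum_i c i *: s i x = \sum_(i < #|I|) c (enum_val i) *: s' i x.
    by rewrite (reindex (@enum_val I predT)) //=; apply: onW_bij; exact: enum_val_bij.
  have sp' x : W x -> forall v : K x, exists c : 'I_#|I| -> R, v = \sum_i c i *: s' i x.
    by move=> Wx v; have [c ->] := sp x Wx v; exists (fun i => c (enum_val i));
      rewrite re.
  have fr'' x : W x -> forall c : 'I_#|I| -> R, \sum_i c i *: s' i x = 0 ->
    forall i, c i = 0.
    move=> Wx c c0 i; rewrite -[i]enum_valK.
    apply: (fr' x Wx (fun j => c (enum_rank j))); rewrite re -[RHS]c0.
    by apply: eq_bigr => j _; rewrite enum_valK.
  have basis x : W x -> forall v : K x, exists! c : {ffun 'I_#|I| -> R},
    v = \sum_i c i *: s' i x.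
    move=> Wx v; have [c vE] := sp' x Wx v.
    exists [ffun i => c i]; split; first by rewrite {1}vE; apply: eq_bigr => i _;
      rewrite ffunE.
    move=> c' vE'; apply/ffunP => i; rewrite ffunE; apply/eqP; rewrite -subr_eq0;
      apply/eqP.
    apply: (fr'' x Wx (fun i => c i - c' i)).
    under eq_bigr do rewrite scalerBl.
    by rewrite sumrB -vE -vE' subrr.
  exists (@LocalFrame R n M K W #|I| (fun i => sval_of (s' i)) oW basis) => //=.
  exists s'; split => //; split => // u.
  have [c [sc cE]] := co u; exists (fun i => c (enum_val i)); split=> [i|x Wx].
    exact: sc.
  by rewrite cE // (re x (fun i => c i x)).
split => // [t t' [s [tE _]] [s' [tE' [_ _ _ co']]] i|s].
  have [c [sc cE]] := co' (s i); exists c; split=> [j|x [tx t'x]].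
    by apply: smooth_within_sub (sc j) => x [].
  by rewrite tE cE //; apply: eq_bigr => j _; rewrite tE'.
split=> [Ss t [s' [tE [_ _ _ co]]]|H].
  have [c [sc cE]] := co (mksec Ss); exists c; split => // x tx.
  by rewrite -[LHS]/(mksec Ss x) cE //; apply: eq_bigr => j _; rewrite tE.
apply: loc => m; have [t At tm] := cover m.
have [c [sc cE]] := H t At; have [s' [tE [oW _ _ _]]] := At.
have ex i : exists g : Cinf M, \forall x \near m, g x = c i x.
  exact: smooth_near (sc i).
have [g gE] := choice ex.
exists (\sum_i fmul (g i) (s' i)).
have nW : \forall x \near m, fdom t x by exact: open_nbhs_nbhs.
have ng : \forall x \near m, forall i, g i x = c i x by exact: filter_forall.
apply: filterS2 nW ng => x tx gx.
by rewrite cE // sev_sum; apply: eq_bigr => i _; rewrite fmulE gx tE.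
Qed.

End Frames.

(** * Tangent vectors and local coordinates *)

Section Coordinates.
Variables (R : realType) (n : nat) (M : manifold R n).
Implicit Types (m x : M) (f g : Cinf M).

Definition Ccst (a : R) : Cinf M := mkCinf (@smooth_within_cst _ _ M setT a).

Lemma cevD f g x : cev (f + g) x = f x + g x. Proof. by []. Qed.
Lemma cevN f x : cev (- f) x = - f x. Proof. by []. Qed.
Lemma cevZ a f x : cev (a *: f) x = a * f x. Proof. by []. Qed.
Lemma cmulE f g x : cmul f g x = f x * g x. Proof. by []. Qed.

Lemma cev_sum (I : Type) (r : seq I) (F : I -> Cinf M) x :
  cev (\sum_(i <- r) F i) x = \sum_(i <- r) F i x.
Proof. by elim: r => [|i r IH]; rewrite ?big_nil // !big_cons cevD IH. Qed.

Lemma linear_fun0 (U W : lmodType R) (h : U -> W) : linear h -> h 0 = 0.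
Proof. by move=> hl; rewrite -[X in h X](subrr 0) (linear_sub hl) subrr. Qed.

Lemma linear_fun_sum (U W : lmodType R) (h : U -> W) (I : Type) (r : seq I) (F : I -> U) :
  linear h -> h (\sum_(i <- r) F i) = \sum_(i <- r) h (F i).
Proof.
move=> hl; elim: r => [|i r IH]; first by rewrite !big_nil linear_fun0.
by rewrite !big_cons (linear_add hl) IH.
Qed.

Lemma linear_funZ (U W : lmodType R) (h : U -> W) (a : R) (y : U) : linear h ->
  h (a *: y) = a *: h y.
Proof. by move=> hl; rewrite -[a *: y]addr0 hl linear_fun0 // addr0. Qed.

Section Tangent.
Variables (m : M) (v : Cinf M -> R^o).
Hypothesis tv : tangent_vector m v.

(** If [psi] is a bump at m supported where [f] vanishes, then [psi f = 0], and
    the Leibniz rule gives [v f = 0]. *)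
Lemma tangent_near0 f : (\forall x \near m, f x = 0) -> v f = 0.
Proof.
move=> /near_open_nbhs [W [oW Wm f0]]; case: tv => vl vM.
have [psi [V [C [[oV Vm VW] psi1 [clC CW] psi0]]]] := manifold_bump oW Wm.
have : cmul psi f = 0.
  apply: Cinf_eq => x; rewrite cmulE; have [Wx|nW] := pselect (W x).
    by rewrite f0 ?mulr0.
  by rewrite psi0 ?mul0r // => /CW.
move=> /(congr1 v); rewrite vM linear_fun0 // psi1 // mul1r (f0 m Wm) mulr0 add0r.
by [].
Qed.

Lemma tangent_near_eq f g : (\forall x \near m, f x = g x) -> v f = v g.
Proof.
move=> fg; apply/eqP; rewrite -subr_eq0 -(linear_sub tv.1); apply/eqP/tangent_near0.
by apply: filterS fg => x E; rewrite cevD cevN E subrr.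
Qed.

Lemma tangent_cst a : v (Ccst a) = 0.
Proof.
case: tv => vl vM; have v1 : v (Ccst 1) = 0.
  have := vM (Ccst 1) (Ccst 1).
  rewrite (_ : cmul _ _ = Ccst 1); last by apply: Cinf_eq => x;
    rewrite cmulE -[RHS]/1 -[LHS]/(1 * 1) mulr1.
  rewrite -[cev (Ccst 1) m]/(1 : R) mulr1 mul1r => /eqP.
  by rewrite -subr_eq0 opprD addNKr oppr_eq0 => /eqP.
rewrite (_ : Ccst a = a *: Ccst 1); last by apply: Cinf_eq => x;
  rewrite cevZ -[RHS]/(a * 1) mulr1.
by rewrite linear_funZ // v1 scaler0.
Qed.

Lemma tangent_near_cst f a : (\forall x \near m, f x = a) -> v f = 0.
Proof. by move=> fa; rewrite -(tangent_cst a); apply: tangent_near_eq. Qed.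

End Tangent.

Lemma vector_field_tangent X m : vector_field X ->
  tangent_vector m (fun f => X f m : R^o).
Proof. by move=> [Xl XM]; split=> [a f g|f g]; rewrite ?Xl ?XM. Qed.

(** Coordinate functions and coordinate vector fields are defined on the domain
    of a chart only; these are their products with a bump. *)
Record coords m := Coords {
  co_dom : set M;
  co_X : 'I_n -> Cinf M;
  co_partial : 'I_n -> Cinf M -> Cinf M;
  co_open : open co_dom;
  co_m : co_dom m;
  co_field : forall i, vector_field (co_partial i);
  co_dual : forall i j x, co_dom x -> co_partial i (co_X j) x = (i == j)%:R;
  co_tangent : forall x v f, co_dom x -> tangent_vector x v ->
    v f = \sum_i v (co_X i) * co_partial i f x }.

(** A derivation at x only sees the first-order part of a function: by
    Hadamard's lemma the function is, near x, a constant plus a sum of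
    products of coordinates vanishing at x by smooth functions. *)
Lemma coords_exist m : inhabited (coords m).
Proof.
have [c Ac cm] := matlas_cover m.
have oc : open (cdom c) by exact: cdom_open.
have [phi [V [C [[oV Vm Vc] phi1 [clC Cc] phi0]]]] := manifold_bump oc cm.
have out x : ~ cdom c x -> phi x = 0 by move=> nc; apply: phi0 => /Cc.
pose X j : Cinf M := mkCinf (smooth_cut oc clC Cc phi0 (smooth_within_coord j Ac)).
have XE j x : V x -> X j x = cmap c x 0 j.
  by move=> Vx; rewrite -[LHS]/(phi x * _) phi1 // mul1r.
have img : [set cmap c x | x in cdom c] = cmap c @` (cdom c `&` setT) by rewrite setIT.
have rd f k : Ck k (cmap c @` cdom c) (fun y => f (cinv c y)).
  by rewrite img; exact: (submP f).
have oI : open (cmap c @` cdom c) by exact: cimg_open.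
have dsm i f : smooth_within (cdom c) (fun x => 'D_(delta_mx 0 i) (fun y => f (cinv c y))
  (cmap c x)).
  apply: (smooth_within_chart Ac oc) => // k.
  apply: Ck_eq ((rd f k.+1).2 i).2 => //.
  by move=> _ [x cx <-]; rewrite cmapK.
pose P i f : Cinf M := mkCinf (smooth_cut oc clC Cc phi0 (dsm i f)).
have PE i f x : P i f x = phi x * 'D_(delta_mx 0 i) (fun y => f (cinv c y))
  (cmap c x) by [].
have der i f x : cdom c x -> derivable (fun y => f (cinv c y)) (cmap c x) (delta_mx 0 i).
  by move=> cx; apply: ((rd f 1%N).2 i).1; exists x.
have nI x : cdom c x -> \forall y \near cmap c x, (cmap c @` cdom c) y.
  by move=> cx; apply: open_nbhs_nbhs; split => //; exists x.
have Pfield i : vector_field (P i).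
  split=> [a f g|f g]; apply: Cinf_eq => x.
    rewrite -[RHS]/(a * cev (P i f) x + cev (P i g) x) !PE mulrCA -mulrDr.
    have [cx|/out ->] := pselect (cdom c x); last by rewrite !mul0r.
    congr (_ * _).
    have := deriveD (@derivableZ _ _ _ _ a _ _ (der i f x cx)) (der i g x cx).
    by rewrite (@deriveZ _ _ _ _ a _ _ (der i f x cx)).
  rewrite -[RHS]/(P i f x * g x + f x * P i g x) !PE.
  have [cx|/out ->] := pselect (cdom c x); last by rewrite !mul0r mulr0 addr0.
  have := deriveM (der i f x cx) (der i g x cx).
  rewrite (cmapK cx) => E.
  rewrite -[X in phi x * X]/('D_(delta_mx 0 i)
    ((fun y => f (cinv c y)) * (fun y => g (cinv c y))) (cmap c x)) E.
  rewrite -![_ *: _]/(_ * _); ring.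
have Pdual i j x : V x -> P i (X j) x = (i == j)%:R.
  move=> Vx; have cx := Vc _ Vx; rewrite PE phi1 // mul1r.
  rewrite (@near_eq_derive _ _ _ _ (fun y : 'rV[R]_n => y 0 j)).
    rewrite (@derive_val _ _ _ _ _ _ _ (is_derive_coord _ _ _)) mxE eqxx /= eq_sym.
    by [].
  have nV : \forall y \near cmap c x, V (cinv c y).
    apply: (cinv_cont (_ : (cmap c @` cdom c) (cmap c x))); first by exists x.
    by rewrite /= cmapK //; exact: open_nbhs_nbhs.
  apply: filterS2 nV (nI x cx) => y Vy [z cz zy].
  by move: Vy; rewrite -zy cmapK // => Vz; rewrite XE.
have Ptan x v f : V x -> tangent_vector x v -> v f = \sum_i v (X i) * P i f x.
  move=> Vx tv; have cx := Vc _ Vx; pose a := cmap c x.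
  have Ia : (cmap c @` cdom c) a by exists x.
  have [F [CF nF]] := Ck_localize (fun y => f (cinv c y)) oI Ia.
  have sF k : Ck k setT F by apply: CF; exact: rd.
  have [q [Cq qa Fq]] := hadamard a (sF 1%N).
  have sq i : smooth_within (cdom c) (q i \o cmap c).
    by apply: smooth_within_pullback => // k; exact: Cq.
  have [Q QE] := choice (fun i => smooth_near oc cx (sq i)).
  have -> : v f = v (Ccst (F a) + \sum_i cmul (X i - Ccst (a 0 i)) (Q i)).
    apply: (tangent_near_eq tv).
    have n1 : \forall y \near x, f (cinv c (cmap c y)) = F (cmap c y).
      have H : \forall y \near x, F (cmap c y) =
        f (cinv c (cmap c y)) by exact: (cmap_cont cx nF).
      by apply: filterS H => y ->.
    have n2 : \forall y \near x, forall i, Q i y =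
      (q i \o cmap c) y by exact: filter_forall.
    have n3 : \forall y \near x, V y by exact: open_nbhs_nbhs.
    apply: filterS3 n1 n2 n3 => y E1 E2 Vy; have cy := Vc _ Vy.
    rewrite cmapK // in E1; rewrite E1 Fq cevD cev_sum; congr (_ + _).
    by apply: eq_bigr => i _; rewrite cmulE cevD cevN E2 XE.
  case: (tv) => vl vM; rewrite (linear_add vl) (tangent_cst tv) add0r
    (linear_fun_sum _ _ vl).
  apply: eq_bigr => i _; rewrite vM cevD cevN XE // subrr mul0r addr0.
  rewrite (linear_sub vl) (tangent_cst tv) subr0; congr (_ * _).
  rewrite (nbhs_singleton (QE i)) /= qa phi1 // mul1r.
  exact: (near_eq_derive _ nF).
by constructor; exact: (@Coords m V X P oV Vm Pfield Pdual Ptan).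
Qed.

End Coordinates.

(** * The fibres of DE and JE *)

Lemma mklinear (R : realType) (V W : lmodType R) (f : V -> W) : linear f ->
  exists g : {linear V -> W}, forall x, g x = f x.
Proof.
move=> fl; pose F := GRing.isLinear.Build R V W *:%R f fl.
by exists (HB.pack f F : {linear V -> W}).
Qed.

Section GaugeFibres.
Variables (R : realType) (n : nat) (M : manifold R n) (E : bundle M).
Implicit Types (m x : M) (u : sec E).

Definition mkgauge m (d : sec E -> E m) (gd : is_gauge d) : DE E m :=
  mksub (S := Submod (@is_gauge0 R n M E m) (@is_gauge_lin R n M E m)) gd.

Definition mkjet m (mu : DE E m -> E m) (jm : is_jet mu) : JE E m :=
  mksub (S := Submod (@is_jet0 R n M E m) (@is_jet_lin R n M E m)) jm.

Lemma gauge_ext m (d r : DE E m) : (forall u, gev d u = gev r u) -> d = r.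
Proof. by move=> dr; apply: val_inj; apply/funext. Qed.

Lemma jet_ext m (mu nu : JE E m) : (forall d, jev mu d = jev nu d) -> mu = nu.
Proof. by move=> mn; apply: val_inj; apply/funext. Qed.

Lemma gev_gauge m (d : DE E m) : is_gauge (gev d).
Proof. exact: submP d. Qed.

Lemma gev_linear m (d : DE E m) : linear (gev d).
Proof. by case: (gev_gauge d). Qed.

Lemma gevD m (d r : DE E m) u : gev (d + r) u = gev d u + gev r u. Proof. by []. Qed.
Lemma gevZ m a (d : DE E m) u : gev (a *: d) u = a *: gev d u. Proof. by []. Qed.
Lemma gev0 m u : gev (0 : DE E m) u = 0. Proof. by []. Qed.
Lemma gev_sum m (I : Type) (r : seq I) (F : I -> DE E m) u :
  gev (\sum_(i <- r) F i) u = \sum_(i <- r) gev (F i) u.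
Proof. by elim: r => [|i r IH]; rewrite ?big_nil // !big_cons gevD IH. Qed.

Lemma jev_jet m (mu : JE E m) : is_jet (jev mu).
Proof. exact: submP mu. Qed.
Lemma jev_linear m (mu : JE E m) : linear (jev mu).
Proof. by case: (jev_jet mu). Qed.
Lemma jevD m (mu nu : JE E m) d : jev (mu + nu) d = jev mu d + jev nu d.
Proof. by []. Qed.
Lemma jevN m (mu : JE E m) d : jev (- mu) d = - jev mu d. Proof. by []. Qed.
Lemma jevZ m a (mu : JE E m) d : jev (a *: mu) d = a *: jev mu d. Proof. by []. Qed.
Lemma jev0 m d : jev (0 : JE E m) d = 0. Proof. by []. Qed.
Lemma jev_sum m (I : Type) (r : seq I) (F : I -> JE E m) d :
  jev (\sum_(i <- r) F i) d = \sum_(i <- r) jev (F i) d.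
Proof. by elim: r => [|i r IH]; rewrite ?big_nil // !big_cons jevD IH. Qed.

Lemma gact_val (d : sec (DE E)) u m : gact d u m = gev (d m) u. Proof. by []. Qed.
Lemma jpair_val (mu : sec (JE E)) (d : sec (DE E)) m : jpair mu d m = jev (mu m) (d m).
Proof. by []. Qed.
Lemma jet_val u m (d : DE E m) : jev (jet u m) d = gev d u. Proof. by []. Qed.

Lemma cdo_smooth (d : sec E -> sec E) (cd : covariant_diff_op d) :
  smooth_sec (DE E) (fun m => mkgauge (cdo_gauge m cd)).
Proof. by exists d. Qed.

Definition cdo_sec d (cd : covariant_diff_op d) : sec (DE E) := mksec (cdo_smooth cd).

Lemma gact_cdo_sec d (cd : covariant_diff_op d) u : gact (cdo_sec cd) u = d u.
Proof. exact: sec_eq. Qed.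

Lemma gauge_sec_ext (d r : sec (DE E)) : (forall u, gact d u = gact r u) -> d = r.
Proof.
move=> dr; apply: sec_eq => m; apply: gauge_ext => u.
by rewrite -!gact_val dr.
Qed.

Lemma id_cdo : covariant_diff_op (fun u : sec E => u).
Proof.
split; first by [].
exists (fun=> 0).
  split=> [a f g|f g]; first by rewrite scaler0 addr0.
  by apply: Cinf_eq => x; rewrite cevD !cmulE -[cev 0 x]/(0 : R) mul0r mulr0 addr0.
by move=> f u; apply: sec_eq => x; rewrite sevD !fmulE -[cev 0 x]/(0 : R) scale0r addr0.
Qed.

Definition gid : sec (DE E) := cdo_sec id_cdo.

Lemma gact_gid u : gact gid u = u. Proof. exact: gact_cdo_sec. Qed.

Lemma gid_val m : gid m = gauge_id E m. Proof. by apply: gauge_ext. Qed.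

End GaugeFibres.

(** * Locality of sections of DE and JE *)

Section Tensorial.
Variables (R : realType) (n : nat) (M : manifold R n) (K L : bundle M).
Hypothesis frK : has_frames K.
Variable T : sec K -> sec L.
Hypotheses (Tl : linear T) (Tf : forall f s, T (fmul f s) = fmul f (T s)).

(** Expand the section, cut off by a bump, in a coframe: its coefficients
    vanish where the section does. *)
Lemma tensorial_eq (s t : sec K) m : s m = t m -> T s m = T t m.
Proof.
have T0 (u : sec K) : u m = 0 -> T u m = 0.
  move=> u0; have [F _] := coframe_exists frK openT (Logic.I : setT m).
  have := congr1 (fun s : sec L => s m) (congr1 T (cof_decomp F u)).
  rewrite Tf fmulE cof_bump1 ?scale1r; last exact: cof_m.
  move=> ->; rewrite (linear_fun_sum _ _ Tl) sev_sum big1 // => i _.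
  by rewrite Tf fmulE cof_local // scale0r.
move=> st; apply/eqP; rewrite -subr_eq0; apply/eqP.
by rewrite -[LHS]/(sev (T s - T t) m) -(linear_sub Tl); apply: T0;
  rewrite sevD sevN st subrr.
Qed.

End Tensorial.

Section Locality.
Variables (R : realType) (n : nat) (M : manifold R n) (E : bundle M).
Hypotheses (locE : local_sections E) (frE : has_frames E).

(** An element of DE determines its symbol unless the fibre of E is 0. As the
    rank is locally constant, the exception does not break smoothness. *)
Lemma near_zero_rank m : (exists u : sec E, exists2 W : set M,
  open_nbhs m W & forall x, W x -> u x != 0) \/
  exists2 W : set M, open_nbhs m W & forall x, W x -> forall v : E x, v = 0.
Proof.
have [W [I [s [Wm [oW sp fr co]]]]] := frE m.
have [i0|ni] := pselect (inhabited I).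
  left; case: i0 => i0; exists (s i0), W => // x Wx; apply/eqP => s0.
  have c0 : \sum_i (i == i0)%:R *: s i x = 0.
    rewrite (bigD1 i0) //= eqxx scale1r s0 add0r big1 // => j /negbTE ->.
    by rewrite scale0r.
  by have /eqP := fr x Wx _ c0 i0; rewrite eqxx oner_eq0.
right; exists W => // x Wx v; have [c ->] := sp x Wx v.
by rewrite big1 // => i _; case: ni.
Qed.

(** The symbols at the points must form a vector field. They are unique where E
    is not 0, and are taken to be 0 where it is. *)
Lemma gauge_local : local_sections (DE E).
Proof.
move=> s loc.
have sm (u : sec E) : smooth_sec E (fun x => gev (s x) u).
  apply: locE => m; have [s' ss'] := loc m; exists (gact s' u).
  by apply: filterS ss' => x ->.
pose d u : sec E := mksec (sm u).
pose nz x := exists u : sec E, u x != 0.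
have symb x : exists v : Cinf M -> R^o, tangent_vector x v /\
    if `[< nz x >] then forall f u, gev (s x) (fmul f u) = f x *: gev (s x) u + v f *: u x
    else forall f, v f = 0.
  case: asboolP => [_|_]; last first.
    by exists 0; split => //; split=> [a f g|f g];
      rewrite ?scaler0 ?addr0 // mul0r mulr0 addr0.
  by have [_ [v tv vE]] := gev_gauge (s x); exists v.
have [v vP] := choice symb.
have Xsm (f : Cinf M) : is_smooth (fun x => v x f).
  apply: smooth_within_bigcup => m _.
  have [s' ss'] := loc m.
  have [[u [W [oW Wm] uW]]|[W [oW Wm] W0]] := near_zero_rank m; last first.
    exists W => //; apply: (smooth_within_eq oW _ (smooth_within_cst W 0)) => x Wx.
    have [_] := vP x; case: asboolP => [[u]|_ ->//].
    by rewrite (W0 x Wx (u x)) eqxx.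
  have [_ [X Xf dX]] := gact_cdo s'.
  have /near_open_nbhs [V [oV Vm sV]] := ss'.
  exists (W `&` V) => //.
  apply: (smooth_within_eq (openI oW oV) _ (smooth_within_setT (X f) _)) => x [Wx Vx].
  have [_] := vP x; case: asboolP => [_ H|[]]; last by exists u; exact: uW.
  have := congr1 (fun t : sec E => t x) (dX f u).
  rewrite sevD !fmulE !gact_val -(sV x Vx) H => /addrI/eqP.
  by rewrite eq_sym -subr_eq0 -scalerBl scaler_eq0 (negbTE (uW x Wx)) orbF subr_eq0 =>
    /eqP.
pose X f : Cinf M := mkCinf (Xsm f).
have XE f x : X f x = v x f by [].
exists d => //; split.
  by move=> a u w; apply: sec_eq => x; rewrite -[LHS]/(gev (s x) _) gev_linear.
exists X.
  split=> [a f g|f g]; apply: Cinf_eq => x; have [[vl vM] _] := vP x.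
    by rewrite XE vl.
  by rewrite XE vM.
move=> f u; apply: sec_eq => x; rewrite sevD !fmulE XE.
rewrite -[LHS]/(gev (s x) (fmul f u)) -[d u x]/(gev (s x) u).
have [_] := vP x; case: asboolP => [_ H|nn _]; first exact: H.
have E0 (w : E x) : w = 0.
  have [w' <-] := sec_through w frE; apply: contrapT => w0; apply: nn.
  by exists w'; apply/eqP.
by rewrite [LHS]E0 [RHS]E0.
Qed.

(** With zero symbol the operator acts on the fibres of E. *)
Lemma tensorial_gl (d : sec (DE E)) x :
  (forall f u, gact d (fmul f u) = fmul f (gact d u)) ->
  exists Psi : {linear E x -> E x}, d x = gl_gauge Psi.
Proof.
move=> df; have [dl _] := gact_cdo d.
have [w wE] := choice (fun v : E x => sec_through v frE).
have [|Psi PsiE] := @mklinear R (E x) (E x) (fun v => gact d (w v) x).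
  move=> c u v; rewrite -[RHS]/(sev (c *: gact d (w u) + gact d (w v)) x) -dl.
  by apply: tensorial_eq => //; rewrite sevD sevZ !wE.
exists Psi; apply: gauge_ext => u; rewrite -[RHS]/(Psi (u x)) PsiE -gact_val.
by apply: tensorial_eq => //; rewrite wE.
Qed.

Lemma jet_local : local_sections (JE E).
Proof.
move=> mu loc d; apply: locE => m; have [mu' mm'] := loc m.
by exists (jpair mu' d); apply: filterS mm' => x ->.
Qed.

End Locality.

(** * Local frames of DE and JE *)

Arguments gev : simpl never.
Arguments jev : simpl never.
Arguments sev : simpl never.
Arguments cev : simpl never.

Section GaugeFrame.
Variables (R : realType) (n : nat) (M : manifold R n) (E : bundle M).
Hypotheses (locE : local_sections E) (frE : has_frames E).
Variables (m : M) (F : coframe E m) (C : coords m).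

Local Notation s := (@cof_sec R n M E m F).
Local Notation U := (@cof_coef R n M E m F).
Local Notation X := (@co_X R n M m C).
Local Notation P := (@co_partial R n M m C).
Local Notation phi := (cof_bump F).
Let V : set M := cof_dom F `&` co_dom C.

Let oV : open V. Proof. by apply: openI; [exact: cof_open|exact: co_open]. Qed.

Let phi1 x : V x -> \forall y \near x, phi y = 1.
Proof.
move=> [Fx _]; have : nbhs x (cof_dom F) by apply: open_nbhs_nbhs; split => //;
  exact: cof_open.
by apply: filterS => y; exact: cof_bump1.
Qed.

Let dual_near a b x : V x -> \forall y \near x, U a (s b) y = (a == b)%:R.
Proof.
move=> [Fx _]; have : nbhs x (cof_dom F) by apply: open_nbhs_nbhs; split => //;
  exact: cof_open.
by apply: filterS => y; exact: cof_dual.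
Qed.

Lemma partial_cdo i :
  covariant_diff_op (fun u => \sum_a fmul (P i (U a u)) (s a)).
Proof.
have [Pl PM] := co_field C i; split.
  move=> a u v; rewrite scaler_sumr -big_split /=; apply: eq_bigr => b _.
  by rewrite cof_lin Pl fmulDl.
exists (fun f => cmul (P i f) phi).
  split=> [a f g|f g]; first by rewrite Pl cmulDl.
  rewrite PM; apply: Cinf_eq => x; rewrite !(cmulE, cevD); ring.
move=> f u; rewrite -fmulA cof_decomp.
have fsum g (G : cof_I F -> sec E) : fmul g (\sum_a G a) = \sum_a fmul g (G a).
  by apply: sec_eq => x; rewrite fmulE !sev_sum scaler_sumr.
rewrite !fsum -big_split /=; apply: eq_bigr => a _.
rewrite cof_mul PM !fmulA addrC; apply: sec_eq => x.
by rewrite !(fmulE, sevD) cevD scalerDl.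
Qed.

Lemma unit_cdo a b : covariant_diff_op (fun u => fmul (U a u) (s b)).
Proof.
split=> [c u v|]; first by rewrite cof_lin fmulDl.
exists (fun=> 0).
  split=> [c f g|f g]; first by rewrite scaler0 addr0.
  by apply: Cinf_eq => x; rewrite cevD !cmulE -[cev 0 x]/(0 : R) mul0r mulr0 addr0.
move=> f u; apply: sec_eq => x.
by rewrite cof_mul sevD !fmulE cmulE -[cev 0 x]/(0 : R) scale0r addr0 scalerA.
Qed.

(** Covariant derivative along the i-th coordinate, in the flat connection of
    the frame, and the endomorphism taking [s a] to [s b]. *)
Definition frame_partial i : sec (DE E) := cdo_sec (partial_cdo i).
Definition frame_unit a b : sec (DE E) := cdo_sec (unit_cdo a b).

Lemma frame_partial_val i x u : gev (frame_partial i x) u = \sum_a P i (U a u) x *: s a x.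
Proof. by rewrite -gact_val gact_cdo_sec sev_sum. Qed.

Lemma frame_unit_val a b x u : gev (frame_unit a b x) u = U a u x *: s b x.
Proof. by rewrite -gact_val gact_cdo_sec. Qed.

Lemma frame_partial_sec i a x : V x -> gev (frame_partial i x) (s a) = 0.
Proof.
move=> Vx; rewrite frame_partial_val big1 // => b _.
have t := vector_field_tangent x (co_field C i).
by rewrite (tangent_near_cst t (dual_near b a Vx)) scale0r.
Qed.

Lemma frame_unit_sec a b c x : V x -> gev (frame_unit a b x) (s c) = (a == c)%:R *: s b x.
Proof. by move=> [Fx _]; rewrite frame_unit_val cof_dual. Qed.

Lemma frame_partial_coord i j a x : V x -> gev (frame_partial i x) (fmul (X j) (s a)) =
  (i == j)%:R *: s a x.
Proof.
move=> Vx; rewrite frame_partial_val (bigD1 a) //= big1 => [|b ba].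
  rewrite addr0 cof_mul (co_field C i).2 cevD !cmulE co_dual ?cof_dual ?(eqxx a);
    try by case: Vx.
  have t := vector_field_tangent x (co_field C i).
  by rewrite (tangent_near_cst t (dual_near a a Vx)) mulr0 addr0 mulr1.
rewrite cof_mul (co_field C i).2 cevD !cmulE cof_dual ?(negbTE ba); last by case: Vx.
have t := vector_field_tangent x (co_field C i).
by rewrite (tangent_near_cst t (dual_near b a Vx)) !mulr0 addr0 scale0r.
Qed.

(** A derivative endomorphism is determined by its symbol and its values on
    the frame. *)
Lemma gauge_decomp x (d : DE E x) v k : V x -> tangent_vector x v ->
  (forall f u, gev d (fmul f u) = f x *: gev d u + v f *: u x) ->
  (forall a, gev d (s a) = \sum_b k a b *: s b x) ->
  d = \sum_(ab : cof_I F * cof_I F) k ab.1 ab.2 *: frame_unit ab.1 ab.2 x +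
      \sum_i v (X i) *: frame_partial i x.
Proof.
move=> Vx tv dv dk; apply: gauge_ext => u; rewrite gevD !gev_sum.
have dl := gev_linear d.
have -> : gev d u = gev d (fmul phi u).
  rewrite dv (tangent_near_cst tv (phi1 Vx)) scale0r addr0.
  by rewrite (nbhs_singleton (phi1 Vx)) scale1r.
rewrite cof_decomp (linear_fun_sum _ _ dl).
under eq_bigr do rewrite dv.
rewrite big_split /=; congr (_ + _).
  rewrite -(pair_bigA _ (fun a b => gev (k a b *: frame_unit a b x) u)) /=.
  apply: eq_bigr => a _; rewrite dk scaler_sumr; apply: eq_bigr => b _.
  by rewrite gevZ frame_unit_val !scalerA mulrC.
under [RHS]eq_bigr do rewrite gevZ frame_partial_val scaler_sumr.
rewrite exchange_big /=; apply: eq_bigr => a _.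
rewrite (@co_tangent _ _ _ _ C x v (U a u) Vx.2 tv).
by rewrite scaler_suml; apply: eq_bigr => i _; rewrite scalerA.
Qed.

Let E_frame : frame_on (cof_dom F) s := cof_frame F.

Lemma gauge_span x (d : DE E x) : V x -> exists k v,
  d = \sum_(ab : cof_I F * cof_I F) k ab.1 ab.2 *: frame_unit ab.1 ab.2 x +
      \sum_i v i *: frame_partial i x.
Proof.
move=> Vx; have [_ sp _ _] := E_frame.
have [_ [v tv dv]] := gev_gauge d.
have [k kE] := choice (fun a => sp x Vx.1 (gev d (s a))).
by exists k, (fun i => v (X i)); exact: gauge_decomp.
Qed.

(** The elements [s a] detect the endomorphisms, then the [X j s a] detect the
    derivatives; without any [s a], that is in rank 0, the latter vanish. *)
Lemma gauge_free x k v : V x ->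
  \sum_(ab : cof_I F * cof_I F) k ab.1 ab.2 *: frame_unit ab.1 ab.2 x +
      \sum_i v i *: frame_partial i x = 0 ->
  (forall a b, k a b = 0) /\ (inhabited (cof_I F) -> forall i, v i = 0).
Proof.
move=> Vx H; have [_ _ fr _] := E_frame.
have ev u := congr1 (fun d => gev d u) H.
have k0 a b : k a b = 0.
  have := ev (s a); rewrite gevD !gev_sum gev0.
  rewrite [X in _ + X]big1 ?addr0 => [|i _];
    last by rewrite gevZ frame_partial_sec // scaler0.
  rewrite -(pair_bigA _ (fun c b => gev (k c b *: frame_unit c b x) (s a))) /=.
  rewrite (bigD1 a) //= [X in _ + X]big1 ?addr0 => [|c ca].
    under eq_bigr do rewrite gevZ frame_unit_sec // eqxx scale1r.
    by move=> H'; exact: (fr x Vx.1 _ H').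
  by rewrite big1 // => b' _; rewrite gevZ frame_unit_sec // (negbTE ca) scale0r scaler0.
split => // -[a] j.
have := ev (fmul (X j) (s a)); rewrite gevD !gev_sum gev0.
rewrite big1 ?add0r => [|ab _]; last by rewrite k0 scale0r.
rewrite (bigD1 j) //= big1 ?addr0 => [|i ij]; last first.
  by rewrite gevZ frame_partial_coord // (negbTE ij) scale0r scaler0.
rewrite gevZ frame_partial_coord // eqxx scale1r => H'.
have := fr x Vx.1 (fun b => if b == a then v j else 0) _ a; rewrite eqxx; apply.
rewrite (bigD1 a) //= eqxx H' add0r big1 // => b /negbTE ->.
by rewrite scale0r.
Qed.

(** In rank 0 the bundle DE is 0 and the empty family is a frame of it. *)
Lemma gauge_frame : exists (I : finType) (t : I -> sec (DE E)), frame_on V t.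
Proof.
have [_ sp fr co] := E_frame.
have [inh|ninh] := pselect (inhabited (cof_I F)); last first.
  exists void, (fun i : void => match i with end); split => //.
  - move=> x Vx d; exists (fun=> 0); rewrite big1 ?scaler0; last by case.
    apply: gauge_ext => u; have [c ->] := sp x Vx.1 (gev d u).
    by rewrite big1 // => i; case: ninh.
  - move=> u; exists (fun=> fun=> 0); split; first by case.
    move=> x Vx; rewrite big1 ?scaler0; last by case.
    apply: gauge_ext => w; have [c ->] := sp x Vx.1 (gev (u x) w).
    by rewrite big1 // => i; case: ninh.
exists ((cof_I F * cof_I F) + 'I_n)%type,
  (fun i => match i with inl ab => frame_unit ab.1 ab.2 | inr i => frame_partial i end).
split => //.
- move=> x Vx d; have [k [v ->]] := gauge_span d Vx.
  exists (fun i => match i with inl ab => k ab.1 ab.2 | inr i => v i end).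
  by rewrite big_sumType.
- move=> x Vx c; rewrite big_sumType /= => H.
  have [|k0 v0] := @gauge_free x (fun a b => c (inl (a, b))) (fun i => c (inr i)) Vx.
    by rewrite -[RHS]H; congr (_ + _); apply: eq_bigr => -[a b].
  by case=> [[a b]|i]; [exact: k0|exact: v0].
- move=> d; have [_ [Y Yf dY]] := gact_cdo d.
  have coa a : exists c : cof_I F -> M -> R,
    (forall b, smooth_within (cof_dom F) (c b)) /\
      forall x, cof_dom F x -> gact d (s a) x = \sum_b c b x *: s b x by exact: co.
  have [k kE] := choice coa.
  exists (fun i => match i with inl ab => k ab.1 ab.2 | inr i => Y (X i) end); split.
    case=> [[a b]|i] /=; last exact: smooth_within_setT.
    by apply: smooth_within_sub ((kE a).1 b) => x [].
  move=> x Vx; rewrite big_sumType /=.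
  apply: (@gauge_decomp x (d x) (fun f => Y f x) (fun a b => k a b x)) => //.
  + exact: vector_field_tangent.
  + by move=> f u; rewrite -gact_val dY.
  + by move=> a; rewrite -gact_val (kE a).2 //; case: Vx.
Qed.

Lemma frame_unit_gl a b x : exists Psi : {linear E x -> E x},
  frame_unit a b x = gl_gauge Psi.
Proof. by apply: tensorial_gl => // f u; rewrite !gact_cdo_sec cof_mul fmulA. Qed.

(** A jet is determined by its values on the identity and on the derivatives
    along the coordinates. *)
Lemma jet_determined x (nu : JE E x) : V x -> jev nu (gid E x) = 0 ->
  (forall i, jev nu (frame_partial i x) = 0) -> nu = 0.
Proof.
move=> Vx nu0 nuD; apply: jet_ext => d; have [k [v ->]] := gauge_span d Vx.
have nl := jev_linear nu; rewrite (linear_add nl) !(linear_fun_sum _ _ nl) jev0.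
rewrite !big1 ?addr0 => [|i _|ab _] //; rewrite (linear_funZ _ _ nl).
  by rewrite nuD scaler0.
have [Psi ->] := frame_unit_gl ab.1 ab.2 x.
by rewrite (jev_jet nu).2 -gid_val nu0 linear0 scaler0.
Qed.

(** The frame of JE = E + Hom(TM, E) dual to [gid] and the [frame_partial i]:
    [coord_jet a i] is the differential of [X i] times [s a]. *)
Definition frame_jet a : sec (JE E) := jet (s a).
Definition coord_jet a i : sec (JE E) := jet (fmul (X i) (s a)) - fmul (X i) (jet (s a)).

Lemma frame_jet_partial a i x : V x -> jev (frame_jet a x) (frame_partial i x) = 0.
Proof. exact: frame_partial_sec. Qed.
Lemma coord_jet_id a i x : jev (coord_jet a i x) (gid E x) = 0.
Proof. by rewrite -[LHS]/(X i x *: s a x - X i x *: s a x) subrr. Qed.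
Lemma coord_jet_partial a i j x : V x -> jev (coord_jet a i x) (frame_partial j x) =
  (j == i)%:R *: s a x.
Proof.
move=> Vx; rewrite -[LHS]/(gev (frame_partial j x) (fmul (X i) (s a)) -
  X i x *: gev (frame_partial j x) (s a)).
by rewrite frame_partial_sec // scaler0 subr0 frame_partial_coord.
Qed.

Lemma jet_comb_id x w z : jev (\sum_a w a *: frame_jet a x +
  \sum_(ai : cof_I F * 'I_n) z ai.1 ai.2 *: coord_jet ai.1 ai.2 x)
   (gid E x) = \sum_a w a *: s a x.
Proof.
rewrite jevD !jev_sum [X in _ + X]big1 ?addr0 // => ai _.
by rewrite jevZ coord_jet_id scaler0.
Qed.

Lemma jet_comb_partial x w z i : V x ->
  jev (\sum_a w a *: frame_jet a x +
    \sum_(ai : cof_I F * 'I_n) z ai.1 ai.2 *: coord_jet ai.1 ai.2 x)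
   (frame_partial i x) = \sum_a z a i *: s a x.
Proof.
move=> Vx; rewrite jevD !jev_sum [X in X + _]big1 ?add0r => [|a _];
  last by rewrite jevZ frame_jet_partial // scaler0.
rewrite -(pair_bigA _ (fun a j => jev (z a j *: coord_jet a j x) (frame_partial i x))) /=.
apply: eq_bigr => a _; rewrite (bigD1 i) //= big1 ?addr0 => [|j ji].
  by rewrite jevZ coord_jet_partial // eqxx scale1r.
by rewrite jevZ coord_jet_partial // eq_sym (negbTE ji) scale0r scaler0.
Qed.

Lemma jet_decomp x (nu : JE E x) w z : V x ->
  jev nu (gid E x) = \sum_a w a *: s a x ->
  (forall i, jev nu (frame_partial i x) = \sum_a z a i *: s a x) ->
  nu = \sum_a w a *: frame_jet a x +
    \sum_(ai : cof_I F * 'I_n) z ai.1 ai.2 *: coord_jet ai.1 ai.2 x.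
Proof.
move=> Vx n1 n2; apply/eqP; rewrite -subr_eq0; apply/eqP; apply: jet_determined => //.
  by rewrite jevD jevN jet_comb_id n1 subrr.
by move=> i; rewrite jevD jevN jet_comb_partial // n2 subrr.
Qed.

Lemma jet_frame : exists (I : finType) (t : I -> sec (JE E)), frame_on V t /\
  forall i, exists u f w, t i = jet u - fmul f (jet w).
Proof.
have [_ sp fr co] := E_frame.
exists (cof_I F + cof_I F * 'I_n)%type,
  (fun i => match i with inl a => frame_jet a | inr ai => coord_jet ai.1 ai.2 end).
split; last first.
  case=> [a|ai]; last by exists (fmul (X ai.2) (s ai.1)), (X ai.2), (s ai.1).
  exists (s a), 0, (s a); apply: sec_eq => x.
  by rewrite sevD sevN fmulE -[cev 0 x]/(0 : R) scale0r subr0.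
split => //.
- move=> x Vx nu; have [w wE] := sp x Vx.1 (jev nu (gid E x)).
  have [z zE] := choice (fun i => sp x Vx.1 (jev nu (frame_partial i x))).
  exists (fun i => match i with inl a => w a | inr ai => z ai.2 ai.1 end).
  by rewrite big_sumType /=; exact: (@jet_decomp x nu w (fun a i => z i a)).
- move=> x Vx c; rewrite big_sumType /= => H.
  have /= E1 := congr1 (fun mu => jev mu (gid E x)) H.
  have /= E2 i := congr1 (fun mu => jev mu (frame_partial i x)) H.
  have re : \sum_(ai : cof_I F * 'I_n) c (inr ai) *: coord_jet ai.1 ai.2 x =
     \sum_(ai : cof_I F * 'I_n) (fun a i => c (inr (a, i))) ai.1 ai.2 *:
       coord_jet ai.1 ai.2 x.
    by apply: eq_bigr => -[a i].
  case=> [a|[a i]].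
    by move: E1; rewrite re (jet_comb_id x (fun a => c (inl a))
      (fun a i => c (inr (a, i)))) jev0 => /(fr x Vx.1)/(_ a).
  by move: (E2 i) => /=; rewrite re (jet_comb_partial (fun a => c (inl a))
    (fun a i => c (inr (a, i))))// jev0 => /(fr x Vx.1)/(_ a).
- move=> mu; have [w [sw wE]] := co (jpair mu (gid E)).
  have [z zE] := choice (fun i => co (jpair mu (frame_partial i))).
  exists (fun i => match i with inl a => w a | inr ai => z ai.2 ai.1 end); split.
    case=> [a|[a i]] /=; apply: smooth_within_sub (_ : V `<=` cof_dom F) _ => [x []//|].
      exact: sw.
    exact: (zE i).1.
  move=> x Vx; rewrite big_sumType /=.
  apply: (@jet_decomp x (mu x) (w ^~ x) (fun a i => z i a x)) => //.
    by rewrite -jpair_val wE //; case: Vx.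
  by move=> i; rewrite -jpair_val (zE i).2 //; case: Vx.
Qed.

End GaugeFrame.

Section OmniBundle.
Variables (R : realType) (n : nat) (M : manifold R n) (E : bundle M).
Hypotheses (locE : local_sections E) (frE : has_frames E).

Lemma gauge_has_frames : has_frames (DE E).
Proof.
move=> m; have [F _] := coframe_exists frE openT (I : setT m).
have [C] := coords_exist m; have [J [t tf]] := gauge_frame F C.
by exists (cof_dom F `&` co_dom C), J, t; split => //; split; [exact: cof_m|exact: co_m].
Qed.

(** Frames of this form reduce the smoothness of a bundle map out of JE to its
    values on the jets of sections. *)
Lemma jet_spanned m : exists W (I : finType) (t : I -> sec (JE E)),
  [/\ W m, frame_on W t &
  forall i, exists u f w, t i = jet u - fmul f (jet w)].
Proof.
have [F _] := coframe_exists frE openT (I : setT m).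
have [C] := coords_exist m; have [J [t [tf tj]]] := jet_frame frE F C.
by exists (cof_dom F `&` co_dom C), J, t; split => //; split; [exact: cof_m|exact: co_m].
Qed.

Lemma jet_has_frames : has_frames (JE E).
Proof. by move=> m; have [W [I [t [Wm tf _]]]] := jet_spanned m; exists W, I, t. Qed.

End OmniBundle.

Section DirectSum.
Variables (R : realType) (n : nat) (M : manifold R n) (K L : bundle M).

Lemma dsum_vector_bundle : local_sections K -> has_frames K ->
  local_sections L -> has_frames L -> vector_bundle (dsum K L).
Proof.
move=> lK fK lL fL; apply: frames_vector_bundle.
  move=> s loc; split; [apply: lK => m|apply: lL => m]; have [s' ss'] := loc m.
    by exists (pr1 s'); apply: filterS ss' => x ->.
  by exists (pr2 s'); apply: filterS ss' => x ->.
move=> m; have [W1 [I1 [s1 [W1m fr1]]]] := fK m; have [W2 [I2 [s2 [W2m fr2]]]] := fL m.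
have oW : open (W1 `&` W2) by case: fr1 => ? _ _ _; case: fr2 => ? _ _ _; exact: openI.
have [_ sp1 f1 co1] := frame_on_sub oW (@subIsetl _ W1 W2) fr1.
have [_ sp2 f2 co2] := frame_on_sub oW (@subIsetr _ W1 W2) fr2.
have S1 i : smooth_sec (dsum K L) (fun x => (s1 i x, 0) : dsum K L x).
  by split; [exact: submP (s1 i)|exact: smem0].
have S2 i : smooth_sec (dsum K L) (fun x => (0, s2 i x) : dsum K L x).
  by split; [exact: smem0|exact: submP (s2 i)].
pose t i : sec (dsum K L) :=
  match i with inl i => mksec (S1 i) | inr i => mksec (S2 i) end.
have tE x c : \sum_i c i *: t i x =
    (\sum_i c (inl i) *: s1 i x, \sum_i c (inr i) *: s2 i x) :> dsum K L x.
  rewrite big_sumType /=.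
  have -> : \sum_i c (inl i) *: mksec (S1 i) x =
    (\sum_i c (inl i) *: s1 i x, 0) :> dsum K L x.
    elim/big_rec2: _ => // i y1 y2 _ ->.
    by rewrite -[LHS]/(c (inl i) *: s1 i x + y1,
      c (inl i) *: (0 : L x) + 0) scaler0 addr0.
  have -> : \sum_i c (inr i) *: mksec (S2 i) x =
    (0, \sum_i c (inr i) *: s2 i x) :> dsum K L x.
    elim/big_rec2: _ => // i y1 y2 _ ->.
    by rewrite -[LHS]/(c (inr i) *: (0 : K x) + 0,
      c (inr i) *: s2 i x + y1) scaler0 addr0.
  by rewrite -[LHS]/(_ + 0, 0 + _) addr0 add0r.
exists (W1 `&` W2), (I1 + I2)%type, t; split => //; split => //.
- move=> x Wx [v1 v2]; have [c1 ->] := sp1 x Wx v1; have [c2 ->] := sp2 x Wx v2.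
  by exists (fun i => match i with inl i => c1 i | inr i => c2 i end); rewrite tE.
- move=> x Wx c; rewrite tE => -[H1 H2] [i|i].
    exact: (f1 x Wx _ H1).
  exact: (f2 x Wx _ H2).
- move=> u; have [c1 [sc1 c1E]] := co1 (pr1 u); have [c2 [sc2 c2E]] := co2 (pr2 u).
  exists (fun i => match i with inl i => c1 i | inr i => c2 i end); split; first by case.
  by move=> x Wx; rewrite tE -c1E // -c2E //; exact: surjective_pairing.
Qed.

End DirectSum.

(** * Equality of linear combinations *)

Section LinearCombinations.
Variables (R : realType) (V : lmodType R).

Inductive lincomb :=
| LcAtom of nat | LcZero | LcAdd of lincomb & lincomb
| LcOpp of lincomb | LcScale of R & lincomb.

Fixpoint lc_eval (env : seq V) e : V :=
  match e with
  | LcAtom i => nth 0 env i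
  | LcZero => 0
  | LcAdd e1 e2 => lc_eval env e1 + lc_eval env e2
  | LcOpp e1 => - lc_eval env e1
  | LcScale a e1 => a *: lc_eval env e1
  end.

Fixpoint lc_coef (e : lincomb) (i : nat) : R :=
  match e with
  | LcAtom j => if j == i then 1 else 0
  | LcZero => 0
  | LcAdd e1 e2 => lc_coef e1 i + lc_coef e2 i
  | LcOpp e1 => - lc_coef e1 i
  | LcScale a e1 => a * lc_coef e1 i
  end.

Lemma lc_evalE env e : lc_eval env e = \sum_(i < size env) lc_coef e i *: env`_i.
Proof.
elim: e => [j||e1 IH1 e2 IH2|e1 IH|a e1 IH] /=.
- have [js|js] := ltnP j (size env).
    rewrite (bigD1 (Ordinal js)) //= eqxx scale1r big1 ?addr0 // => i ij.
    by rewrite ifF ?scale0r //; apply/negbTE; move: ij; rewrite eq_sym.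
  rewrite nth_default // big1 // => i _; rewrite ifF ?scale0r //.
  by apply/negbTE; rewrite neq_ltn (leq_trans (ltn_ord i) js) orbT.
- by rewrite big1 // => i _; rewrite scale0r.
- by rewrite IH1 IH2 -big_split; apply: eq_bigr => i _; rewrite scalerDl.
- by rewrite IH -sumrN; apply: eq_bigr => i _; rewrite scaleNr.
- by rewrite IH scaler_sumr; apply: eq_bigr => i _; rewrite scalerA.
Qed.

Fixpoint lc_same (n : nat) (e1 e2 : lincomb) : Prop :=
  if n is k.+1 then lc_coef e1 k = lc_coef e2 k /\ lc_same k e1 e2 else True.

Lemma lc_sameP env e1 e2 : lc_same (size env) e1 e2 -> lc_eval env e1 = lc_eval env e2.
Proof.
rewrite !lc_evalE => H; apply: eq_bigr => i _; congr (_ *: _).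
move: H (ltn_ord i); elim: (size env) (i : nat) => // k IH j [Hk Hs].
by rewrite ltnS leq_eqVlt => /orP[/eqP ->//|]; exact: IH.
Qed.

End LinearCombinations.

Ltac lc_index x env :=
  lazymatch env with
  | (x :: _)%SEQ => constr:(0%N)
  | (_ :: ?env')%SEQ => let i := lc_index x env' in constr:(i.+1)
  end.

Ltac lc_mem x env :=
  lazymatch env with
  | (x :: _)%SEQ => constr:(true)
  | (_ :: ?env')%SEQ => lc_mem x env'
  | _ => constr:(false)
  end.

Ltac lc_atoms t env :=
  lazymatch t with
  | (?a + ?b)%R => let e1 := lc_atoms a env in lc_atoms b e1
  | (- ?a)%R => lc_atoms a env
  | (_ *: ?a)%R => lc_atoms a env
  | 0%R => env
  | _ => lazymatch lc_mem t env with
         | true => env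
         | false => constr:((t :: env)%SEQ)
         end
  end.

Ltac lc_reify R t env :=
  lazymatch t with
  | (?a + ?b)%R => let x := lc_reify R a env in let y := lc_reify R b env in
      constr:(@LcAdd R x y)
  | (- ?a)%R => let x := lc_reify R a env in constr:(@LcOpp R x)
  | (?c *: ?a)%R => let x := lc_reify R a env in constr:(@LcScale R c x)
  | 0%R => constr:(@LcZero R)
  | _ => let i := lc_index t env in constr:(@LcAtom R i)
  end.

(** Both sides are expressed over a common list of atoms, and the coefficients of
    each atom compared. *)
Ltac lincomb R V :=
  lazymatch goal with
  | |- ?l = ?r =>
    let env := lc_atoms l (@nil V) in
    let env := lc_atoms r env in
    let e1 := lc_reify R l env in
    let e2 := lc_reify R r env in
    apply: (@lc_sameP R V env e1 e2); rewrite /=; repeat split; (lra || ring)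
  end.

(** * The Lie derivative of a jet *)

Section GaugeAlgebra.
Variables (R : realType) (n : nat) (M : manifold R n) (E : bundle M).
Implicit Types (d r t s : sec (DE E)) (mu nu eta : sec (JE E)) (u : sec E) (f : Cinf M).

Lemma gact_linear d : linear (gact d). Proof. by case: (gact_cdo d). Qed.
Lemma gactD d u w : gact d (u + w) = gact d u + gact d w.
Proof. exact: (linear_add (gact_linear d)). Qed.
Lemma gactN d u : gact d (- u) = - gact d u.
Proof. by rewrite -scaleN1r (linear_funZ _ _ (gact_linear d)) scaleN1r. Qed.
Lemma gactZ d a u : gact d (a *: u) = a *: gact d u.
Proof. exact: (linear_funZ _ _ (gact_linear d)). Qed.
Lemma gactDl d r u : gact (d + r) u = gact d u + gact r u. Proof. exact: sec_eq. Qed.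
Lemma gactNl d u : gact (- d) u = - gact d u. Proof. exact: sec_eq. Qed.
Lemma gactZl a d u : gact (a *: d) u = a *: gact d u. Proof. exact: sec_eq. Qed.
Lemma gactfl f d u : gact (fmul f d) u = fmul f (gact d u). Proof. exact: sec_eq. Qed.

Lemma jpairDl mu nu d : jpair (mu + nu) d = jpair mu d + jpair nu d.
Proof. exact: sec_eq. Qed.
Lemma jpairNl mu d : jpair (- mu) d = - jpair mu d. Proof. exact: sec_eq. Qed.
Lemma jpairZl a mu d : jpair (a *: mu) d = a *: jpair mu d. Proof. exact: sec_eq. Qed.
Lemma jpair_linear mu : linear (jpair mu).
Proof.
move=> a d r; apply: sec_eq => m; rewrite jpair_val.
rewrite -[RHS]/(a *: jev (mu m) (sev d m) + jev (mu m) (sev r m)).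
exact: jev_linear.
Qed.
Lemma jpairDr mu d r : jpair mu (d + r) = jpair mu d + jpair mu r.
Proof. exact: (linear_add (jpair_linear mu)). Qed.
Lemma jpairNr mu d : jpair mu (- d) = - jpair mu d.
Proof. by rewrite -scaleN1r (linear_funZ _ _ (jpair_linear mu)) scaleN1r. Qed.
Lemma jpairZr mu a d : jpair mu (a *: d) = a *: jpair mu d.
Proof. exact: (linear_funZ _ _ (jpair_linear mu)). Qed.
Lemma jpair0r mu : jpair mu 0 = 0. Proof. exact: (linear_fun0 (jpair_linear mu)). Qed.
Lemma jpairf mu f d : jpair mu (fmul f d) = fmul f (jpair mu d).
Proof.
apply: sec_eq => m; rewrite jpair_val !fmulE.
exact: (linear_funZ _ _ (jev_linear (mu m))).
Qed.

Lemma gbr_jacobi d r t : gbr (gbr d r) t = gbr d (gbr r t) - gbr r (gbr d t).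
Proof.
apply: gauge_sec_ext => u.
rewrite !(gactDl, gactNl, gbrE, gactD, gactN).
lincomb R (sec E).
Qed.

Lemma gbr_anti d r : gbr r d = - gbr d r.
Proof.
apply: gauge_sec_ext => u; rewrite gactNl !gbrE.
lincomb R (sec E).
Qed.

Lemma gbr_linear d : linear (gbr d).
Proof.
move=> a r t; apply: gauge_sec_ext => u;
  rewrite gactDl gactZl !gbrE !gactDl !gactZl !(gactD, gactZ).
lincomb R (sec E).
Qed.

Lemma gbrDr d r t : gbr d (r + t) = gbr d r + gbr d t.
Proof. exact: (linear_add (gbr_linear d)). Qed.
Lemma gbrDl d r t : gbr (r + t) d = gbr r d + gbr t d.
Proof. by rewrite gbr_anti gbrDr opprD -!(gbr_anti d). Qed.
Lemma gbrZr a d r : gbr d (a *: r) = a *: gbr d r.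
Proof. exact: (linear_funZ _ _ (gbr_linear d)). Qed.
Lemma gbrZl a d r : gbr (a *: r) d = a *: gbr r d.
Proof. by rewrite gbr_anti gbrZr -scalerN -gbr_anti. Qed.

Lemma gbr_gid d : gbr (gid E) d = 0.
Proof.
apply: gauge_sec_ext => u; rewrite gbrE !gact_gid subrr; exact: sec_eq.
Qed.
Lemma gbr_gidr d : gbr d (gid E) = 0.
Proof. by rewrite gbr_anti gbr_gid oppr0. Qed.

(** The defining condition of a jet, for a global section of gl(E). *)
Lemma gact_jpair_gl d mu : (forall f u, gact d (fmul f u) = fmul f (gact d u)) ->
  has_frames E -> jpair mu d = gact d (jpair mu (gid E)).
Proof.
move=> df frE; apply: sec_eq => m; rewrite jpair_val gact_val.
have [Psi ->] := tensorial_gl frE m df.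
by rewrite (jev_jet (mu m)).2 -[RHS]/(Psi (jev (mu m) (gid E m))) gid_val.
Qed.

Lemma LieDE d mu s : LieD d mu s = gact d (jpair mu s) - jpair mu (gbr d s).
Proof. by []. Qed.

Lemma omni_jetE d mu r nu s : omni_jet d mu r nu s =
  gact d (jpair nu s) - jpair nu (gbr d s) - (gact r (jpair mu s) - jpair mu (gbr r s))
  + gact s (jpair mu r).
Proof. by rewrite -(jetE (jpair mu r) s). Qed.

Lemma LieD_linear d mu : linear (LieD d mu).
Proof.
move=> a r t; rewrite !LieDE jpair_linear gbr_linear jpair_linear gact_linear.
lincomb R (sec E).
Qed.

Hypotheses (locE : local_sections E) (frE : has_frames E).

Lemma gauge_through m (d : DE E m) : exists s, s m = d.
Proof. exact: (sec_through d (gauge_has_frames frE)). Qed.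

Lemma jpair_inj mu nu : (forall d, jpair mu d = jpair nu d) -> mu = nu.
Proof.
move=> H; apply: sec_eq => m; apply: jet_ext => d; have [s <-] := gauge_through d.
by rewrite -!jpair_val H.
Qed.

(** Here [g] is the derivative of [f] along the symbol of [d]. *)
Lemma gbr_fmul d f s : exists g : Cinf M,
  gbr d (fmul f s) = fmul f (gbr d s) + fmul g s /\
  forall u, gact d (fmul f u) = fmul f (gact d u) + fmul g u.
Proof.
have [_ [X _ dX]] := gact_cdo d; exists (X f); split => //.
apply: gauge_sec_ext => u; rewrite gactDl !gactfl !gbrE !gactfl dX.
apply: sec_eq => m; rewrite !(sevD, sevN, fmulE).
lincomb R (E m).
Qed.

(** The derivatives of [f] in the two terms cancel; hence the Lie derivative acts
    on the fibres of DE. *)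
Lemma LieD_fmul d mu f s : LieD d mu (fmul f s) = fmul f (LieD d mu s).
Proof.
have [g [gE dE]] := gbr_fmul d f s.
rewrite !LieDE gE jpairDr !jpairf dE; apply: sec_eq => m.
rewrite !(sevD, sevN, fmulE); lincomb R (E m).
Qed.

(** Extend the images of the frame at m to sections, and combine these with the
    cut-off coefficients. *)
Lemma gl_through m (Psi : {linear E m -> E m}) : exists d,
  (forall f u, gact d (fmul f u) = fmul f (gact d u)) /\ d m = gl_gauge Psi.
Proof.
have [F _] := coframe_exists frE openT (Logic.I : setT m).
have [w wE] := choice (fun a : cof_I F => sec_through (Psi (cof_sec a m)) frE).
pose T u := \sum_a fmul (cof_coef a u) (w a).
have Tl : linear T.
  move=> a u v; rewrite /T scaler_sumr -big_split; apply: eq_bigr => b _.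
  by rewrite cof_lin fmulDl.
have Tf f u : T (fmul f u) = fmul f (T u).
  apply: sec_eq => x; rewrite /T fmulE !sev_sum scaler_sumr; apply: eq_bigr => a _.
  by rewrite cof_mul !fmulE cmulE scalerA.
have cT : covariant_diff_op T.
  split => //; exists (fun=> 0); last first.
    by move=> f u; rewrite Tf; apply: sec_eq => x;
      rewrite sevD !fmulE -[cev 0 x]/(0 : R) scale0r addr0.
  split=> [a f g|f g]; first by rewrite scaler0 addr0.
  by apply: Cinf_eq => x; rewrite cevD !cmulE -[cev 0 x]/(0 : R) mul0r mulr0 addr0.
exists (cdo_sec cT); split=> [f u|]; first by rewrite !gact_cdo_sec Tf.
apply: gauge_ext => u; rewrite -gact_val gact_cdo_sec /T sev_sum -[RHS]/(Psi (u m)).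
rewrite [in RHS](coframe_span u (cof_m F)) linear_sum; apply: eq_bigr => a _.
by rewrite fmulE wE linearZ.
Qed.

(** Linearity over the functions gives the map on the fibres. The condition on
    gl(E) is the identity [d, Psi] w = d (Psi w) - Psi (d w), where w is the
    value of the jet at the identity. *)
Lemma LieD_is_jet d mu : exists nu, forall s, jpair nu s = LieD d mu s.
Proof.
have Tl := LieD_linear d mu; have Tf := LieD_fmul d mu.
have ten := tensorial_eq (gauge_has_frames frE) Tl Tf.
have [w wE] := choice (fun md : {m : M & DE E m} => gauge_through (projT2 md)).
pose nu0 m (e : DE E m) : E m := LieD d mu (w (existT _ m e)) m.
have nu0E m s : nu0 m (s m) = LieD d mu s m by apply: ten; rewrite wE.
have nu0l m : linear (nu0 m).
  move=> a x y; have [s <-] := gauge_through x; have [t <-] := gauge_through y.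
  rewrite -[a *: s m + t m]/(sev (a *: s + t) m) !nu0E Tl.
  by [].
have jet_nu0 m : is_jet (nu0 m).
  split => // Psi; have [P [Pf Pm]] := gl_through Psi.
  rewrite -Pm -gid_val !nu0E !LieDE gbr_gidr jpair0r subr0.
  have Qf f u : gact (gbr d P) (fmul f u) = fmul f (gact (gbr d P) u).
    rewrite !gbrE Pf; have [g [_ dE]] := gbr_fmul d f P.
    rewrite !dE gactD !Pf; apply: sec_eq => x.
    rewrite !(sevD, sevN, fmulE); lincomb R (E x).
  rewrite (gact_jpair_gl mu Pf frE) (gact_jpair_gl mu Qf frE) gbrE.
  have -> : gact d (gact P (jpair mu (gid E))) -
     (gact d (gact P (jpair mu (gid E))) - gact P (gact d (jpair mu (gid E)))) =
     gact P (gact d (jpair mu (gid E))) by lincomb R (sec E).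
  by rewrite gact_val Pm.
have sm : smooth_sec (JE E) (fun m => mkjet (jet_nu0 m)).
  move=> s; rewrite (_ : (fun m => _) = sval_of (LieD d mu s)); first exact: submP.
  by apply: functional_extensionality_dep => m; exact: nu0E.
by exists (mksec sm) => s; apply: sec_eq => m; exact: nu0E.
Qed.

End GaugeAlgebra.

(** * Structures twisted by an admissible pair *)

Section SumSections.
Variables (R : realType) (n : nat) (M : manifold R n) (K L : bundle M).

Definition sec_pair (a : sec K) (b : sec L) : sec (dsum K L) :=
  @mksec R n M (dsum K L) (fun m => (a m, b m) : dsum K L m) (conj (submP a) (submP b)).

Lemma sec_pair1 a b : pr1 (sec_pair a b) = a. Proof. exact: sec_eq. Qed.
Lemma sec_pair2 a b : pr2 (sec_pair a b) = b. Proof. exact: sec_eq. Qed.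

Lemma dsum_sec_eq (X Y : sec (dsum K L)) : pr1 X = pr1 Y -> pr2 X = pr2 Y -> X = Y.
Proof.
move=> E1 E2; apply: sec_eq => m.
have e1 : (X m).1 = (Y m).1 := congr1 (fun s : sec K => s m) E1.
have e2 : (X m).2 = (Y m).2 := congr1 (fun s : sec L => s m) E2.
by rewrite (surjective_pairing (X m)) e1 e2 -surjective_pairing.
Qed.

Lemma pr1_lin a (X Y : sec (dsum K L)) : pr1 (a *: X + Y) = a *: pr1 X + pr1 Y.
Proof. exact: sec_eq. Qed.
Lemma pr2_lin a (X Y : sec (dsum K L)) : pr2 (a *: X + Y) = a *: pr2 X + pr2 Y.
Proof. exact: sec_eq. Qed.
Lemma pr1D (X Y : sec (dsum K L)) : pr1 (X + Y) = pr1 X + pr1 Y.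
Proof. exact: sec_eq. Qed.
Lemma pr2D (X Y : sec (dsum K L)) : pr2 (X + Y) = pr2 X + pr2 Y.
Proof. exact: sec_eq. Qed.
End SumSections.

Section Twisted.
Variables (R : realType) (n : nat) (M : manifold R n) (E : bundle M).
Hypotheses (locE : local_sections E) (frE : has_frames E).
Variable p : admissible_pair E.
Notation om := (bapp2 (apom p)).
Notation Th := (bapp2 (apTh p)).
Implicit Types (d r t s : sec (DE E)) (mu nu eta : sec (JE E)).

Lemma omDl d r t : om (d + r) t = om d t + om r t.
Proof. by apply: sec_eq => m; exact: (linear_add (bfun2_linl (apom p) (t m))). Qed.
Lemma om_sym d r : om d r = om r d.
Proof. by apply: sec_eq => m; exact: apom_sym. Qed.
Lemma omDr d r t : om d (r + t) = om d r + om d t.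
Proof. by rewrite om_sym omDl !(om_sym _ d). Qed.
Lemma ThDl d r t : Th (d + r) t = Th d t + Th r t.
Proof. by apply: sec_eq => m; exact: (linear_add (bfun2_linl (apTh p) (t m))). Qed.
Lemma ThDr d r t : Th d (r + t) = Th d r + Th d t.
Proof. by apply: sec_eq => m; exact: (linear_add (bfun2_linr (apTh p) (d m))). Qed.
Lemma ThZl a d t : Th (a *: d) t = a *: Th d t.
Proof. by apply: sec_eq => m; exact: (linear_funZ _ _ (bfun2_linl (apTh p) (t m))). Qed.
Lemma ThZr a d t : Th d (a *: t) = a *: Th d t.
Proof. by apply: sec_eq => m; exact: (linear_funZ _ _ (bfun2_linr (apTh p) (d m))). Qed.

Lemma twisted_bracket_ex : exists B : sec (dsum (DE E) (JE E)) ->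
  sec (dsum (DE E) (JE E)) -> sec (dsum (DE E) (JE E)),
  forall X Y, pr1 (B X Y) = gbr (pr1 X) (pr1 Y) /\
    jpair (pr2 (B X Y)) = omni_jet (pr1 X) (pr2 X) (pr1 Y) (pr2 Y) +
      jpair (Th (pr1 X) (pr1 Y)).
Proof.
have ex XY : exists Z : sec (dsum (DE E) (JE E)), pr1 Z = gbr (pr1 XY.1) (pr1 XY.2) /\
    jpair (pr2 Z) = omni_jet (pr1 XY.1) (pr2 XY.1) (pr1 XY.2) (pr2 XY.2) +
      jpair (Th (pr1 XY.1) (pr1 XY.2)).
  move: XY => [X Y] /=.
  have [l1 l1E] := LieD_is_jet frE (pr1 X) (pr2 Y).
  have [l2 l2E] := LieD_is_jet frE (pr1 Y) (pr2 X).
  exists (sec_pair (gbr (pr1 X) (pr1 Y))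
     (l1 - l2 + jet (jpair (pr2 X) (pr1 Y)) + Th (pr1 X) (pr1 Y))).
  rewrite sec_pair1 sec_pair2; split => //; apply/funext => s.
  by rewrite !jpairDl jpairNl l1E l2E.
have [B BE] := choice ex.
by exists (fun X Y => B (X, Y)) => X Y; exact: (BE (X, Y)).
Qed.

Lemma twisted_exists : exists S, twisted p S.
Proof.
have [B BE] := twisted_bracket_ex.
pose pf m (x y : dsum (DE E) (JE E) m) : E m :=
  2^-1 *: (jev y.2 x.1 + jev x.2 y.1) + apom p m x.1 y.1.
have pl m y : linear (fun x => @pf m x y).
  move=> a x x'; rewrite /pf -[(a *: x + x').1]/(a *: x.1 + x'.1).
  rewrite -[(a *: x + x').2]/(a *: x.2 + x'.2).
  by rewrite (jev_linear y.2) jevD jevZ bfun2_linl; lincomb R (E m).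
have pr m x : linear (@pf m x).
  move=> a y y'; rewrite /pf -[(a *: y + y').1]/(a *: y.1 + y'.1).
  rewrite -[(a *: y + y').2]/(a *: y.2 + y'.2).
  by rewrite (jev_linear x.2) jevD jevZ bfun2_linr; lincomb R (E m).
have ps (s t : sec (dsum (DE E) (JE E))) : smooth_sec E (fun m => pf m (s m) (t m)).
  exact: submP (2^-1 *: (jpair (pr2 t) (pr1 s) + jpair (pr2 s) (pr1 t)) +
    om (pr1 s) (pr1 t)).
have al m : linear (fun x : dsum (DE E) (JE E) m => x.1 : DE E m) by [].
have as_ (s : sec (dsum (DE E) (JE E))) : smooth_sec (DE E) (fun m => (s m).1).
  exact: submP (pr1 s).
by exists (CourantData (BMap2 pl pr ps) B (BMap al as_)).
Qed.

Variables (S : courant_data E (dsum (DE E) (JE E))) (tw : twisted p S).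
Implicit Types (X Y Z : sec (dsum (DE E) (JE E))).

Let anchorE X : bapp (canchor S) X = pr1 X.
Proof. by case: tw => H _ _; apply: sec_eq => m; exact: H. Qed.

Let pairE X Y : bapp2 (cpair S) X Y =
  2^-1 *: (jpair (pr2 Y) (pr1 X) + jpair (pr2 X) (pr1 Y)) + om (pr1 X) (pr1 Y).
Proof. by case: tw => _ H _; apply: sec_eq => m; exact: H. Qed.

Let br1 X Y : pr1 (cbr S X Y) = gbr (pr1 X) (pr1 Y).
Proof. by case: tw => _ _ /(_ X Y) []. Qed.

Let br2 X Y s : jpair (pr2 (cbr S X Y)) s =
  gact (pr1 X) (jpair (pr2 Y) s) - jpair (pr2 Y) (gbr (pr1 X) s)
  - (gact (pr1 Y) (jpair (pr2 X) s) - jpair (pr2 X) (gbr (pr1 Y) s))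
  + gact s (jpair (pr2 X) (pr1 Y)) + jpair (Th (pr1 X) (pr1 Y)) s.
Proof.
case: tw => _ _ /(_ X Y) [_ E2].
by rewrite (congr1 (fun f => f s) E2) -[LHS]/(omni_jet _ _ _ _ s + jpair _ s) omni_jetE.
Qed.

Let brP X Y Z : pr1 (cbr S X Y) = pr1 Z ->
  (forall s, jpair (pr2 (cbr S X Y)) s = jpair (pr2 Z) s) -> cbr S X Y = Z.
Proof. by move=> E1 E2; apply: dsum_sec_eq => //; exact: (jpair_inj frE). Qed.

Lemma twisted_linl Y : linear (fun X => cbr S X Y).
Proof.
move=> a X X'; apply: brP; first by rewrite pr1_lin !br1 pr1_lin gbrDl gbrZl.
move=> s; rewrite pr2_lin jpairDl jpairZl !br2 pr1_lin pr2_lin.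
rewrite ThDl ThZl !(jpairDl, jpairZl) gbrDl gbrZl jpairDr jpairZr.
rewrite !(gactDl, gactZl, gactD, gactZ); lincomb R (sec E).
Qed.

Lemma twisted_linr X : linear (cbr S X).
Proof.
move=> a Y Y'; apply: brP; first by rewrite pr1_lin !br1 pr1_lin gbrDr gbrZr.
move=> s; rewrite pr2_lin jpairDl jpairZl !br2 pr1_lin pr2_lin.
rewrite ThDr ThZr !(jpairDl, jpairZl) gbrDl gbrZl !jpairDr !jpairZr.
rewrite !(gactDl, gactZl, gactD, gactZ); lincomb R (sec E).
Qed.

Let cocycleE d r t s :
  gact d (jpair (Th r t) s) - jpair (Th r t) (gbr d s)
  - (gact r (jpair (Th d t) s) - jpair (Th d t) (gbr r s))
  + (gact t (jpair (Th d r) s) - jpair (Th d r) (gbr t s))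
  - gact s (jpair (Th d r) t)
  + jpair (Th d (gbr r t)) s - jpair (Th r (gbr d t)) s - jpair (Th (gbr d r) t) s = 0.
Proof.
have := congr1 (fun f => f s) (apTh_cocycle p d r t).
by rewrite -(jetE (jpair (Th d r) t) s).
Qed.

Lemma twisted_leibniz X Y Z :
  cbr S X (cbr S Y Z) = cbr S (cbr S X Y) Z + cbr S Y (cbr S X Z).
Proof.
apply: brP; first by rewrite pr1D !br1 gbr_jacobi subrK.
move=> s; rewrite pr2D jpairDl.
set d := pr1 X; set r := pr1 Y; set t := pr1 Z.
have c := cocycleE d r t s.
(* Once brackets are expanded, both sides differ by the cocycle identity. *)
rewrite -[LHS]subr0 -c !br2 !br1 -/d -/r -/t !(gactD, gactN).
rewrite !gbrE !gbr_jacobi !(jpairDr, jpairNr).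
lincomb R (sec E).
Qed.

(** [apom_inv] is the diagonal case. *)
Let inv_polar d r t : gact d (om r t) =
  2^-1 *: (jpair (Th d r) t + jpair (Th d t) r) + om (gbr d r) t + om (gbr d t) r.
Proof.
have -> : gact d (om r t) = 2^-1 *: gact d (om (r + t) (r + t)) -
    2^-1 *: gact d (om r r) - 2^-1 *: gact d (om t t).
  rewrite !(omDl, omDr) (om_sym t r) !gactD; lincomb R (sec E).
rewrite !apom_inv ThDr gbrDr !(omDl, omDr) !(jpairDl, jpairDr).
lincomb R (sec E).
Qed.

Lemma twisted_inv X Y Z : gact (bapp (canchor S) X) (bapp2 (cpair S) Y Z) =
  bapp2 (cpair S) (cbr S X Y) Z + bapp2 (cpair S) Y (cbr S X Z).
Proof.
rewrite anchorE !pairE !br1 !br2 !(gactD, gactZ) inv_polar.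
rewrite (gbr_anti (pr1 Y) (pr1 Z)) jpairNr.
rewrite (om_sym (pr1 Y)); lincomb R (sec E).
Qed.

Lemma twisted_square X : pr1 (cbr S X X) = 0 /\
  pr2 (cbr S X X) = jet (bapp2 (cpair S) X X).
Proof.
have g0 d : gbr d d = 0.
  by apply: gauge_sec_ext => u; rewrite gbrE subrr; apply: sec_eq.
split; first by rewrite br1 g0.
apply: (jpair_inj frE) => s; rewrite br2 apTh_diag !jetE pairE !(gactD, gactZ).
lincomb R (sec E).
Qed.

Lemma twisted_courant : is_courant S.
Proof.
have [aE pE _] := tw.
have nondeg m (x : dsum (DE E) (JE E) m) : (forall y, cpair S m x y = 0) -> x = 0.
  case: x => d mu H.
  have d0 : d = 0.
    apply: gauge_ext => u; have := H (0, jet u m); rewrite pE /=.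
    rewrite (linear_fun0 (jev_linear mu)) addr0
      (linear_fun0 (bfun2_linr (apom p) d)) addr0.
    by move/eqP; rewrite scaler_eq0 invr_eq0 pnatr_eq0 => /eqP.
  have mu0 : mu = 0.
    apply: jet_ext => r; have := H (r, 0); rewrite pE /= d0.
    rewrite jev0 add0r (linear_fun0 (bfun2_linl (apom p) r)) addr0.
    by move/eqP; rewrite scaler_eq0 invr_eq0 pnatr_eq0 => /eqP.
  by rewrite d0 mu0.
have costar m (mu : JE E m) : is_costar S mu ((0, mu) : dsum (DE E) (JE E) m).
  move=> x; rewrite pE aE /= (linear_fun0 (jev_linear x.2)) add0r.
  by rewrite (linear_fun0 (bfun2_linl (apom p) x.1)) addr0.
split.
- apply: dsum_vector_bundle; [exact: gauge_local|exact: gauge_has_frames|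
    exact: jet_local|exact: jet_has_frames].
- exact: twisted_linl.
- exact: twisted_linr.
- exact: twisted_leibniz.
- by move=> m x y; rewrite !pE apom_sym addrC [jev y.2 _ + _]addrC addrC.
- exact: nondeg.
- by move=> X Y; rewrite !anchorE br1.
- move=> X m; have [s1 s2] := twisted_square X.
  rewrite (_ : cbr S X X m = (0, jet (bapp2 (cpair S) X X) m)); first exact: costar.
  rewrite -s2 (surjective_pairing (cbr S X X m)); congr (_, _).
  exact: (congr1 (fun s : sec (DE E) => s m) s1).
- exact: twisted_inv.
- by move=> m mu; exists (0, mu).
- move=> m mu k kmu; rewrite aE; apply: gauge_ext => u.
  have := kmu (0, jet u m); rewrite pE aE /=.
  rewrite !(linear_fun0 (jev_linear _)) addr0
    (linear_fun0 (bfun2_linr (apom p) k.1)) addr0 scaler0.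
  by move/eqP; rewrite scaler_eq0 invr_eq0 pnatr_eq0 => /eqP.
Qed.

Lemma twisted_is_exact : is_exact S.
Proof.
have [aE pE _] := tw; split.
- move=> m mu mu0; apply: jet_ext => d; have := mu0 (d, 0).
  rewrite pE aE /= !(linear_fun0 (jev_linear _)) jev0 add0r.
  rewrite (linear_fun0 (bfun2_linl (apom p) d)) addr0 scaler0.
  by move/esym/eqP; rewrite scaler_eq0 invr_eq0 pnatr_eq0 => /eqP.
- move=> m k; rewrite aE => k0; exists k.2 => x.
  rewrite pE aE k0 (linear_fun0 (jev_linear x.2)) add0r.
  by rewrite (linear_fun0 (bfun2_linl (apom p) x.1)) addr0.
- by move=> m d; exists (d, 0); rewrite aE.
Qed.

End Twisted.

(** * Lifting sections through a surjection of bundles *)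

Section Lifting.
Variables (R : realType) (n : nat) (M : manifold R n) (K L : bundle M).
Hypotheses (locK : local_sections K) (frK : has_frames K) (frL : has_frames L).
Variable T : sec K -> sec L.
Hypotheses (Tl : linear T) (Tf : forall f s, T (fmul f s) = fmul f (T s)).
Hypothesis Tsurj : forall m (w : L m), exists Y, T Y m = w.

(** Lifts of the elements of a basis of the fibre at m are carried to a local
    frame near m, the matrix of which has a smooth inverse (its adjugate over
    its determinant). *)
Lemma lift_near (t : sec L) (m : M) : exists Y, \forall x \near m, T Y x = t x.
Proof.
have [W [I [s [Wm [oW sp fr co]]]]] := frL m.
pose N := #|I|; pose s' (i : 'I_N) := s (enum_val i).
have [Y YE] := choice (fun i => Tsurj (s' i m)).
have re x (c : I -> R) : \sum_i c i *: s i x = \sum_(i < N) c (enum_val i) *: s' i x.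
  by rewrite (reindex (@enum_val I predT)) //=; apply: onW_bij; exact: enum_val_bij.
have co' (u : sec L) : exists c : 'I_N -> M -> R, (forall i, smooth_within W (c i)) /\
    forall x, W x -> u x = \sum_i c i x *: s' i x.
  have [c [sc cE]] := co u; exists (fun i => c (enum_val i)); split=> [i|x Wx];
    first exact: sc.
  by rewrite cE // (re x (c ^~ x)).
have fr' x : W x -> forall c : 'I_N -> R, \sum_i c i *: s' i x = 0 -> forall i, c i = 0.
  move=> Wx c c0 i; rewrite -[i]enum_valK.
  apply: (fr x Wx (fun j => c (enum_rank j))); rewrite re -[RHS]c0.
  by apply: eq_bigr => j _; rewrite enum_valK.
have [a aE] := choice (fun i => co' (T (Y i))).
pose A x : 'M[R]_N := \matrix_(i, j) a i j x.
have sdet k (B : M -> 'M[R]_k) : (forall i j, smooth_within W (fun x => B x i j)) ->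
    smooth_within W (fun x => \det (B x)).
  move=> sB; apply: smooth_within_sum => // p.
  apply: smooth_withinM => //; first exact: smooth_within_cst.
  by apply: smooth_within_prod => // i; exact: sB.
have sA i j : smooth_within W (fun x => A x i j).
  by apply: (smooth_within_eq oW _ ((aE i).1 j)) => x _; rewrite mxE.
have sadj i j : smooth_within W (fun x => \adj (A x) i j).
  apply: (@smooth_within_eq _ _ _ _ (fun x => cofactor (A x) j i)) => //.
    by move=> x _; rewrite mxE.
  apply: smooth_withinM => //; first exact: smooth_within_cst.
  apply: sdet => i' j'; apply: (@smooth_within_eq _ _ _ _
    (fun x => A x (lift j i') (lift i j'))) => //.
  by move=> x _; rewrite !mxE.
have Am : A m = 1%:M.
  apply/matrixP => i j; rewrite !mxE; apply/eqP; rewrite -subr_eq0; apply/eqP.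
  apply: (fr' m Wm (fun j => a i j m - (i == j)%:R)).
  under eq_bigr do rewrite scalerBl.
  rewrite sumrB -(aE i).2 // YE (bigD1 i) //= eqxx scale1r big1 ?addr0 ?subrr // => k.
  by rewrite eq_sym => /negbTE ->; rewrite scale0r.
have [V [oV Vm VW V0]] : exists V, [/\ open V, V m, V `<=` W & forall x, V x ->
  \det (A x) != 0].
  by apply: smooth_neq0_near (sdet _ _ sA) _ => //; rewrite Am det1 oner_neq0.
have [c [sc cE]] := co' t.
pose g i x := \sum_k c k x * ((\det (A x))^-1 * \adj (A x) k i).
have sV f : smooth_within W f -> smooth_within V f by exact: smooth_within_sub.
have sg i : smooth_within V (g i).
  apply: smooth_within_sum => // k; apply: smooth_withinM => //; first exact: sV.
  apply: smooth_withinM => //; last exact: sV.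
  by apply: smooth_within_inv => //; apply: sV; exact: sdet.
have [G GE] := choice (fun i => smooth_near oV Vm (sg i)).
exists (\sum_i fmul (G i) (Y i)).
have nV : \forall x \near m, V x by exact: open_nbhs_nbhs.
have nG : \forall x \near m, forall i, G i x = g i x by exact: filter_forall.
apply: filterS2 nV nG => x Vx Gx; have Wx := VW _ Vx.
rewrite (linear_fun_sum _ _ Tl) sev_sum cE //.
under eq_bigr do rewrite Tf fmulE Gx (aE _).2 // scaler_sumr.
rewrite exchange_big /=; apply: eq_bigr => j _.
under eq_bigr do rewrite scalerA.
rewrite -scaler_suml; congr (_ *: _).
have := mul_adj_mx (A x) => /matrixP E.
rewrite /g; under eq_bigr do rewrite mulr_suml.
rewrite exchange_big /= (bigD1 j) //= [X in _ + X]big1 ?addr0 => [|k kj].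
  under eq_bigr do rewrite -mulrA -mulrA.
  rewrite -!mulr_sumr.
  have := E j j; rewrite !mxE eqxx mulr1n => E'.
  under eq_bigr => i _ do rewrite (_ : a i j x = A x i j) ?mxE //.
  rewrite (_ : \sum_i _ = \det (A x)); first by rewrite mulVf ?mulr1 // V0.
  by rewrite -E'; apply: eq_bigr => i _; rewrite !mxE.
under eq_bigr do rewrite -mulrA -mulrA.
rewrite -!mulr_sumr (_ : \sum_i _ = 0) ?mulr0 //.
have := E k j; rewrite !mxE (negbTE kj) mulr0n => E'.
by rewrite -[RHS]E'; apply: eq_bigr => i _; rewrite !mxE.
Qed.

(** Local lifts Y_k over a countable cover, with bumps phi_k equal to 1 on its
    members, are glued by psi_k = phi_k prod_(j < k) (1 - phi_j): where
    phi_k = 1 all later psi_j vanish and the sum of the psi_j is 1, so that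
    local finiteness needs no further choice of the cover. *)
Lemma lift_global (t : sec L) : exists Y, T Y = t.
Proof.
pose Q (V : set M) := exists (phi : Cinf M) (Y : sec K),
  (forall x, V x -> phi x = 1) /\ forall x, phi x != 0 -> T Y x = t x.
have Q0 : Q set0 by exists 0, 0; split => // x; rewrite -[cev 0 x]/(0 : R) eqxx.
have QS V W : V `<=` W -> Q W -> Q V.
  by move=> VW [phi [Y [p1 pY]]]; exists phi, Y; split => // x /VW; exact: p1.
have cov m : exists V, [/\ open V, V m & Q V].
  have [Y /near_open_nbhs [W [oW Wm WY]]] := lift_near t m.
  have [phi [V [C [[oV Vm VW] p1 [clC CW] p0]]]] := manifold_bump oW Wm.
  exists V; split => //; exists phi, Y; split => // x px; apply: WY.
  by apply: contrapT => nW; move/eqP: px; apply; apply: p0 => /CW.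
have [W [WP Wcov]] := countable_cover Q0 QS cov.
have oW k : open (W k) by case: (WP k).
have [phi /choice [Y YP]] := choice (fun k => (WP k).2).
pose P := fix P k : Cinf M :=
  if k is j.+1 then cmul (P j) (Ccst M 1 - phi j) else Ccst M 1.
pose Sm k : sec K := \sum_(j < k) fmul (cmul (phi j) (P j)) (Y j).
have PS k x : P k.+1 x = P k x * (1 - phi k x) by [].
have TS k x : T (Sm k) x = (1 - P k x) *: t x.
  elim: k => [|k IH].
    by rewrite /Sm big_ord0 (linear_fun0 Tl) -[P 0%N x]/(1 : R) subrr scale0r.
  rewrite /Sm big_ord_recr /= (linear_add Tl) sevD -/(Sm k) IH Tf fmulE PS cmulE.
  have [->|p0] := eqVneq (phi k x) 0; first by rewrite mul0r scale0r addr0 subr0 mulr1.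
  by rewrite (YP k).2 // -scalerDl; congr (_ *: _); ring.
have P0 N k x : W N x -> (N < k)%N -> P k x = 0.
  move=> WNx; elim: k => // k IH; rewrite ltnS leq_eqVlt => /orP[/eqP <-|/IH Pk].
    by rewrite PS (YP N).1 // subrr mulr0.
  by rewrite PS Pk mul0r.
have stab N k x : W N x -> (N < k)%N -> Sm k x = Sm N.+1 x.
  move=> WNx; elim: k => // k IH; rewrite ltnS leq_eqVlt => /orP[/eqP <- //|Nk].
  by rewrite /Sm big_ord_recr /= sevD -/(Sm k) IH // fmulE cmulE
    (P0 N) // mulr0 scale0r addr0.
have stab2 N1 N2 x : W N1 x -> W N2 x -> Sm N1.+1 x = Sm N2.+1 x.
  move=> W1 W2; rewrite -(stab N1 (maxn N1 N2).+1) ?ltnS ?leq_maxl //.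
  by rewrite -(stab N2 (maxn N1 N2).+1) ?ltnS ?leq_maxr.
have [N NW] := choice Wcov.
have sm : smooth_sec K (fun m => Sm (N m).+1 m).
  apply: locK => m; exists (Sm (N m).+1).
  have : nbhs m (W (N m)) by apply: open_nbhs_nbhs.
  by apply: filterS => x Wx; exact: stab2.
exists (mksec sm); apply: sec_eq => m.
rewrite (_ : T (mksec sm) m = T (Sm (N m).+1) m).
  by rewrite TS (P0 (N m)) // subr0 scale1r.
exact: (tensorial_eq frK Tl Tf).
Qed.

End Lifting.

(** * Admissible pairs are coboundaries *)

Section ZeroPair.
Variables (R : realType) (n : nat) (M : manifold R n) (E : bundle M).

Definition zero_bmap2 (K L N : bundle M) : bmap2 K L N :=
  @BMap2 R n M K L N (fun m _ _ => 0)
    (fun m y a u v => esym (etrans (addr0 _) (scaler0 _ a)))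
    (fun m x a u v => esym (etrans (addr0 _) (scaler0 _ a)))
    (fun s t => smem0 (smooth_sec N)).

Lemma zero_bapp2 (K L N : bundle M) s t : bapp2 (zero_bmap2 K L N) s t = 0.
Proof. exact: sec_eq. Qed.

Lemma jpair0l d : jpair (0 : sec (JE E)) d = 0. Proof. exact: sec_eq. Qed.

Lemma zero_cocycle : leibniz_cocycle (zero_bmap2 (DE E) (DE E) (JE E)).
Proof.
move=> d r t; apply/funext => s; rewrite !zero_bapp2.
have L0 e : LieD e (0 : sec (JE E)) = 0.
  apply/funext => w; rewrite LieDE !jpair0l subr0; exact: (linear_fun0 (gact_linear e)).
have j0 : jpair (jet (0 : sec E)) s = 0.
  by rewrite jetE; exact: (linear_fun0 (gact_linear s)).
rewrite !L0 -[LHS]/(0 - 0 + 0 - jpair (jet (jpair 0 t)) s + jpair 0 s - jpair 0 s -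
  jpair 0 s).
by rewrite !jpair0l j0 !subr0 !addr0.
Qed.

Lemma zero_diag (d : sec (DE E)) : bapp2 (zero_bmap2 (DE E) (DE E) (JE E)) d d =
  jet (bapp2 (zero_bmap2 (DE E) (DE E) E) d d).
Proof.
rewrite !zero_bapp2; apply: sec_eq => m; apply: jet_ext => e.
by rewrite jet_val jev0 (linear_fun0 (gev_linear e)).
Qed.

Lemma zero_inv (d r : sec (DE E)) :
  2^-1 *: gact d (bapp2 (zero_bmap2 (DE E) (DE E) E) r r) =
  2^-1 *: jpair (bapp2 (zero_bmap2 (DE E) (DE E) (JE E)) d r) r +
  bapp2 (zero_bmap2 (DE E) (DE E) E) (gbr d r) r.
Proof.
rewrite !zero_bapp2 (linear_fun0 (gact_linear d)) scaler0 jpair0l scaler0.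
by rewrite addr0.
Qed.

(** The pair of the untwisted omni-Lie algebroid. *)
Definition zero_pair : admissible_pair E :=
  @AdmissiblePair R n M E (zero_bmap2 _ _ _) (zero_bmap2 _ _ _)
    (fun m x y => erefl) zero_cocycle zero_diag zero_inv.

End ZeroPair.

Section PairsTrivial.
Variables (R : realType) (n : nat) (M : manifold R n) (E : bundle M).

(** The Lie derivative along Id is the identity on jets and Id is central in DE,
    so the invariance and the cocycle condition with first argument Id express
    omega and Theta by [b r = Theta(Id, r)]. *)
Lemma contraction_omega (p : admissible_pair E) (d r : sec (DE E)) :
  bapp2 (apom p) d r =
  2^-1 *: (jpair (bapp2 (apTh p) (gid E) d) r + jpair (bapp2 (apTh p) (gid E) r) d).
Proof.
have sq s : bapp2 (apom p) s s = jpair (bapp2 (apTh p) (gid E) s) s.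
  have := apom_inv p (gid E) s; rewrite gbr_gid gact_gid.
  rewrite (_ : bapp2 (apom p) 0 s = 0); last first.
    by apply: sec_eq => m; exact: (linear_fun0 (bfun2_linl (apom p) (s m))).
  rewrite addr0 => /eqP; rewrite -subr_eq0 -scalerBr scaler_eq0 invr_eq0 pnatr_eq0 /=.
  by rewrite subr_eq0 => /eqP.
have := sq (d + r); rewrite !(omDl, omDr) ThDr !(jpairDl, jpairDr)
  !sq (om_sym p r d) => H.
have -> : bapp2 (apom p) d r = 2^-1 *: ((jpair (bapp2 (apTh p) (gid E) d) d +
  bapp2 (apom p) d r +
   (bapp2 (apom p) d r + jpair (bapp2 (apTh p) (gid E) r) r)) -
   jpair (bapp2 (apTh p) (gid E) d) d - jpair (bapp2 (apTh p) (gid E) r) r).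
  lincomb R (sec E).
rewrite H; lincomb R (sec E).
Qed.

Lemma contraction_theta (p : admissible_pair E) (d r s : sec (DE E)) :
  let b := bapp2 (apTh p) (gid E) in
  jpair (bapp2 (apTh p) d r) s =
  LieD d (b r) s - LieD r (b d) s + gact s (jpair (b d) r) - jpair (b (gbr d r)) s.
Proof.
move=> b; have := congr1 (fun f => f s) (apTh_cocycle p (gid E) d r).
rewrite -[LHS]/(LieD (gid E) (bapp2 (apTh p) d r) s - LieD d (b r) s + LieD r (b d) s -
   jpair (jet (jpair (b d) r)) s + jpair (b (gbr d r)) s -
   jpair (bapp2 (apTh p) d (gbr (gid E) r)) s -
     jpair (bapp2 (apTh p) (gbr (gid E) d) r) s).
rewrite !gbr_gid jetE (LieDE (gid E)) gact_gid gbr_gid jpair0r.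
rewrite (_ : bapp2 (apTh p) d 0 = 0); last first.
  by apply: sec_eq => m; exact: (linear_fun0 (bfun2_linr (apTh p) (d m))).
rewrite (_ : bapp2 (apTh p) 0 r = 0); last first.
  by apply: sec_eq => m; exact: (linear_fun0 (bfun2_linl (apTh p) (r m))).
rewrite !jpair0l => H; have H0 : _ = (0 : sec E) := H; rewrite -[LHS]subr0 -H0.
lincomb R (sec E).
Qed.

Lemma pairs_equiv (p q : admissible_pair E) : pair_equiv p q.
Proof.
pose bf m (d : DE E m) : JE E m := apTh q m (gid E m) d - apTh p m (gid E m) d.
have bl m : linear (@bf m).
  move=> a x y; rewrite /bf !bfun2_linr; lincomb R (JE E m).
have bs (s : sec (DE E)) : smooth_sec (JE E) (fun m => bf m (s m)).
  exact: submP (bapp2 (apTh q) (gid E) s - bapp2 (apTh p) (gid E) s).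
pose b : bmap (DE E) (JE E) := BMap bl bs.
have bE s : bapp b s = bapp2 (apTh q) (gid E) s - bapp2 (apTh p) (gid E) s.
  exact: sec_eq.
exists b; split=> d r.
  rewrite !contraction_omega !bE !(jpairDl, jpairNl); lincomb R (sec E).
apply/funext => s; rewrite (contraction_theta q d r s).
rewrite -[RHS]/(jpair (bapp2 (apTh p) d r) s +
  (LieD d (bapp b r) s - LieD r (bapp b d) s +
   jpair (jet (jpair (bapp b d) r)) s - jpair (bapp b (gbr d r)) s)).
rewrite (contraction_theta p d r s) jetE !LieDE !bE !(jpairDl, jpairNl, gactD, gactN).
lincomb R (sec E).
Qed.

End PairsTrivial.

(** * The standard form of an exact E-Courant algebroid *)

Section StandardForm.
Variables (R : realType) (n : nat) (M : manifold R n) (E : bundle M).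
Hypotheses (locE : local_sections E) (frE : has_frames E).
Variables (K : bundle M) (S : courant_data E K).
Hypotheses (SC : is_courant S) (SX : is_exact S).

Local Notation br := (cbr S).
Local Notation rho X := (bapp (canchor S) X).
Local Notation pair X Y := (bapp2 (cpair S) X Y).
Implicit Types (X Y Z : sec K) (d r s : sec (DE E)) (mu nu : sec (JE E)).

Let locK : local_sections K := vector_bundle_local (ec_bundle SC).
Let frK : has_frames K := vector_bundle_frames (ec_bundle SC).

Let rhoD X Y : rho (X + Y) = rho X + rho Y.
Proof. by apply: sec_eq => m; exact: (linear_add
  (@bfun_lin _ _ _ _ _ (canchor S) m)). Qed.
Let rhoZ a X : rho (a *: X) = a *: rho X.
Proof. by apply: sec_eq => m; exact: (linear_funZ _ _
  (@bfun_lin _ _ _ _ _ (canchor S) m)). Qed.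
Let rhof f X : rho (fmul f X) = fmul f (rho X).
Proof. by apply: sec_eq => m; exact: (linear_funZ _ _
  (@bfun_lin _ _ _ _ _ (canchor S) m)). Qed.
Let pairDl X Y Z : pair (X + Y) Z = pair X Z + pair Y Z.
Proof. by apply: sec_eq => m; exact: (linear_add (bfun2_linl (cpair S) (Z m))). Qed.
Let pairDr X Y Z : pair X (Y + Z) = pair X Y + pair X Z.
Proof. by apply: sec_eq => m; exact: (linear_add (bfun2_linr (cpair S) (X m))). Qed.
Let pairZl a X Y : pair (a *: X) Y = a *: pair X Y.
Proof. by apply: sec_eq => m; exact: (linear_funZ _ _ (bfun2_linl (cpair S) (Y m))). Qed.
Let pairZr a X Y : pair X (a *: Y) = a *: pair X Y.
Proof. by apply: sec_eq => m; exact: (linear_funZ _ _ (bfun2_linr (cpair S) (X m))). Qed.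
Let pairfr f X Y : pair X (fmul f Y) = fmul f (pair X Y).
Proof. by apply: sec_eq => m; exact: (linear_funZ _ _ (bfun2_linr (cpair S) (X m))). Qed.
Let pair_sym X Y : pair X Y = pair Y X.
Proof. by apply: sec_eq => m; exact: ec_sym SC _ _ _. Qed.
Let brDl X Y Z : br (X + Y) Z = br X Z + br Y Z.
Proof. exact: (linear_add (ec_linl SC Z)). Qed.
Let brDr X Y Z : br X (Y + Z) = br X Y + br X Z.
Proof. exact: (linear_add (ec_linr SC X)). Qed.
Let rho_br X Y : rho (br X Y) = gbr (rho X) (rho Y). Proof. exact: ec1 SC X Y. Qed.
Let inv X Y Z : gact (rho X) (pair Y Z) = pair (br X Y) Z + pair Y (br X Z).
Proof. exact: ec3 SC X Y Z. Qed.

Let nondeg m (k l : K m) : (forall y, cpair S m k y = cpair S m l y) -> k = l.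
Proof.
move=> kl; apply/eqP; rewrite -subr_eq0; apply/eqP; apply: (ec_nondeg SC) => y.
by rewrite (linear_sub (bfun2_linl (cpair S) y)) kl subrr.
Qed.

Let pair_inj X Y : (forall Z, pair X Z = pair Y Z) -> X = Y.
Proof.
move=> H; apply: sec_eq => m; apply: nondeg => y; have [Z <-] := sec_through y frK.
exact: (congr1 (fun u : sec E => u m) (H Z)).
Qed.

(** [star] is the dual anchor: its values exist by [ec4] and are unique because
    the pairing is nondegenerate. *)
Let costar_ex m (mu : JE E m) : exists k, is_costar S mu k.
Proof. exact: ec4 SC m mu. Qed.

Let star m (mu : JE E m) : K m := sval (cid (costar_ex mu)).

Let starP m (mu : JE E m) : is_costar S mu (star mu).
Proof. by rewrite /star; case: cid. Qed.

Let star_uniq m (mu : JE E m) k : is_costar S mu k -> k = star mu.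
Proof. by move=> H; apply: nondeg => y; rewrite H starP. Qed.

Let star_linear m : linear (@star m).
Proof.
move=> a mu nu; apply/esym/star_uniq => x.
by rewrite bfun2_linl !starP jevD jevZ; lincomb R (E m).
Qed.

Let rho_star m (mu : JE E m) : canchor S m (star mu) = 0.
Proof. exact: ec5 SC _ _ _ (starP mu). Qed.

Let star_inj m (mu nu : JE E m) : star mu = star nu -> mu = nu.
Proof.
move=> H; apply/eqP; rewrite -subr_eq0; apply/eqP; apply: (ex_inj SX).
by rewrite -(subrr (star mu)) {2}H -(linear_sub (@star_linear m)); exact: starP.
Qed.

Let rho_linear : linear (fun X => rho X).
Proof. by move=> a X Y; rewrite rhoD rhoZ. Qed.

Lemma anchor_lift d : exists X, rho X = d.
Proof.
apply: (lift_global locK frK (gauge_has_frames frE) rho_linear rhof) => m w.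
have [k <-] := ex_surj SX w; have [X <-] := sec_through k frK.
by exists X.
Qed.

Variable e : sec K.
Hypothesis rho_e : rho e = gid E.

Let P X := br e X.

(** P is a projection onto the kernel of the anchor: its values lie there
    because Id is central in DE. As Id acts as the identity on E, invariance of
    the pairing gives the next identity, from which P is linear over the
    functions and, the kernel being isotropic, fixes the kernel. *)
Let P_pair X Y : pair (P X) Y + pair X (P Y) = pair X Y.
Proof. by rewrite -inv rho_e gact_gid. Qed.

Let P_linear : linear P. Proof. exact: ec_linr SC e. Qed.

Let P_fmul f X : P (fmul f X) = fmul f (P X).
Proof.
apply: pair_inj => Y.
have E1 := P_pair (fmul f X) Y; have E2 := P_pair X Y.
apply: (addIr (pair (fmul f X) (P Y))); rewrite E1.
have pfl Z W : pair (fmul f Z) W = fmul f (pair Z W) by rewrite pair_sym pairfr pair_sym.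
rewrite !pfl -E2; apply: sec_eq => m; rewrite !(fmulE, sevD).
by rewrite scalerDr.
Qed.

Let rho_P X : rho (P X) = 0. Proof. by rewrite rho_br rho_e gbr_gid. Qed.

Let P_kernel X m : canchor S m (X m) = 0 -> P X m = X m.
Proof.
move=> X0; have [mu Xmu] := ex_mid SX X0.
apply: nondeg => y; have [Y <-] := sec_through y frK.
have := congr1 (fun u : sec E => u m) (P_pair X Y).
rewrite sevD -[pair (P X) Y m]/(cpair S m (P X m) (Y m)) => H.
have z : pair X (P Y) m = 0.
  rewrite -[LHS]/(cpair S m (X m) (P Y m)) Xmu.
  rewrite (_ : canchor S m (P Y m) = 0); last first.
    exact: (congr1 (fun t : sec (DE E) => t m) (rho_P Y)).
  by rewrite (linear_fun0 (jev_linear mu)) scaler0.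
by rewrite z addr0 in H.
Qed.

Let P_eq X Y m : X m = Y m -> P X m = P Y m.
Proof. exact: (tensorial_eq frK P_linear P_fmul). Qed.

Let through m (k : K m) : {X : sec K | X m = k}.
Proof. exact/cid/sec_through. Qed.

Let Pm m (k : K m) : K m := P (sval (through k)) m.

Let PmE X m : Pm (X m) = P X m.
Proof. by apply: P_eq; case: through. Qed.

Let rho_Pm m (k : K m) : canchor S m (Pm k) = 0.
Proof. exact: (congr1 (fun t : sec (DE E) => t m) (rho_P _)). Qed.

Let Pm_linear m : linear (@Pm m).
Proof.
move=> a k l; have [X <-] := sec_through k frK; have [Y <-] := sec_through l frK.
by rewrite -[a *: X m + Y m]/(sev (a *: X + Y) m) !PmE P_linear.
Qed.

Let Pm_kernel m (k : K m) : canchor S m k = 0 -> Pm k = k.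
Proof. by have [X <-] := sec_through k frK; rewrite PmE; exact: P_kernel. Qed.

Let jetpart_ex m (k : K m) : exists mu : JE E m, star mu = Pm k.
Proof.
by have [mu H] := ex_mid SX (rho_Pm k); exists mu; rewrite -(star_uniq H).
Qed.

Let jetpart m (k : K m) : JE E m := sval (cid (jetpart_ex k)).

Let jetpartP m (k : K m) : star (jetpart k) = Pm k.
Proof. by rewrite /jetpart; case: cid. Qed.

Let lift m (d : DE E m) : {k : K m | canchor S m k = d}.
Proof. exact/cid/(ex_surj SX). Qed.

(** F is k |-> (rho k, mu) where mu has image [e, k] under [star]; its inverse
    lifts elements of DE to the kernel of P. *)
Let F m (k : K m) : dsum (DE E) (JE E) m := (canchor S m k, jetpart k).
Let G m (x : dsum (DE E) (JE E) m) : K m :=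
  sval (lift x.1) - Pm (sval (lift x.1)) + star x.2.

Let GE m (k : K m) (mu : JE E m) : G (canchor S m k, mu) = k - Pm k + star mu.
Proof.
rewrite /G /=; congr (_ + _); move: (lift _) => [l lk] /=.
have z : canchor S m (l - k : K m) = 0.
  by rewrite (linear_sub (@bfun_lin _ _ _ _ _ (canchor S) m)) lk subrr.
have := Pm_kernel z; rewrite (linear_sub (@Pm_linear m)) => H.
have -> : Pm l = Pm k + (l - k) by rewrite -H addrC subrK.
lincomb R (K m).
Qed.

Let FK m : cancel (@F m) (@G m).
Proof. by move=> k; rewrite /F GE jetpartP subrK. Qed.

Let GK m : cancel (@G m) (@F m).
Proof.
move=> [d mu]; have [k kd] := lift d; rewrite -kd GE /F.
have z : canchor S m (k - Pm k + star mu) = canchor S m k.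
  rewrite (linear_add (@bfun_lin _ _ _ _ _ (canchor S) m)).
  by rewrite (linear_sub (@bfun_lin _ _ _ _ _ (canchor S) m)) rho_Pm rho_star subr0 addr0.
congr (_, _); first exact: z.
apply: star_inj; rewrite jetpartP.
rewrite (linear_add (@Pm_linear m)) (linear_sub (@Pm_linear m)).
by rewrite (Pm_kernel (rho_Pm k)) subrr add0r Pm_kernel // rho_star.
Qed.

Let F_linear m : linear (@F m).
Proof.
move=> a k l; rewrite /F (@bfun_lin _ _ _ _ _ (canchor S) m).
rewrite (_ : jetpart (a *: k + l) = a *: jetpart k + jetpart l) //.
by apply: star_inj; rewrite star_linear !jetpartP Pm_linear.
Qed.

Let sq X Z : pair (br X X) Z = 2^-1 *: gact (rho Z) (pair X X).
Proof. by apply: sec_eq => m; exact: ec2 SC X m (Z m). Qed.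

Let polar X Y Z : pair (br X Y) Z + pair (br Y X) Z = gact (rho Z) (pair X Y).
Proof.
have := sq (X + Y) Z; rewrite !brDl !brDr !(pairDl, pairDr)
  !sq (pair_sym Y X) !gactD => H.
have -> : pair (br X Y) Z + pair (br Y X) Z =
   (2^-1 *: gact (rho Z) (pair X X) + pair (br X Y) Z +
     (pair (br Y X) Z + 2^-1 *: gact (rho Z) (pair Y Y)))
   - 2^-1 *: gact (rho Z) (pair X X) - 2^-1 *: gact (rho Z) (pair Y Y).
  lincomb R (sec E).
rewrite H; lincomb R (sec E).
Qed.

(** Polarization of [ec2]. It shows that [star], constructed point by point, is
    smooth on the jets of sections of the form (2 e, Y). *)
Let star_jet (Y : sec K) m : star (jet (pair (2 *: e) Y) m) = sev (br e Y + br Y e) m.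
Proof.
apply/esym/star_uniq => x; have [Z <-] := sec_through x frK.
rewrite -[LHS]/(pair (br e Y + br Y e) Z m) pairDl polar.
rewrite -[RHS]/(sev (2^-1 *: gact (rho Z) (pair (2 *: e) Y)) m).
by rewrite pairZl gactZ scalerA mulVf ?pnatr_eq0 // scale1r.
Qed.

(** On the fibre at m: as e lifts Id, the image under [star] of the jet of v
    pairs with 2 e to v(m). *)
Let pair_lift (u : sec E) : exists Y, pair (2 *: e) Y = u.
Proof.
apply: (lift_global locK frK frE (T := fun Y => pair (2 *: e) Y)).
- by move=> a X Y; rewrite pairDr pairZr.
- by move=> f X; rewrite pairfr.
move=> m w; have [v vw] := sec_through w frE.
have [Y YE] := sec_through (star (jet v m)) frK; exists Y.
rewrite pair_sym pairZr sevZ -[pair Y e m]/(cpair S m (Y m) (e m)) YE starP.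
rewrite scalerA mulfV ?pnatr_eq0 // scale1r jet_val.
rewrite (_ : canchor S m (e m) = gid E m);
  last exact: (congr1 (fun t : sec (DE E) => t m) rho_e).
by rewrite -gact_val gact_gid.
Qed.

(** JE is spanned locally by jets, to which [star_jet] and [pair_lift] apply. *)
Let star_smooth mu : smooth_sec K (fun m => star (mu m)).
Proof.
have sj u : smooth_sec K (fun m => star (jet u m)).
  have [Y <-] := pair_lift u.
  rewrite (_ : (fun m => _) = sval_of (br e Y + br Y e)); first exact: submP.
  by apply: functional_extensionality_dep => m; exact: star_jet.
apply: locK => m; have [W [I [t [Wm [oW _ _ co] tj]]]] := jet_spanned frE m.
have [c [sc cE]] := co mu.
have [g gE] := choice (fun i => smooth_near oW Wm (sc i)).
have st i : smooth_sec K (fun x => star (t i x)).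
  have [u [f [w ->]]] := tj i.
  have := submP (mksec (sj u) - fmul f (mksec (sj w))).
  rewrite (_ : sval_of _ = (fun x => star (sev (jet u - fmul f (jet w)) x))
    :> dprod K) //.
  apply: functional_extensionality_dep => x.
  rewrite -[LHS]/(star (jet u x) - f x *: star (jet w x)) -(linear_funZ _ _
    (@star_linear x)).
  by rewrite -(linear_sub (@star_linear x)).
exists (\sum_i fmul (g i) (mksec (st i))).
have nW : \forall x \near m, W x by exact: open_nbhs_nbhs.
have ng : \forall x \near m, forall i, g i x = c i x by exact: filter_forall.
apply: filterS2 nW ng => x Wx gx; rewrite cE // sev_sum
  (linear_fun_sum _ _ (@star_linear x)).
by apply: eq_bigr => i _; rewrite (linear_funZ _ _ (@star_linear x)) fmulE gx.
Qed.

Let jetpart_pair X Y m : jev (jetpart (X m)) (rho Y m) = 2 *: pair (P X) Y m.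
Proof.
have := starP (jetpart (X m)) (Y m); rewrite jetpartP PmE => H.
rewrite -[pair (P X) Y m]/(cpair S m (P X m) (Y m)) H scalerA mulfV ?pnatr_eq0 //.
by rewrite scale1r.
Qed.

Let G_smooth (s : dprod (dsum (DE E) (JE E))) :
  smooth_sec (dsum (DE E) (JE E)) s <-> smooth_sec K (fun m => G (s m)).
Proof.
split=> [ss|sG].
  pose s' : sec (dsum (DE E) (JE E)) := mksec ss.
  have [Y YE] := anchor_lift (pr1 s').
  have := submP (Y - P Y + mksec (star_smooth (pr2 s'))).
  rewrite (_ : sval_of _ = (fun m => G (s m)) :> dprod K) //;
    apply: functional_extensionality_dep => m.
  rewrite (surjective_pairing (s m)).
  rewrite (_ : (s m).1 = canchor S m (Y m)); last first.
    by rewrite -[RHS]/(rho Y m) YE.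
  by rewrite GE PmE.
pose X : sec K := mksec sG.
have sE m : s m = F (X m) by rewrite -[X m]/(G (s m)) GK.
split.
  rewrite (_ : (fun m => _) = sval_of (rho X)); first exact: submP.
  by apply: functional_extensionality_dep => m; rewrite sE.
move=> d; have [Y <-] := anchor_lift d.
rewrite (_ : (fun m => _) = sval_of (2 *: pair (P X) Y)); first exact: submP.
apply: functional_extensionality_dep => m.
by rewrite sE; exact: jetpart_pair.
Qed.

Let Fiso : biso (diffeo_id M) K (dsum (DE E) (JE E)) :=
  @BIso R n M (diffeo_id M) K (dsum (DE E) (JE E)) (@F) (@G) F_linear FK GK G_smooth.

Variables (S0 : courant_data E (dsum (DE E) (JE E))) (tw : twisted (zero_pair E) S0).

Lemma standard_form :
  exists F0 : biso (diffeo_id M) K (dsum (DE E) (JE E)), courant_iso S S0 (biso_id E) F0.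
Proof.
exists Fiso; have [aE pE bE] := tw; split.
- move=> m x y; rewrite -[LHS]/(cpair S0 m (F x) (F y)) -[RHS]/(cpair S m x y).
  rewrite pE /= addr0.
  have [X <-] := sec_through x frK; have [Y <-] := sec_through y frK.
  rewrite (jetpart_pair Y X m) (jetpart_pair X Y m) -scalerDr scalerA mulVf ?pnatr_eq0
    // scale1r.
  rewrite addrC (pair_sym (P Y)).
  exact: (congr1 (fun u : sec E => u m) (P_pair X Y)).
- move=> X Y X' Y' XX YY m.
  have E1 : pr1 X' = rho X by apply: sec_eq => x; rewrite -[LHS]/(X' x).1 (XX x).
  have E2 : pr1 Y' = rho Y by apply: sec_eq => x; rewrite -[LHS]/(Y' x).1 (YY x).
  have J1 Z : jpair (pr2 X') (rho Z) = 2 *: pair (P X) Z.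
    apply: sec_eq => x; rewrite jpair_val -[pr2 X' x]/(X' x).2 (XX x).
    exact: jetpart_pair.
  have J2 Z : jpair (pr2 Y') (rho Z) = 2 *: pair (P Y) Z.
    apply: sec_eq => x; rewrite jpair_val -[pr2 Y' x]/(Y' x).2 (YY x).
    exact: jetpart_pair.
  have [B1 B2] := bE X' Y'.
  have smF Z : smooth_sec (dsum (DE E) (JE E)) (fun x => F (Z x)).
    apply/G_smooth; rewrite (_ : (fun x => _) = sval_of Z); first exact: submP.
    by apply: functional_extensionality_dep => x; exact: FK.
  pose FB : sec (dsum (DE E) (JE E)) := mksec (smF (br X Y)).
  suff -> : cbr S0 X' Y' = FB by [].
  apply: dsum_sec_eq; first by rewrite B1 E1 E2 -rho_br; exact: sec_eq.
  apply: (jpair_inj frE) => s; rewrite B2; have [Z <-] := anchor_lift s.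
  have -> : jpair (pr2 FB) (rho Z) = 2 *: pair (P (br X Y)) Z.
    by apply: sec_eq => x; rewrite jpair_val; exact: jetpart_pair.
  rewrite -[LHS]/(omni_jet (pr1 X') (pr2 X') (pr1 Y') (pr2 Y') (rho Z) +
    jpair (bapp2 (apTh (zero_pair E)) (pr1 X') (pr1 Y')) (rho Z)).
  rewrite zero_bapp2 jpair0l addr0 omni_jetE E1 E2 -!rho_br !(J1, J2) !gactZ.
  (* P is a derivation of the bracket. *)
  rewrite [P (br X Y)](ec_leibniz SC e X Y) pairDl -[br e X]/(P X) -[br e Y]/(P Y).
  have H1 := inv X (P Y) Z; have H2 := inv Y (P X) Z; have H3 := polar (P X) Y Z.
  rewrite H1 H2 -H3; lincomb R (sec E).
- move=> m x u; rewrite -[LHS]/(gev (canchor S0 m (F x)) u) aE /=.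
  rewrite -[RHS]/(gev (canchor S m x) (pull (biso_id E) u)); congr (gev _ _).
  exact: sec_eq.
Qed.

End StandardForm.

(** * The classification *)

Section Classification.
Variables (R : realType) (n : nat) (M : manifold R n) (E : bundle M).
Hypothesis hE : vector_bundle E.

Let locE : local_sections E := vector_bundle_local hE.
Let frE : has_frames E := vector_bundle_frames hE.

Lemma exact_EC_standard S0 (A : exact_EC E) : twisted (zero_pair E) S0 ->
  exists F : biso (diffeo_id M) (ecK A) (dsum (DE E) (JE E)),
    courant_iso (ecS A) S0 (biso_id E) F.
Proof.
move=> tw; have [SC SX] := ecP A.
have [e e1] := anchor_lift frE SC SX (gid E).
exact: (standard_form frE SC SX e1 tw).
Qed.

Lemma exact_EC_isomorphic (A B : exact_EC E) : isomorphic A B.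
Proof.
have [S0 tw] := twisted_exists frE (zero_pair E).
have [F [Fp Fb Fa]] := exact_EC_standard A tw.
have [G [Gp Gb Ga]] := exact_EC_standard B tw.
have ginv m (y : dsum (DE E) (JE E) m) : G m (Defs.iinv G y) = y by exact: iinvK.
have Hl m : linear (fun x : ecK A m => Defs.iinv G (F m x) : ecK B m).
  move=> a x y; apply: (can_inj (@ifunK _ _ _ _ _ _ G m)).
  rewrite (@ifun_lin _ _ _ _ _ _ G m) !ginv.
  exact: (@ifun_lin _ _ _ _ _ _ F m).
have HK m : cancel (fun x : ecK A m => Defs.iinv G (F m x) : ecK B m)
  (fun y => Defs.iinv F (G m y)).
  by move=> x; rewrite ginv ifunK.
have KH m : cancel (fun y : ecK B m => Defs.iinv F (G m y))
  (fun x : ecK A m => Defs.iinv G (F m x)).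
  by move=> y; rewrite (iinvK F) (ifunK G).
have Hs (s : dprod (ecK B)) : smooth_sec (ecK B) s <->
    smooth_sec (ecK A) (fun m => Defs.iinv F (G m (s m))).
  rewrite -(ifun_smooth F (fun m => G m (s m))) (ifun_smooth G (fun m => G m (s m))).
  rewrite (_ : (fun m => Defs.iinv G (G _ (s _))) = s) //.
  by apply: functional_extensionality_dep => m; rewrite ifunK.
have push_both (X : sec (ecK A)) (X' : sec (ecK B)) :
    (forall m, X' m = Defs.iinv G (F m (X m))) -> exists FX, is_push F X FX /\
      is_push G X' FX.
  move=> XX; have sm : smooth_sec (dsum (DE E) (JE E)) (fun m => F m (X m)).
    apply/(ifun_smooth F); rewrite (_ : (fun m => _) = sval_of X); first exact: submP.
    by apply: functional_extensionality_dep => m; rewrite ifunK.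
  exists (mksec sm); split => // m.
  by rewrite XX ginv.
exists (diffeo_id M), (biso_id E),
  (@BIso R n M (diffeo_id M) (ecK A) (ecK B) _ _ Hl HK KH Hs); split.
- move=> m x y; rewrite -[LHS]/(cpair (ecS B) m (Defs.iinv G (F m x))
    (Defs.iinv G (F m y))).
  have := Gp m (Defs.iinv G (F m x)) (Defs.iinv G (F m y)); rewrite !ginv.
  by rewrite -[RHS]/(cpair (ecS B) m (Defs.iinv G (F m x)) (Defs.iinv G (F m y))) => <-;
    exact: Fp.
- move=> X Y X' Y' XX YY m.
  have [FX [FX1 FX2]] : exists FX, is_push F X FX /\ is_push G X' FX by exact: push_both.
  have [FY [FY1 FY2]] : exists FY, is_push F Y FY /\ is_push G Y' FY by exact: push_both.
  have := Fb _ _ _ _ FX1 FY1 m; rewrite (Gb _ _ _ _ FX2 FY2 m) => E1.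
  rewrite -[RHS]/(Defs.iinv G (F m (cbr (ecS A) X Y m))) -E1.
  by rewrite ifunK.
- move=> m x u; have pu : pull (biso_id E) u = u by exact: sec_eq.
  have := Ga m (Defs.iinv G (F m x)) u; rewrite ginv (Fa m x u) pu => H.
  by rewrite -[LHS]/(biso_id E m (gev (canchor (ecS B) m (Defs.iinv G (F m x))) u)) -H.
Qed.

Lemma isomorphicE (A : exact_EC E) : isomorphic A = fun=> True.
Proof.
by apply/funext => B; apply/propext; split => // _; exact: exact_EC_isomorphic.
Qed.

Lemma pair_equivE (p : admissible_pair E) : pair_equiv p = fun=> True.
Proof. by apply/funext => q; apply/propext; split => // _; exact: pairs_equiv. Qed.

Lemma twisted_exact_courant (p : admissible_pair E) S : twisted p S -> exact_courant S.
Proof. by move=> tw; split; [exact: twisted_courant tw|exact: twisted_is_exact tw]. Qed.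

Lemma exact_EC_corresponds (A : exact_EC E) : corresponds A (zero_pair E).
Proof.
have [S0 tw] := twisted_exists frE (zero_pair E).
by exists S0; split => //; exact: exact_EC_standard.
Qed.

Lemma exact_EC_exists : inhabited (exact_EC E).
Proof.
have [S0 tw] := twisted_exists frE (zero_pair E).
by constructor; exact: (ExactEC (twisted_exact_courant tw)).
Qed.

Lemma iso_classes_contr (c c' : iso_classes E) : c = c'.
Proof.
case: c c' => [C [A CA]] [C' [A' CA']]; apply: eq_exist.
by rewrite CA CA' !isomorphicE.
Qed.

Lemma pair_classes_contr (c c' : pair_classes E) : c = c'.
Proof.
case: c c' => [C [p Cp]] [C' [p' Cp']]; apply: eq_exist.
by rewrite Cp Cp' !pair_equivE.
Qed.

End Classification.

Theorem theorem5p4 (R : realType) (n : nat) (M : manifold R n) (E : bundle M)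
    (hE : vector_bundle E) :
  [/\ exists f : iso_classes E -> pair_classes E,
        bijective f /\
        forall A p, corresponds A p -> f (iso_class A) = pair_class p,
      forall A : exact_EC E, exists p, corresponds A p,
      forall p : admissible_pair E,
        (exists S, twisted p S) /\ (forall S, twisted p S -> exact_courant S)
    & forall (A B : exact_EC E) (p q : admissible_pair E),
        corresponds A p -> corresponds B q ->
        (isomorphic A B <-> pair_equiv p q)].
Proof.
split.
- have [A] := exact_EC_exists hE.
  exists (fun=> pair_class (zero_pair E)); split=> [|B p _];
    last exact: pair_classes_contr.
  exists (fun=> iso_class A) => c; first exact: (iso_classes_contr hE).
  exact: pair_classes_contr.
- by move=> A; exists (zero_pair E); exact: exact_EC_corresponds.
- move=> p; split=> [|S]; last exact: twisted_exact_courant.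
  exact: (twisted_exists (vector_bundle_frames hE)).
- move=> A B p q _ _; split=> _; first exact: pairs_equiv.
  exact: exact_EC_isomorphic.
Qed.
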